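(* Let $\Xi_\sigma(t):=\xi(\sigma-\mathrm{i}t)/\xi(\sigma)$, $t\in\mathbb{R}$. When $\sigma>1$, for all $t\in\mathbb{R}$, $$\Xi_\sigma(t)=\exp\left[\mathrm{i}t\lambda_\sigma+\int_0^\infty\left(e^{\mathrm{i}tx}-1-\mathrm{i}tx1_{D_{1/2}}(x)\right)\nu_\sigma(dx)\right],$$ where $$\lambda_\sigma:=\frac{e^{-\sigma/2}-1}{\sigma}+\frac{e^{(1-\sigma)/2}-1}{\sigma-1}+\frac{\log\pi}{2}+\frac12\int_0^1\left(\frac{e^{-\sigma x/2}}{1-e^{-x}}-\frac{e^{-x}}{x}\right)dx-\frac12\int_1^\infty e^{-x}\frac{dx}{x},$$ $$\nu_\sigma(dx):=\frac{1}{x e^{\sigma x}(1-e^{-2x})}\,(dx)-\frac{1+e^x}{x e^{\sigma x}}\,(dx)+\sum_{p}\sum_{r=1}^\infty\frac{p^{-r\sigma}}{r}\,\delta_{r\log p}(dx).$$ Therefore, the characteristic function $\Xi_\sigma(t)$ is not infinitely divisible but is quasi-infinitely divisible when $\sigma>1$.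
   Context: $\zeta(s)$ is the Riemann zeta function, $\Gamma(s)$ is the Gamma function, and $\xi(s):=s(s-1)\pi^{-s/2}\Gamma(s/2)\zeta(s)$. For every $\sigma\in\mathbb{R}$, $\Xi_\sigma$ is the characteristic function of a probability distribution on $\mathbb{R}$; the characteristic function of $\mu$ is $\widehat{\mu}(t)=\int_{\mathbb{R}}e^{\mathrm{i}tx}\mu(dx)$. The sum $\sum_p$ is over all prime numbers, $\delta_x$ is the unit (Dirac) mass at $x$, and the terms of $\nu_\sigma$ of the form $g(x)(dx)$ are absolutely continuous with density $g$ on $(0,\infty)$; $\nu_\sigma$ lives on $(0,\infty)$. For $b>0$ put $D_b:=\{x\in\mathbb{R}:-b\le x\le b\}$, with indicator function $1_{D_b}$. A probability measure $\mu$ on $\mathbb{R}$ is infinitely divisible if for every positive integer $n$ there is a probability measure $\mu_n$ with $\mu=\mu_n^{n*}$ ($n$-fold convolution). A distribution $\mu$ on $\mathbb{R}$ is called quasi-infinitely divisible if $$\widehat{\mu}(t)=\exp\left[-\frac{a}{2}t^2+\mathrm{i}\lambda t+\int_{\mathbb{R}}\left(e^{\mathrm{i}tx}-1-\mathrm{i}tx1_{D_b}(x)\right)\nu(dx)\right],\qquad t\in\mathbb{R},$$ with $a,\lambda\in\mathbb{R}$ and $\nu$ a signed measure on $\mathbb{R}$ whose total variation measure $|\nu|$ satisfies $\int_{\mathbb{R}}(|x|^2\wedge1)\,|\nu|(dx)<\infty$, and $\nu(\{0\})=0$ (here, as for Lévy measures, $|\nu|$ may have infinite mass near $0$). A characteristic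 function is called infinitely divisible or quasi-infinitely divisible if its distribution is. *)

(* Defs.v *)
From HB Require Import structures.
From mathcomp Require Import all_boot all_order all_algebra.
From mathcomp Require Import complex.
From mathcomp Require Import all_classical all_reals all_analysis measurable_realfun.

Set Implicit Arguments.
Unset Strict Implicit.
Unset Printing Implicit Defensive.

Import Order.TTheory GRing.Theory Num.Theory.
Import numFieldNormedType.Exports.

Local Open Scope classical_set_scope.
Local Open Scope ring_scope.
Local Open Scope complex_scope.

Section complex_analysis.
Context {R : realType}.

Definition cexp (z : R[i]) : R[i] :=
  let: a +i* b := z in (expR a * cos b) +i* (expR a * sin b).

(* [x ^ s] with the real logarithm; only meaningful for [0 < x]. *)
Definition cpow (x : R) (s : R[i]) : R[i] := cexp ((ln x)%:C * s).

Definition Cintegral d (T : measurableType d) (mu : {measure set T -> \bar R})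
    (D : set T) (f : T -> R[i]) : R[i] :=
  (\int[mu]_(x in D) complex.Re (f x)) +i* (\int[mu]_(x in D) complex.Im (f x)).

(* Euler's integral: the Gamma function on [Re s > 0]. *)
Definition Gamma (s : R[i]) : R[i] :=
  Cintegral (@lebesgue_measure R) `]0, +oo[
    (fun x : R => cpow x (s - 1) * (expR (- x))%:C).

(* Dirichlet series: the Riemann zeta function on [Re s > 1]. *)
Definition zeta (s : R[i]) : R[i] :=
  limn (series (fun n => cpow n.+1%:R (- s) : R[i]^o)).

Definition xi (s : R[i]) : R[i] :=
  s * (s - 1) * cpow pi (- (s / 2)) * Gamma (s / 2) * zeta s.

Definition Xi (sigma t : R) : R[i] := xi (sigma -i* t) / xi sigma%:C.

End complex_analysis.

Section distributions_on_the_line.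
Context {R : realType}.
Local Notation T := (measurableTypeR R).
Implicit Types (mu nu : probability T R) (P N : {measure set T -> \bar R}).

Definition charfun mu (t : R) : R[i] :=
  Cintegral mu setT (fun x : R => cexp ((t * x)*i)).

Definition sum2 (z : T * T) : T := (z.1 : R) + (z.2 : R).

Lemma measurable_sum2 : measurable_fun setT sum2.
Proof.
by apply: measurable_funD; [exact: measurable_fst|exact: measurable_snd].
Qed.

HB.instance Definition _ := isMeasurableFun.Build _ _ _ _ sum2 measurable_sum2.

Definition convolution mu nu : probability T R :=
  distribution (mu \x nu)%E sum2.

Fixpoint convolution_power mu (n : nat) : probability T R :=
  if n is n'.+1 then convolution mu (convolution_power mu n') else \d_(0 : T).

Definition infinitely_divisible mu : Prop :=
  forall n : nat, (0 < n)%N -> exists mun : probability T R,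
    forall A : set T, measurable A -> mu A = convolution_power mun n A.

(* Integral against the signed measure [P - N].  As [|P - N|] may be infinite
   near [0], such a signed measure is kept as a pair of positive measures; the
   integral does not depend on the pair as long as [f] is integrable for both
   [P] and [N]. *)
Definition signed_integral P N (D : set T) (f : T -> R[i]) : R[i] :=
  Cintegral P D f - Cintegral N D f.

(* [(P, N)] is then the Jordan decomposition of [P - N], and the total
   variation measure [|P - N|] is [P + N]. *)
Definition mutually_singular P N : Prop :=
  exists2 H : set T, measurable H & P (~` H) = 0%E /\ N H = 0%E.

(* e^{itx} - 1 - itx 1_{[-b, b]}(x) *)
Definition LK_integrand (b t x : R) : R[i] :=
  cexp ((t * x)*i) - 1 - (t * x * \1_(`[- b, b] : set R) x)*i.

Definition quasi_infinitely_divisible (b : R) mu : Prop :=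
  exists (a lam : R) (P N : {measure set T -> \bar R}),
  [/\ mutually_singular P N,
      (\int[measure_add P N]_x (Num.min (`|x : R| ^+ 2) 1)%:E < +oo)%E,
      P [set 0] = 0%E /\ N [set 0] = 0%E &
      forall t : R, charfun mu t =
        cexp ((- (a / 2 * t ^+ 2))%:C + (t * lam)*i
              + signed_integral P N setT (LK_integrand b t))].

End distributions_on_the_line.

Section density_measure.
Context {R : realType}.
Local Notation T := (measurableTypeR R).
Local Open Scope ereal_scope.
Variable g : R -> R.
Hypothesis mg : measurable_fun (setT : set T) g.
Hypothesis g0 : forall x, (0 <= g x)%R.

(* [mg] and [g0] are arguments so that the measure structure can be inferred. *)
Definition density_measure of measurable_fun (setT : set T) g &
    (forall x, (0 <= g x)%R) : set T -> \bar R := fun A =>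
  \int[@lebesgue_measure R]_(x in A) (g x)%:E.

Local Notation dens := (density_measure mg g0).

Let dens0 : dens set0 = 0.
Proof. by rewrite /density_measure integral_set0. Qed.

Let dens_ge0 A : 0 <= dens A.
Proof. by apply: integral_ge0 => x _; rewrite lee_fin. Qed.

Let dens_sigma_additive : semi_sigma_additive dens.
Proof.
by apply: semi_sigma_additive_nng_induced => //; exact/measurable_EFinP.
Qed.

HB.instance Definition _ := isMeasure.Build _ _ _ dens
  dens0 dens_ge0 dens_sigma_additive.

End density_measure.

Section nu_sigma.
Context {R : realType}.
Variable sigma : R.
Local Notation T := (measurableTypeR R).

Definition gamma_density (x : R) : R :=
  (x * expR (sigma * x) * (1 - expR (- (2 * x))))^-1 * \1_(`]0, +oo[ : set R) x.

Definition pole_density (x : R) : R :=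
  (1 + expR x) / (x * expR (sigma * x)) * \1_(`]0, +oo[ : set R) x.

Let measurable_invr : measurable_fun (setT : set T) (fun x : R => x^-1).
Proof.
have mC : measurable (~` [set (0 : R)] : set T) by exact: measurableC.
rewrite -(setvU [set (0 : R)]); apply/measurable_funU => //; split; last first.
  exact: measurable_fun_set1.
apply: open_continuous_measurable_fun.
  apply/closed_openC/accessible_closed_set1/hausdorff_accessible.
  exact: norm_hausdorff.
by move=> x /[!inE]/= /eqP x0; exact: inv_continuous.
Qed.

Let measurable_expRM (c : R) :
  measurable_fun (setT : set T) (fun x : R => expR (c * x)).
Proof. by apply: measurableT_comp => //; exact: measurable_funM. Qed.

Lemma measurable_gamma_density : measurable_fun (setT : set T) gamma_density.
Proof.
apply: measurable_funM; last exact: measurable_indic.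
apply: (measurableT_comp measurable_invr); apply: measurable_funM.
  by apply: measurable_funM => //; exact: measurable_expRM.
apply: measurable_funB => //.
by under eq_fun do rewrite -mulNr; exact: measurable_expRM.
Qed.

Lemma gamma_density_ge0 x : 0 <= gamma_density x.
Proof.
rewrite /gamma_density indicE; case: (boolP (x \in _)); last by rewrite mulr0.
rewrite inE/= in_itv/= andbT mulr1 => x0.
by rewrite invr_ge0 !mulr_ge0 ?expR_ge0 ?(ltW x0)// subr_ge0 -expR0 ler_expR
           oppr_le0 mulr_ge0 ?(ltW x0).
Qed.

Lemma measurable_pole_density : measurable_fun (setT : set T) pole_density.
Proof.
apply: measurable_funM; last exact: measurable_indic.
apply: measurable_funM; first exact: measurable_funD.
apply: (measurableT_comp measurable_invr).
by apply: measurable_funM => //; exact: measurable_expRM.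
Qed.

Lemma pole_density_ge0 x : 0 <= pole_density x.
Proof.
rewrite /pole_density indicE; case: (boolP (x \in _)); last by rewrite mulr0.
rewrite inE/= in_itv/= andbT mulr1 => x0.
by rewrite divr_ge0 ?addr_ge0 ?mulr_ge0 ?expR_ge0 ?(ltW x0).
Qed.

Lemma prime_weight_ge0 (p r : nat) : 0 <= p%:R `^ (- (r%:R * sigma)) / r%:R :> R.
Proof. by rewrite divr_ge0 ?powR_ge0. Qed.

Definition prime_power_atom (p r : nat) : {measure set T -> \bar R} :=
  mscale (NngNum (prime_weight_ge0 p r)) \d_(r%:R * ln p%:R : T).

Definition prime_atoms (p : nat) : {measure set T -> \bar R} :=
  if prime p then (mseries (prime_power_atom p) 1 : {measure set T -> \bar R})
  else (mzero : {measure set T -> \bar R}).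

(* The signed measure nu_sigma is [nu_pos - nu_neg]: the pair separates the
   positive and the negative terms of its definition and is not its Jordan
   decomposition. *)
Definition nu_pos : {measure set T -> \bar R} :=
  measure_add (density_measure measurable_gamma_density gamma_density_ge0)
    (mseries prime_atoms 0).

Definition nu_neg : {measure set T -> \bar R} :=
  density_measure measurable_pole_density pole_density_ge0.

Definition lambda : R :=
  (expR (- (sigma / 2)) - 1) / sigma
  + (expR ((1 - sigma) / 2) - 1) / (sigma - 1)
  + ln pi / 2
  + 2^-1 * (\int[lebesgue_measure]_(x in `[0, 1])
              (expR (- (sigma * x / 2)) / (1 - expR (- x)) - expR (- x) / x))
  - 2^-1 * (\int[lebesgue_measure]_(x in `[1, +oo[) (expR (- x) / x)).

End nu_sigma.

(* Main.v *)
(** Each factor of xi(s) contributes one piece of the Levy-Khintchine form on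
    Re s > 1. For a linear factor, (1 - it/a) exp (int_0^oo (e^{itx} - 1) e^{-ax} dx/x)
    has derivative 0 in t. Gamma(s/2) is Euler's limit of N^z N! / (z (z+1) ... (z+N)):
    each linear factor is treated as before, the kernels e^{-(sigma+2k)x}/x add up to
    the first density of nu, and the drift comes from Malmsten's integral, obtained
    by writing ln N as a Frullani integral. zeta is an Euler product, and for each prime
    the derivative argument is repeated with the atoms at r log p.

    Splitting the difference of the two densities into positive and negative parts
    gives mutually singular measures P (with the atoms) and N (without), hence
    quasi-infinite divisibility.

    If the law were infinitely divisible with Levy exponent psi, comparing with its
    n-th convolution roots would give int q dP >= int q dN for every nonnegative cosine
    polynomial q with q(0) = 0. By dominated convergence this extends to
    q = (1 - cos x) exp (-M (x^2 - c^2)^2) with c = log (5/2). Near c there are no atoms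
    and the density of nu is negative, so as M goes to infinity the N-integral
    exceeds the P-integral, a contradiction. *)

Require Import Defs.
From mathcomp Require Import all_boot all_order all_algebra.
From mathcomp Require Import complex.
From mathcomp Require Import all_classical all_reals all_analysis measurable_realfun.
From mathcomp Require Import ring lra.

Set Implicit Arguments.
Unset Strict Implicit.
Unset Printing Implicit Defensive.

Import Order.TTheory GRing.Theory Num.Theory.
Import numFieldNormedType.Exports.

Local Open Scope classical_set_scope.
Local Open Scope ring_scope.
Local Open Scope complex_scope.

(** * Complex exponential and complex integrals *)

(** No complex logarithm is ever taken. Linear and Euler factors are compared with their value at t
    = 0 through identities of the form w exp F = constant, limits are taken of whole products, and
    convolution roots are handled through squared moduli, so that no branch has to be chosen or
    followed. The densities need care at 0. The first one behaves like 1/(2 x^2), so only functions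
    of order min(x^2, 1) can be integrated against it. Its summands e^{-ax}/x are milder, because x
    times them is integrable: they are treated without the truncation term, which is put back
    afterwards and produces the drift terms (1 - e^{-a/2})/a. Failure of infinite divisibility is
    usually read off from uniqueness of the signed Levy triplet; here an inequality between
    integrals takes its place. The factor 1 - cos x of the test function serves twice: it vanishes
    at 0, so that the coefficients of the cosine polynomials sum to 0, and it is integrable for P
    and N, so that it dominates every approximation. The point log (5/2) lies between log 2 and log
    3, and near it e^x is above 2, which makes the pole density outweigh the Gamma density. *)

Section complex_toolkit.
Context {R : realType}.
Implicit Types (z w : R[i]) (u v : nat -> R[i]).

Lemma complexP z w :
  complex.Re z = complex.Re w -> complex.Im z = complex.Im w -> z = w.
Proof. by case: z => a b; case: w => c d /= -> ->. Qed.

Lemma ReD z w : complex.Re (z + w) = complex.Re z + complex.Re w.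
Proof. by case: z => a b; case: w. Qed.
Lemma ImD z w : complex.Im (z + w) = complex.Im z + complex.Im w.
Proof. by case: z => a b; case: w. Qed.
Lemma ReN z : complex.Re (- z) = - complex.Re z.
Proof. by case: z. Qed.
Lemma ImN z : complex.Im (- z) = - complex.Im z.
Proof. by case: z. Qed.
Lemma ReB z w : complex.Re (z - w) = complex.Re z - complex.Re w.
Proof. by case: z => a b; case: w. Qed.
Lemma ImB z w : complex.Im (z - w) = complex.Im z - complex.Im w.
Proof. by case: z => a b; case: w. Qed.
Lemma ReM z w : complex.Re (z * w) =
  complex.Re z * complex.Re w - complex.Im z * complex.Im w.
Proof. by case: z => a b; case: w. Qed.
Lemma ImM z w : complex.Im (z * w) =
  complex.Re z * complex.Im w + complex.Im z * complex.Re w.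
Proof. by case: z => a b; case: w. Qed.

Lemma cexpD z w : cexp (z + w) = cexp z * cexp w.
Proof.
case: z => a b; case: w => c d; apply: complexP => /=;
  rewrite ?ReM ?ImM expRD ?cosD ?sinD /=; ring.
Qed.

Lemma cexp0 : cexp (0 : R[i]) = 1.
Proof. by apply: complexP; rewrite /= expR0 ?cos0 ?sin0 ?mulr1 ?mulr0. Qed.

Lemma cexpN z : cexp (- z) = (cexp z)^-1.
Proof.
have h : cexp z * cexp (- z) = 1 by rewrite -cexpD subrr cexp0.
have z0 : cexp z != 0.
  by apply/eqP => z0; move: h; rewrite z0 mul0r => /esym/eqP; rewrite oner_eq0.
by apply: (mulfI z0); rewrite h divff.
Qed.

Lemma cexp_neq0 z : cexp z != 0.
Proof.
apply/eqP => z0; have := cexpD z (- z); rewrite z0 mul0r subrr cexp0.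
by move/eqP; rewrite oner_eq0.
Qed.

Lemma cexp_sum n (f : nat -> R[i]) :
  cexp (\sum_(k < n) f k) = \prod_(k < n) cexp (f k).
Proof.
elim: n => [|n IH]; first by rewrite !big_ord0 cexp0.
by rewrite !big_ord_recr /= cexpD IH.
Qed.

Lemma Re_cexp z : complex.Re (cexp z) = expR (complex.Re z) * cos (complex.Im z).
Proof. by case: z. Qed.
Lemma Im_cexp z : complex.Im (cexp z) = expR (complex.Re z) * sin (complex.Im z).
Proof. by case: z. Qed.

(** Componentwise convergence, so that limit theorems on the real line apply directly. The norm
    topology of [R[i]] is met only once, when [zeta] is identified as a limit. *)
Definition ccvg u (l : R[i]) :=
  (complex.Re (u n) @[n --> \oo] --> complex.Re l) /\
  (complex.Im (u n) @[n --> \oo] --> complex.Im l).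

Lemma ccvg_unique u l l' : ccvg u l -> ccvg u l' -> l = l'.
Proof.
move=> [h1 h2] [h3 h4]; apply: complexP.
- exact: cvg_unique h1 h3.
- exact: cvg_unique h2 h4.
Qed.

Lemma ccvg_cst l : ccvg (fun=> l) l.
Proof. by split; exact: cvg_cst. Qed.

Lemma ccvgD u v l l' : ccvg u l -> ccvg v l' -> ccvg (fun n => u n + v n) (l + l').
Proof.
move=> [h1 h2] [h3 h4]; split.
- by rewrite ReD; under eq_fun do rewrite ReD; exact: cvgD.
- by rewrite ImD; under eq_fun do rewrite ImD; exact: cvgD.
Qed.

Lemma ccvgM u v l l' : ccvg u l -> ccvg v l' -> ccvg (fun n => u n * v n) (l * l').
Proof.
move=> [h1 h2] [h3 h4]; split.
- by rewrite ReM; under eq_fun do rewrite ReM; apply: cvgB; exact: cvgM.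
- by rewrite ImM; under eq_fun do rewrite ImM; apply: cvgD; exact: cvgM.
Qed.

Lemma ccvg_cexp u l : ccvg u l -> ccvg (fun n => cexp (u n)) (cexp l).
Proof.
move=> [h1 h2]; split.
- rewrite Re_cexp; under eq_fun do rewrite Re_cexp.
  apply: cvgM.
  + by apply: continuous_cvg => //; exact: continuous_expR.
  + by apply: continuous_cvg => //; exact: continuous_cos.
- rewrite Im_cexp; under eq_fun do rewrite Im_cexp.
  apply: cvgM.
  + by apply: continuous_cvg => //; exact: continuous_expR.
  + by apply: continuous_cvg => //; exact: continuous_sin.
Qed.

Lemma ccvg_shiftS u l : ccvg u l -> ccvg (fun n => u n.+1) l.
Proof. by move=> [h1 h2]; split; rewrite (@cvg_shiftS _ (fun n => _ (u n))). Qed.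

End complex_toolkit.

Section complex_integral.
Context {R : realType} d (T : measurableType d) (mu : {measure set T -> \bar R})
  (D : set T) (mD : measurable D).
Implicit Types (f g : T -> R[i]) (h : T -> R).

Definition cintegrable f :=
  mu.-integrable D (EFin \o (fun x => complex.Re (f x))) /\
  mu.-integrable D (EFin \o (fun x => complex.Im (f x))).

Lemma le_real_integrable h h' : measurable_fun D h ->
  mu.-integrable D (EFin \o h') -> (forall x, D x -> `|h x| <= h' x) ->
  mu.-integrable D (EFin \o h).
Proof.
move=> mh ih' hh'; apply: le_integrable ih' => //.
- exact/measurable_EFinP.
- by move=> x Dx; rewrite /= lee_fin (le_trans (hh' _ Dx))// ler_norm.
Qed.

Lemma dominated_Rintegral (h_ : nat -> T -> R) h h' :
  (forall n, measurable_fun D (h_ n)) ->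
  (forall x, D x -> h_ n x @[n --> \oo] --> h x) ->
  mu.-integrable D (EFin \o h') ->
  (forall n x, D x -> `|h_ n x| <= h' x) ->
  mu.-integrable D (EFin \o h) /\
  (\int[mu]_(x in D) h_ n x @[n --> \oo] --> \int[mu]_(x in D) h x).
Proof.
move=> mh hh ih' hle.
have cv x : D x -> ((h_ n x)%:E @[n --> \oo] --> (h x)%:E)%E.
  by move=> Dx; apply: cvg_EFin; [exact: nearW|exact: hh].
have mE n : measurable_fun D (EFin \o h_ n) by exact/measurable_EFinP.
have bd n x : D x -> (`|(EFin \o h_ n) x| <= (EFin \o h') x)%E.
  by move=> Dx; rewrite lee_fin; exact: hle.
have mE0 : measurable_fun D (EFin \o h).
  exact: (emeasurable_fun_cvg (fun n => EFin \o h_ n)) mE cv.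
have [ih _ ch] := @dominated_convergence _ _ _ mu D mD (fun n => EFin \o h_ n) (EFin \o h)
  (EFin \o h') mE mE0 (aeW _ cv) ih' (aeW _ (fun x n => @bd n x)).
split => //.
by apply: fine_cvg; rewrite fineK; last exact: integrable_fin_num.
Qed.

Lemma eq_Cintegral f g : {in D, f =1 g} -> Cintegral mu D f = Cintegral mu D g.
Proof.
by move=> fg; congr Complex; apply: eq_Rintegral => x Dx; rewrite fg.
Qed.

Lemma eq_cintegrable f g : {in D, f =1 g} -> cintegrable f -> cintegrable g.
Proof.
move=> fg [h1 h2]; split; [move: h1|move: h2]; apply: eq_integrable => //= x Dx;
  by rewrite /= fg.
Qed.

Lemma le_cintegrable f h : measurable_fun D (fun x => complex.Re (f x)) ->
  measurable_fun D (fun x => complex.Im (f x)) ->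
  mu.-integrable D (EFin \o h) ->
  (forall x, D x -> `|complex.Re (f x)| <= h x) ->
  (forall x, D x -> `|complex.Im (f x)| <= h x) -> cintegrable f.
Proof. by move=> m1 m2 ih l1 l2; split; exact: (le_real_integrable _ ih). Qed.

Lemma real_integrableD (h1 h2 : T -> R) : mu.-integrable D (EFin \o h1) ->
  mu.-integrable D (EFin \o h2) ->
  mu.-integrable D (EFin \o (fun x => h1 x + h2 x)).
Proof. by move=> i1 i2; have := integrableD mD i1 i2; apply: eq_integrable. Qed.

Lemma real_integrableB (h1 h2 : T -> R) : mu.-integrable D (EFin \o h1) ->
  mu.-integrable D (EFin \o h2) ->
  mu.-integrable D (EFin \o (fun x => h1 x - h2 x)).
Proof. by move=> i1 i2; have := integrableB mD i1 i2; apply: eq_integrable. Qed.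

Lemma real_integrableZl (k : R) (h1 : T -> R) : mu.-integrable D (EFin \o h1) ->
  mu.-integrable D (EFin \o (fun x => k * h1 x)).
Proof. by move=> i1; have := integrableZl mD k i1; apply: eq_integrable. Qed.

Lemma cintegrableD f g : cintegrable f -> cintegrable g ->
  cintegrable (fun x => f x + g x).
Proof.
move=> [f1 f2] [g1 g2]; split.
- by under [fun x => _]eq_fun do rewrite ReD; exact: real_integrableD.
- by under [fun x => _]eq_fun do rewrite ImD; exact: real_integrableD.
Qed.

Lemma CintegralD f g : cintegrable f -> cintegrable g ->
  Cintegral mu D (fun x => f x + g x) = Cintegral mu D f + Cintegral mu D g.
Proof.
move=> [f1 f2] [g1 g2]; apply: complexP; rewrite ?ReD ?ImD /= -RintegralD //.
- by apply: eq_Rintegral => x _; rewrite ReD.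
- by apply: eq_Rintegral => x _; rewrite ImD.
Qed.

Lemma cintegrableZl (c : R[i]) f : cintegrable f ->
  cintegrable (fun x => c * f x).
Proof.
move=> [f1 f2]; split.
- by under [fun x => _]eq_fun do rewrite ReM; apply: real_integrableB; exact: real_integrableZl.
- by under [fun x => _]eq_fun do rewrite ImM; apply: real_integrableD; exact: real_integrableZl.
Qed.

Lemma CintegralZl (c : R[i]) f : cintegrable f ->
  Cintegral mu D (fun x => c * f x) = c * Cintegral mu D f.
Proof.
move=> [f1 f2]; apply: complexP; rewrite ?ReM ?ImM /=.
- rewrite -!RintegralZl// -RintegralB//; try exact: real_integrableZl.
  by apply: eq_Rintegral => x _; rewrite ReM.
- rewrite -!RintegralZl// -RintegralD//; try exact: real_integrableZl.
  by apply: eq_Rintegral => x _; rewrite ImM.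
Qed.

Lemma CintegralB f g : cintegrable f -> cintegrable g ->
  Cintegral mu D (fun x => f x - g x) = Cintegral mu D f - Cintegral mu D g.
Proof.
move=> hf hg; rewrite -mulN1r -CintegralZl// -CintegralD//; last exact: cintegrableZl.
by apply: eq_Cintegral => x _; rewrite mulN1r.
Qed.

Lemma cintegrableB f g : cintegrable f -> cintegrable g ->
  cintegrable (fun x => f x - g x).
Proof.
move=> hf hg; have := cintegrableD hf (cintegrableZl (-1) hg).
by apply: eq_cintegrable => x _ /=; rewrite mulN1r.
Qed.

Lemma cintegrable_sum n (f_ : nat -> T -> R[i]) :
  (forall k, cintegrable (f_ k)) -> cintegrable (fun x => \sum_(k < n) f_ k x).
Proof.
move=> hf; elim: n => [|n IH].
  apply: (@eq_cintegrable (fun=> 0)); first by move=> x _; rewrite big_ord0.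
  by split; exact: integrable0.
apply: (@eq_cintegrable (fun x => \sum_(k < n) f_ k x + f_ n x)).
  by move=> x _; rewrite big_ord_recr.
exact: cintegrableD.
Qed.

Lemma Cintegral_sum n (f_ : nat -> T -> R[i]) :
  (forall k, cintegrable (f_ k)) ->
  Cintegral mu D (fun x => \sum_(k < n) f_ k x) = \sum_(k < n) Cintegral mu D (f_ k).
Proof.
move=> hf; elim: n => [|n IH].
  rewrite big_ord0 (@eq_Cintegral _ (fun=> 0)).
    by apply: complexP; rewrite /= Rintegral_cst// mul0r.
  by move=> x _; rewrite big_ord0.
rewrite big_ord_recr -IH /=.
rewrite -(CintegralD (cintegrable_sum n hf) (hf n)).
by apply: eq_Cintegral => x _; rewrite big_ord_recr.
Qed.

Lemma dominated_Cintegral (f_ : nat -> T -> R[i]) f h :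
  (forall n, measurable_fun D (fun x => complex.Re (f_ n x))) ->
  (forall n, measurable_fun D (fun x => complex.Im (f_ n x))) ->
  (forall x, D x -> ccvg (f_^~ x) (f x)) ->
  mu.-integrable D (EFin \o h) ->
  (forall n x, D x -> `|complex.Re (f_ n x)| <= h x) ->
  (forall n x, D x -> `|complex.Im (f_ n x)| <= h x) ->
  cintegrable f /\ ccvg (fun n => Cintegral mu D (f_ n)) (Cintegral mu D f).
Proof.
move=> m1 m2 cv ih b1 b2.
have [|i1 c1] := @dominated_Rintegral _ (fun x => complex.Re (f x)) _ m1 _ ih b1.
  by move=> x /cv[].
have [|i2 c2] := @dominated_Rintegral _ (fun x => complex.Im (f x)) _ m2 _ ih b2.
  by move=> x /cv[].
by split; split.
Qed.

End complex_integral.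

(** * Real derivatives and a linear differential equation *)

Section derivatives.
Context {R : realType}.
Implicit Types f g : R -> R.

Lemma is_deriveMr f g t a b : is_derive t (1 : R) f a -> is_derive t (1 : R) g b ->
  is_derive t (1 : R) (fun x => f x * g x) (a * g t + f t * b).
Proof.
by move=> hf hg; apply: is_derive_eq (is_deriveM hf hg) _; rewrite /GRing.scale /=; ring.
Qed.

Lemma is_deriveDr f g t a b : is_derive t (1 : R) f a -> is_derive t (1 : R) g b ->
  is_derive t (1 : R) (fun x => f x + g x) (a + b).
Proof. by move=> hf hg; exact: is_deriveD. Qed.

Lemma is_deriveBr f g t a b : is_derive t (1 : R) f a -> is_derive t (1 : R) g b ->
  is_derive t (1 : R) (fun x => f x - g x) (a - b).
Proof. by move=> hf hg; exact: is_deriveB. Qed.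

Lemma is_derive_cstM c f t a : is_derive t (1 : R) f a ->
  is_derive t (1 : R) (fun x => c * f x) (c * a).
Proof. by move=> hf; exact: is_deriveZ. Qed.

Lemma is_derive_exp f t a : is_derive t (1 : R) f a ->
  is_derive t (1 : R) (fun x => expR (f x)) (a * expR (f t)).
Proof.
move=> hf; have h := is_derive1_comp (is_derive_expR (f t)) hf.
by apply: is_derive_eq h _; rewrite mulrC.
Qed.

Lemma is_derive_cosr f t a : is_derive t (1 : R) f a ->
  is_derive t (1 : R) (fun x => cos (f x)) (- (a * sin (f t))).
Proof.
move=> hf; have h := is_derive1_comp (is_derive_cos (f t)) hf.
by apply: is_derive_eq h _; rewrite mulNr mulrC.
Qed.

Lemma is_derive_sinr f t a : is_derive t (1 : R) f a ->
  is_derive t (1 : R) (fun x => sin (f x)) (a * cos (f t)).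
Proof.
move=> hf; have h := is_derive1_comp (is_derive_sin (f t)) hf.
by apply: is_derive_eq h _; rewrite mulrC.
Qed.

Lemma is_derive_cstr (c t : R) : is_derive t (1 : R) (fun=> c) 0.
Proof. exact: is_derive_cst. Qed.

Lemma is_derive_mulr_id (x t : R) : is_derive t (1 : R) (fun s => s * x) x.
Proof.
apply: is_derive_eq (is_deriveMr (is_derive_id t (1 : R)) (is_derive_cstr x t)) _.
by rewrite mulr0 addr0 mul1r.
Qed.

End derivatives.
Arguments is_derive_cstr {R} c t.
Arguments is_derive_mulr_id {R} x t.

Section ode.
Context {R : realType}.

(* The two hypotheses on derivatives say [w' + w F' = 0] for [w = u + iv] and
   [F = C + iS], so that [w exp F] is constant. *)
Lemma mul_cexp_cst (u v C S u' v' C' S' : R -> R) :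
  (forall t, is_derive t (1 : R) u (u' t)) -> (forall t, is_derive t (1 : R) v (v' t)) ->
  (forall t, is_derive t (1 : R) C (C' t)) -> (forall t, is_derive t (1 : R) S (S' t)) ->
  (forall t, u' t + C' t * u t - S' t * v t = 0) ->
  (forall t, v' t + C' t * v t + S' t * u t = 0) ->
  forall t, (u t +i* v t) * cexp (C t +i* S t) = (u 0 +i* v 0) * cexp (C 0 +i* S 0).
Proof.
move=> du dv dC dS h1 h2 t.
(* [P] and [Q] are the real and imaginary parts of w exp F. The derivative of each is a combination
   of the left-hand sides of the two hypotheses, hence 0. *)
pose P x := expR (C x) * (u x * cos (S x) - v x * sin (S x)).
pose Q x := expR (C x) * (u x * sin (S x) + v x * cos (S x)).
have dP (x : R) : is_derive x (1 : R) P 0.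
  apply: is_derive_eq (is_deriveMr (is_derive_exp (dC x))
    (is_deriveBr
      (is_deriveMr (du x) (is_derive_cosr (dS x)))
      (is_deriveMr (dv x) (is_derive_sinr (dS x))))) _.
  transitivity (expR (C x) * ((u' x + C' x * u x - S' x * v x) * cos (S x)
    - (v' x + C' x * v x + S' x * u x) * sin (S x))); last by rewrite h1 h2; ring.
  ring.
have dQ (x : R) : is_derive x (1 : R) Q 0.
  apply: is_derive_eq (is_deriveMr (is_derive_exp (dC x))
    (is_deriveDr
      (is_deriveMr (du x) (is_derive_sinr (dS x)))
      (is_deriveMr (dv x) (is_derive_cosr (dS x))))) _.
  transitivity (expR (C x) * ((u' x + C' x * u x - S' x * v x) * sin (S x)
    + (v' x + C' x * v x + S' x * u x) * cos (S x))); last by rewrite h1 h2; ring.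
  ring.
have eP : P t = P 0 by exact: (@is_derive_0_is_cst R P t 0 dP).
have eQ : Q t = Q 0 by exact: (@is_derive_0_is_cst R Q t 0 dQ).
apply: complexP.
- rewrite !ReM /=; transitivity (P t); first by rewrite /P; ring.
  by rewrite eP /P; ring.
- rewrite !ImM /=; transitivity (Q t); first by rewrite /Q; ring.
  by rewrite eQ /Q; ring.
Qed.

End ode.

(** * Integrals against densities and series of measures *)

Section density.
Context {R : realType}.
Local Notation T := (measurableTypeR R).
Local Notation leb := (@lebesgue_measure R).
Variable g : R -> R.
Hypothesis mg : measurable_fun (setT : set T) g.
Hypothesis g0 : forall x, 0 <= g x.
Local Notation dens := (density_measure mg g0).
Variables (D : set T) (mD : measurable D).

Import HBNNSimple.

(** For an indicator this is the definition of the density measure. Linearity gives simple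
    functions, and monotone convergence along [nnsfun_approx] gives the rest on both sides. *)
Lemma ge0_integral_density (f : T -> \bar R) :
  (forall x, D x -> 0 <= f x)%E -> measurable_fun D f ->
  (\int[dens]_(x in D) f x = \int[leb]_(x in D) (f x * (g x)%:E))%E.
Proof.
move=> f0 mf.
have mgD : measurable_fun D (EFin \o g).
  by apply/measurable_EFinP; exact: measurable_funTS.
pose h := nnsfun_approx mD mf.
have hcv x : D x -> ((h n x)%:E @[n --> \oo] --> f x)%E.
  by move=> Dx; exact: (cvg_nnsfun_approx mD mf f0).
have hnd x : D x -> {homo (fun n => (h n x)%:E) : n m / (n <= m)%N >-> (n <= m)%E}.
  by move=> Dx a b ab; rewrite lee_fin; exact/lefP/nd_nnsfun_approx.
transitivity (limn (fun n => \int[dens]_(x in D) (h n x)%:E)%E).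
  rewrite -monotone_convergence//.
  - by apply: eq_integral => x /[!inE] Dx; apply/esym/cvg_lim => //; exact: hcv.
  - by move=> n; apply/measurable_EFinP; exact: measurable_funTS.
  - by move=> n x _; rewrite lee_fin.
transitivity (limn (fun n => \int[leb]_(x in D) ((h n x)%:E * (g x)%:E))%E); last first.
  rewrite -monotone_convergence//.
  - apply: eq_integral => x /[!inE] Dx; apply/cvg_lim => //.
    by apply: cvgeZr => //; exact: hcv.
  - move=> n; apply: emeasurable_funM => //.
    by apply/measurable_EFinP; exact: measurable_funTS.
  - by move=> n x _; rewrite -EFinM lee_fin mulr_ge0.
  - by move=> x Dx a b ab; rewrite lee_wpmul2r ?lee_fin//; exact: (hnd _ Dx).
congr (limn _); apply/funext => n.
under eq_integral do rewrite fimfunE -fsumEFin//.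
have mind r : measurable_fun D (fun x => (\1_(h n @^-1` [set r]) x)%:E : \bar R).
  by apply/measurable_EFinP; exact: measurable_funTS.
rewrite ge0_integral_fsum//; last 2 first.
  - move=> r; rewrite [X in measurable_fun _ X](_ : _ =
      (fun x => r%:E * (\1_(h n @^-1` [set r]) x)%:E)%E)//.
    exact: measurable_funeM.
  - by move=> r x _; rewrite nnfun_muleindic_ge0.
under [in RHS]eq_integral => x _ do
  (rewrite fimfunE -fsumEFin// ge0_mule_fsuml; last first;
     [by move=> r; rewrite nnfun_muleindic_ge0|]).
rewrite [RHS]ge0_integral_fsum//; last 2 first.
  - move=> r; apply: emeasurable_funM => //.
    rewrite [X in measurable_fun _ X](_ : _ =
      (fun x => r%:E * (\1_(h n @^-1` [set r]) x)%:E)%E)//.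
    exact: measurable_funeM.
  - by move=> r x _; apply: mule_ge0; [rewrite EFinM nnfun_muleindic_ge0|rewrite lee_fin].
apply: eq_fsbigr => r _.
(* A nonnegative simple function has empty preimage at a negative value, so such terms vanish on
   both sides. *)
have [r0|r0] := leP 0 r; last first.
  rewrite [LHS](_ : _ = 0%E) ?[RHS](_ : _ = 0%E)//.
  - apply: integral0_eq => x _; rewrite preimage_nnfun0//.
    by rewrite indicE in_set0 mulr0 mul0e.
  - apply: integral0_eq => x _; rewrite preimage_nnfun0//.
    by rewrite indicE in_set0 mulr0.
have -> : (\int[dens]_(x in D) (r * \1_(h n @^-1` [set r]) x)%:E =
    r%:E * dens ((h n @^-1` [set r]) `&` D))%E.
  under eq_integral do rewrite EFinM.
  by rewrite ge0_integralZl//= ?integral_indic//.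
under eq_integral do rewrite EFinM -muleA.
rewrite ge0_integralZl//=; first last.
- by move=> x _; rewrite mule_ge0 ?lee_fin.
- exact: emeasurable_funM.
congr (_ * _)%E; rewrite /density_measure setIC integral_mkcondr.
apply: eq_integral => x _; rewrite indicE /patch /=.
by case: (x \in _); rewrite ?mul1e ?mul0e.
Qed.

Lemma integrable_density (f : R -> R) : measurable_fun D f ->
  leb.-integrable D (EFin \o (fun x => f x * g x)) ->
  dens.-integrable D (EFin \o f).
Proof.
move=> mf /integrableP[_ h]; apply/integrableP; split; first exact/measurable_EFinP.
rewrite ge0_integral_density//; last first.
  by apply: measurableT_comp => //; exact/measurable_EFinP.
move: h; congr (_ < _)%E; apply: eq_integral => x _ /=.
by rewrite normrM EFinM (ger0_norm (g0 x)).
Qed.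

Lemma density_integrable (f : R -> R) : measurable_fun D f ->
  dens.-integrable D (EFin \o f) ->
  leb.-integrable D (EFin \o (fun x => f x * g x)).
Proof.
move=> mf /integrableP[_ h]; apply/integrableP; split.
  by apply/measurable_EFinP; apply: measurable_funM => //; exact: measurable_funTS.
move: h; rewrite ge0_integral_density//; last first.
  by apply: measurableT_comp => //; exact/measurable_EFinP.
congr (_ < _)%E; apply: eq_integral => x _ /=.
by rewrite normrM EFinM (ger0_norm (g0 x)).
Qed.

Lemma Rintegral_density (f : R -> R) : measurable_fun D f ->
  leb.-integrable D (EFin \o (fun x => f x * g x)) ->
  \int[dens]_(x in D) f x = \int[leb]_(x in D) (f x * g x).
Proof.
move=> mf ifg; have ifd := integrable_density mf ifg.
have mE : measurable_fun D (EFin \o f) by exact/measurable_EFinP.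
rewrite /Rintegral; congr fine; rewrite integralE [RHS]integralE.
rewrite !ge0_integral_density; try by [|exact: measurable_funepos|exact: measurable_funeneg].
congr (_ - _)%E; apply: eq_integral => x _ /=.
- by rewrite !funeposE /= -!EFin_max -EFinM maxr_pMl// mul0r.
- by rewrite !funenegE /= -!EFin_max -EFinM maxr_pMl// mul0r mulNr.
Qed.

End density.

(** * Integrals against series of measures *)

Section measure_series.
Context {R : realType} d (T : measurableType d).
Variables (m : nat -> {measure set T -> \bar R}) (D : set T).
Hypothesis mD : measurable D.

Lemma integrable_mseries (f : T -> R) :
  (mseries m 0).-integrable D (EFin \o f) -> forall n, (m n).-integrable D (EFin \o f).
Proof.
move=> /integrableP[mf h] n; apply/integrableP; split => //.
apply: le_lt_trans h; rewrite ge0_integral_measure_series//; last first.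
  exact: measurableT_comp.
have ge0 k : (0 <= \int[m k]_(x in D) `|(EFin \o f) x|)%E by exact: integral_ge0.
rewrite (@nneseriesD1 _ _ n)//.
by rewrite leeDl// nneseries_ge0.
Qed.

Let ge0_Rintegral_mseries (f : T -> R) : (forall x, 0 <= f x) ->
  (mseries m 0).-integrable D (EFin \o f) ->
  \sum_(k < n) \int[m k]_(x in D) f x @[n --> \oo] -->
  \int[mseries m 0]_(x in D) f x.
Proof.
move=> f0 ifm; have ifn := integrable_mseries ifm.
have mf : measurable_fun D (EFin \o f) by case/integrableP : ifm.
have h := ge0_integral_measure_series m mD (fun t _ => (f0 t : 0 <= (f t)%:E)%E) mf.
have /cvg_ex[l cl] : cvgn (fun n => \sum_(0 <= i < n) \int[m i]_(x in D) (f x)%:E)%E.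
  apply: is_cvg_nneseries => n _ _.
  by apply: integral_ge0 => x _; rewrite lee_fin.
have fl : (l = (\int[mseries m 0]_(x in D) f x)%:E)%E.
  rewrite /Rintegral fineK; last exact: integrable_fin_num.
  by rewrite h; apply/esym/cvg_lim.
rewrite fl in cl.
rewrite (_ : (fun n => _) = fine \o (fun n => \sum_(0 <= i < n) \int[m i]_(x in D) (f x)%:E)%E).
  exact: fine_cvg.
apply/funext => n /=; rewrite big_mkord.
rewrite (eq_bigr (fun i : 'I_n => (\int[m i]_(x in D) f x)%:E)) ?sumEFin//.
by move=> i _; rewrite /Rintegral fineK//; exact: integrable_fin_num.
Qed.

(** Writing f = (f + |f|) - |f| reduces to nonnegative integrands, for which the series of extended
    integrals applies. *)
Lemma Rintegral_mseries (f : T -> R) : (mseries m 0).-integrable D (EFin \o f) ->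
  \sum_(k < n) \int[m k]_(x in D) f x @[n --> \oo] -->
  \int[mseries m 0]_(x in D) f x.
Proof.
move=> ifm; have ifn := integrable_mseries ifm.
have iam := integrable_norm ifm.
have ian := integrable_mseries iam.
pose g x := f x + `|f x|.
have igm : (mseries m 0).-integrable D (EFin \o g).
  by have := integrableD mD ifm iam; apply: eq_integrable.
have ign := integrable_mseries igm.
have fE mu' : (mu' : {measure set T -> \bar R}).-integrable D (EFin \o g) ->
    mu'.-integrable D (EFin \o (fun x => `|f x|)) ->
    \int[mu']_(x in D) f x = \int[mu']_(x in D) g x - \int[mu']_(x in D) `|f x|.
  move=> h1 h2; rewrite -RintegralB//.
  by apply: eq_Rintegral => x _; rewrite /g addrK.
rewrite fE//; under eq_fun do under eq_bigr do rewrite fE//.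
rewrite (_ : (fun n => _) = (fun n => \sum_(k < n) \int[m k]_(x in D) g x
    - \sum_(k < n) \int[m k]_(x in D) `|f x|)); last first.
  by apply/funext => n; rewrite -sumrB.
apply: cvgB; apply: ge0_Rintegral_mseries => //.
by move=> x; rewrite /g -lerBlDr sub0r lerNl -normrN ler_norm.
Qed.

End measure_series.

(** * Differentiation of characteristic exponents under the integral sign *)

Section characteristic_exponent.
Context {R : realType}.
Local Notation T := (measurableTypeR R).
Variables (mu : {measure set T -> \bar R}) (D : set T) (mD : measurable D).
Variable w : R -> R.
Hypothesis mw : measurable_fun D w.
Hypothesis ixw : mu.-integrable D (EFin \o (fun x => x * w x)).

Let iaxw : mu.-integrable D (EFin \o (fun x : R => `|x * w x|)).
Proof. exact: (integrable_norm ixw). Qed.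

Lemma measurable_cosM (t : R) : measurable_fun (setT : set T) (fun x : R => cos (t * x)).
Proof.
apply: (@measurableT_comp _ _ _ _ _ _ cos).
  by apply: continuous_measurable_fun; exact: continuous_cos.
exact: measurable_funM.
Qed.

Lemma measurable_sinM (t : R) : measurable_fun (setT : set T) (fun x : R => sin (t * x)).
Proof.
apply: (@measurableT_comp _ _ _ _ _ _ sin).
  by apply: continuous_measurable_fun; exact: continuous_sin.
exact: measurable_funM.
Qed.

Lemma le_sin (x : R) : `|sin x| <= `|x|.
Proof.
wlog x0 : x / 0 <= x => [h|].
  have [|/ltW x0] := leP 0 x; first exact: h.
  by rewrite -[X in sin X]opprK sinN normrN -[leRHS]normrN h// oppr_ge0.
rewrite (ger0_norm x0).
have [->|xn0] := eqVneq x 0; first by rewrite sin0 normr0.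
have {}x0 : 0 < x by rewrite lt_neqAle eq_sym xn0.
have cs : {within `[0, x], continuous (@sin R)}.
  by apply: continuous_subspaceT; exact: continuous_sin.
have [c _] := @MVT R sin cos 0 x x0 (fun y _ => is_derive_sin y) cs.
rewrite sin0 !subr0 => ->.
by rewrite normrM (gtr0_norm x0) ler_piMl ?cos_max// ltW.
Qed.

(** 1 - cos x = 2 sin^2 (x/2), and one of the two sines is bounded by 1, the other by |x/2|. *)
Lemma le_1Bcos (x : R) : 1 - cos x <= `|x|.
Proof.
have hx : x = (x / 2) *+ 2 by rewrite -mulr_natr divfK.
have -> : cos x = 1 - 2 * sin (x / 2) ^+ 2.
  rewrite {1}hx cos_mulr2n cos2sin2 mulr2n; lra.
rewrite opprB addrC subrK.
have h1 := le_sin (x / 2); have h2 := sin_max (x / 2).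
have -> : `|x| = 2 * `|x / 2| by rewrite normrM (@gtr0_norm _ 2^-1)//; field.
rewrite ler_pM2l// -normr_id -real_normK ?num_real//.
by rewrite expr2 normr_id (le_trans _ h1)// ler_piMr.
Qed.

Lemma integrable_cos1 (t : R) :
  mu.-integrable D (EFin \o (fun x => (cos (t * x) - 1) * w x)).
Proof.
apply: (@le_real_integrable _ _ _ _ _ mD _ (fun x => `|t| * `|x * w x|)).
- apply: measurable_funM => //; apply: measurable_funB => //.
  by apply: measurable_funTS; exact: measurable_cosM.
- by have := integrableZl mD `|t| iaxw; apply: eq_integrable.
- move=> x _; rewrite normrM [`|x * _|]normrM mulrA -(normrM t x) ler_wpM2r//.
  have c1 : 0 <= 1 - cos (t * x) by rewrite subr_ge0 cos_le1.
  by rewrite distrC (ger0_norm c1) le_1Bcos.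
Qed.

Lemma integrable_sin (t : R) :
  mu.-integrable D (EFin \o (fun x => sin (t * x) * w x)).
Proof.
apply: (@le_real_integrable _ _ _ _ _ mD _ (fun x => `|t| * `|x * w x|)).
- apply: measurable_funM => //.
  by apply: measurable_funTS; exact: measurable_sinM.
- by have := integrableZl mD `|t| iaxw; apply: eq_integrable.
- by move=> x _; rewrite normrM [`|x * _|]normrM mulrA -(normrM t x) ler_wpM2r// le_sin.
Qed.

(** The dominating function |x w(x)| does not depend on [t], so the window ]t - 1, t + 1[ used for
    the differentiation theorem is arbitrary. *)
Let der_under (f f' : R -> R -> R) :
  (forall t, mu.-integrable D (EFin \o (fun x => f t x))) ->
  (forall t x : R, is_derive t (1 : R) (f^~ x) (f' t x)) ->
  (forall t x, `|f' t x| <= `|x * w x|) -> forall t : R,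
  is_derive t (1 : R) (fun t => \int[mu]_(x in D) f t x) (\int[mu]_(x in D) f' t x).
Proof.
move=> i_f df bf t.
have hI : `]t - 1, t + 1[%classic t by rewrite /= in_itv /= ltrBlDr ltrDl ltr01.
have d1E s x : partial1of2 f s x = f' s x.
  by rewrite partial1of2E; exact: (@derive_val _ _ _ _ _ _ _ (df s x)).
have e := @derivable_under_integral R _ T mu f D mD t (t - 1) (t + 1) hI
  (fun s _ => i_f s) (fun s x _ _ => @ex_derive _ _ _ _ _ _ _ (df s x))
  (fun x => `|x * w x|) (fun x => normr_ge0 _) iaxw.
have e' := @differentiation_under_integral R _ T mu f D mD t (t - 1) (t + 1) hI
  (fun s _ => i_f s) (fun s x _ _ => @ex_derive _ _ _ _ _ _ _ (df s x))
  (fun x => `|x * w x|) (fun x => normr_ge0 _) iaxw.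
apply: DeriveDef; first by apply: e => s x _ _; rewrite d1E.
rewrite -derive1E e'; last by move=> s x _ _; rewrite d1E.
by apply: eq_Rintegral => x _; rewrite d1E.
Qed.

Lemma is_derive_int_cos (t : R) :
  is_derive t (1 : R) (fun t => \int[mu]_(x in D) ((cos (t * x) - 1) * w x))
    (\int[mu]_(x in D) (- (sin (t * x)) * (x * w x))).
Proof.
apply: (der_under (f := fun t x => (cos (t * x) - 1) * w x)
  (f' := fun t x => - (sin (t * x)) * (x * w x))).
- exact: integrable_cos1.
- move=> s x; apply: is_derive_eq (is_deriveMr (is_deriveBr
    (is_derive_cosr (is_derive_mulr_id _ _)) (is_derive_cstr 1 s))
    (is_derive_cstr (w x) s)) _.
  by ring.
- by move=> s x; rewrite normrM normrN ler_piMl ?sin_max.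
Qed.

Lemma is_derive_int_sin (t : R) :
  is_derive t (1 : R) (fun t => \int[mu]_(x in D) (sin (t * x) * w x))
    (\int[mu]_(x in D) (cos (t * x) * (x * w x))).
Proof.
apply: (der_under (f := fun t x => sin (t * x) * w x)
  (f' := fun t x => cos (t * x) * (x * w x))).
- exact: integrable_sin.
- move=> s x; apply: is_derive_eq (is_deriveMr
    (is_derive_sinr (is_derive_mulr_id _ _))
    (is_derive_cstr (w x) s)) _.
  by ring.
- by move=> s x; rewrite normrM ler_piMl ?cos_max.
Qed.

End characteristic_exponent.

(** * Laplace transforms on the half-line *)

Section exponential_integrals.
Context {R : realType}.
Local Notation leb := (@lebesgue_measure R).
Local Notation D := (`]0, +oo[%classic : set R).

Lemma measurable_0y : measurable (D : set (measurableTypeR R)).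
Proof. exact: measurable_itv. Qed.

Lemma ge0_FTC_0y (f F : R -> R) (l : R) : (forall x, 0 <= x -> 0 <= f x) ->
  continuous f -> (forall x : R, is_derive x (1 : R) F (f x)) ->
  F x @[x --> +oo] --> l ->
  leb.-integrable D (EFin \o f) /\ \int[leb]_(x in D) f x = l - F 0.
Proof.
move=> f0 cf dF Fl.
have cF : continuous F.
  move=> x; apply: differentiable_continuous; apply/derivable1_diffP.
  exact: (@ex_derive _ _ _ _ _ _ _ (dF x)).
have cwf : {within `[0, +oo[, continuous f} by exact: continuous_subspaceT.
have F0 : F x @[x --> 0^'+] --> F 0 by apply: cvg_at_right_filter; exact: cF.
have dF' x : 0 < x -> derivable F x 1.
  by move=> _; exact: (@ex_derive _ _ _ _ _ _ _ (dF x)).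
have dFE : {in `]0, +oo[, derive1 F =1 f}.
  by move=> x _; rewrite derive1E; exact: (@derive_val _ _ _ _ _ _ _ (dF x)).
have mf : measurable_fun (setT : set R) f by exact: continuous_measurable_fun.
have e := ge0_continuous_FTC2y f0 cwf Fl dF' F0 dFE.
have e' : (\int[leb]_(x in D) (f x)%:E = (l - F 0)%:E)%E.
  rewrite integral_itv_obnd_cbnd ?e//.
  by apply/measurable_EFinP; exact: measurable_funTS.
split; last by rewrite /Rintegral e'.
apply/integrableP; split; first by apply/measurable_EFinP; exact: measurable_funTS.
under eq_integral => x xD.
  rewrite /= ger0_norm; last first.
    by apply: f0; move: xD; rewrite inE /= in_itv /= andbT => /ltW.
  over.
by rewrite e' ltry.
Qed.

Lemma continuous_expRM (c : R) : continuous (fun x : R => expR (c * x)).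
Proof.
move=> x; apply: continuous_comp; last exact: continuous_expR.
by apply: cvgM; [exact: cvg_cst|exact: cvg_id].
Qed.

Lemma continuous_cosM (c : R) : continuous (fun x : R => cos (c * x)).
Proof.
move=> x; apply: continuous_comp; last exact: continuous_cos.
by apply: cvgM; [exact: cvg_cst|exact: cvg_id].
Qed.

Lemma continuous_sinM (c : R) : continuous (fun x : R => sin (c * x)).
Proof.
move=> x; apply: continuous_comp; last exact: continuous_sin.
by apply: cvgM; [exact: cvg_cst|exact: cvg_id].
Qed.

Lemma is_derive_Ml (c t : R) : is_derive t (1 : R) (fun s => c * s) c.
Proof.
apply: is_derive_eq (is_derive_cstM c (is_derive_id t (1 : R))) _.
by rewrite mulr1.
Qed.

Variable a : R.
Hypothesis a0 : 0 < a.

Lemma cvgy_expRN : expR (- a * x) @[x --> +oo] --> (0 : R).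
Proof.
have h : x * a @[x --> +oo] --> (+oo : set_system R).
  by apply: gt0_cvgMly => //; exact: cvg_id.
rewrite (_ : (fun x => _) = (fun x => expR (- x)) \o (fun x => x * a)); last first.
  by apply/funext => x /=; rewrite mulNr mulrC.
by apply: (@cvg_comp _ _ _ _ _ _ (+oo : set_system R)); [exact: h|exact: cvgr_expR].
Qed.

Lemma cvgy_expRN_bounded (b : R -> R) (k : R) : (forall x, `|b x| <= k) ->
  expR (- a * x) * b x @[x --> +oo] --> (0 : R).
Proof.
move=> bk.
apply: (squeeze_cvgr (f := fun x => - (expR (- a * x) * k))
  (h := fun x => expR (- a * x) * k)).
- apply: nearW => x; rewrite -ler_norml normrM (ger0_norm (expR_ge0 _)).
  by rewrite ler_wpM2l ?expR_ge0.
- rewrite -[X in _ --> X]oppr0; apply: cvgN; rewrite -[X in _ --> X](mul0r k).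
  by apply: cvgM; [exact: cvgy_expRN|exact: cvg_cst].
- rewrite -[X in _ --> X](mul0r k).
  by apply: cvgM; [exact: cvgy_expRN|exact: cvg_cst].
Qed.

Lemma exp_integral : leb.-integrable D (EFin \o (fun x => expR (- a * x))) /\
  \int[leb]_(x in D) expR (- a * x) = a^-1.
Proof.
have [||||i e] := @ge0_FTC_0y (fun x => expR (- a * x)) (fun x => - a^-1 * expR (- a * x)) 0.
- by move=> x _; exact: expR_ge0.
- exact: continuous_expRM.
- move=> x; apply: is_derive_eq (is_derive_cstM _ (is_derive_exp (is_derive_Ml _ _))) _.
  by field; rewrite gt_eqF.
- rewrite -[X in _ --> X](mulr0 (- a^-1)).
  by apply: cvgM; [exact: cvg_cst|exact: cvgy_expRN].
- by split => //; rewrite e mulr0 expR0; ring.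
Qed.

(* [expR (- a * x)] is added to the integrands to make them nonnegative, as the
   fundamental theorem on an unbounded interval requires. *)
Lemma exp_cos_sin_integral (t : R) :
  (leb.-integrable D (EFin \o (fun x => expR (- a * x) * cos (t * x))) /\
   \int[leb]_(x in D) (expR (- a * x) * cos (t * x)) = a / (a ^+ 2 + t ^+ 2)) /\
  (leb.-integrable D (EFin \o (fun x => expR (- a * x) * sin (t * x))) /\
   \int[leb]_(x in D) (expR (- a * x) * sin (t * x)) = t / (a ^+ 2 + t ^+ 2)).
Proof.
have [ie e] := exp_integral.
have at0 : a ^+ 2 + t ^+ 2 != 0 by rewrite gt_eqF// ltr_pwDl ?exprn_gt0 ?sqr_ge0.
(* [k] bounds the amplitude of the oscillating part of the antiderivatives, which the factor e^{-ax}
   then sends to 0 at infinity. *)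
pose k : R := a + `|t|.
have bc (x : R) : `|(t * sin (t * x) - a * cos (t * x)) / (a ^+ 2 + t ^+ 2)| <= k / `|a ^+ 2 + t ^+ 2|.
  rewrite normrM normfV ler_wpM2r ?invr_ge0//.
  rewrite (le_trans (ler_normB _ _))// !normrM addrC (gtr0_norm a0) lerD//.
    by rewrite ler_piMr ?cos_max// ltW.
  by rewrite ler_piMr ?sin_max.
have bs (x : R) : `|(- a * sin (t * x) - t * cos (t * x)) / (a ^+ 2 + t ^+ 2)| <= k / `|a ^+ 2 + t ^+ 2|.
  rewrite normrM normfV ler_wpM2r ?invr_ge0//.
  rewrite (le_trans (ler_normB _ _))// !normrM normrN (gtr0_norm a0) lerD//.
    by rewrite ler_piMr ?sin_max// ltW.
  by rewrite ler_piMr ?cos_max.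
(* Removes the auxiliary e^{-ax}, whose integral is [a^-1]. *)
have diff (h : R -> R) (r : R) :
    leb.-integrable D (EFin \o (fun x => expR (- a * x) + expR (- a * x) * h x)) ->
    \int[leb]_(x in D) (expR (- a * x) + expR (- a * x) * h x) = a^-1 + r ->
    leb.-integrable D (EFin \o (fun x => expR (- a * x) * h x)) /\
    \int[leb]_(x in D) (expR (- a * x) * h x) = r.
  move=> i1 e1.
  have i2 : leb.-integrable D (EFin \o (fun x => expR (- a * x) * h x)).
    have := real_integrableB measurable_0y i1 ie; apply: eq_integrable => // x _ /=.
    by rewrite addrC addrA [X in X + _]addrC subrr add0r.
  by split => //; apply: (addrI a^-1); rewrite -e1 -e -RintegralD.
have vb (h : R -> R) : (forall x, `|h x| <= k / `|a ^+ 2 + t ^+ 2|) ->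
    - a^-1 * expR (- a * x) + expR (- a * x) * h x @[x --> +oo] --> (0 : R).
  move=> hb; rewrite -[X in _ --> X]addr0; apply: cvgD; last exact: cvgy_expRN_bounded hb.
  rewrite -[X in _ --> X](mulr0 (- a^-1)).
  by apply: cvgM; [exact: cvg_cst|exact: cvgy_expRN].
have F1 := @ge0_FTC_0y (fun x => expR (- a * x) + expR (- a * x) * cos (t * x))
    (fun x => - a^-1 * expR (- a * x) + expR (- a * x) *
      ((t * sin (t * x) - a * cos (t * x)) / (a ^+ 2 + t ^+ 2))) 0.
have F2 := @ge0_FTC_0y (fun x => expR (- a * x) + expR (- a * x) * sin (t * x))
    (fun x => - a^-1 * expR (- a * x) + expR (- a * x) *
      ((- a * sin (t * x) - t * cos (t * x)) / (a ^+ 2 + t ^+ 2))) 0.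
have [||||i1 e1] := F1.
- move=> x _; rewrite -[X in X + _]mulr1 -mulrDr mulr_ge0 ?expR_ge0//.
- move=> x; apply: cvgD; [|apply: cvgM; [|exact: continuous_cosM]]; exact: continuous_expRM.
- move=> x; apply: is_derive_eq (is_deriveDr
    (is_derive_cstM _ (is_derive_exp (is_derive_Ml _ _)))
    (is_deriveMr (is_derive_exp (is_derive_Ml _ _))
       (is_deriveMr (is_deriveBr (is_derive_cstM _ (is_derive_sinr (is_derive_Ml _ _)))
          (is_derive_cstM _ (is_derive_cosr (is_derive_Ml _ _)))) (is_derive_cstr _ _)))) _.
  by field; rewrite at0 gt_eqF.
- exact: vb.
have [||||i2 e2] := F2.
- move=> x _; rewrite -[X in X + _]mulr1 -mulrDr mulr_ge0 ?expR_ge0//.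
- move=> x; apply: cvgD; [|apply: cvgM; [|exact: continuous_sinM]]; exact: continuous_expRM.
- move=> x; apply: is_derive_eq (is_deriveDr
    (is_derive_cstM _ (is_derive_exp (is_derive_Ml _ _)))
    (is_deriveMr (is_derive_exp (is_derive_Ml _ _))
       (is_deriveMr (is_deriveBr
          (is_derive_cstM _ (is_derive_sinr (is_derive_Ml _ _)))
          (is_derive_cstM _ (is_derive_cosr (is_derive_Ml _ _)))) (is_derive_cstr _ _)))) _.
  by field; rewrite at0 gt_eqF.
- exact: vb.
split; apply: diff => //.
- rewrite e1 !mulr0 expR0 cos0 sin0; field; by rewrite at0 gt_eqF.
- rewrite e2 !mulr0 expR0 cos0 sin0; field; by rewrite at0 gt_eqF.
Qed.

End exponential_integrals.
Arguments measurable_0y {R}.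

(** * The Levy exponent of the exponential law *)

Section frullani.
Context {R : realType}.
Local Notation leb := (@lebesgue_measure R).
Local Notation D := (`]0, +oo[%classic : set R).

Lemma measurable_invr_0y : measurable_fun D (fun x : R => x^-1).
Proof.
apply: open_continuous_measurable_fun; first exact: interval_open.
move=> x; rewrite inE /= in_itv /= andbT => x0.
by apply: inv_continuous; rewrite gt_eqF.
Qed.

Lemma measurable_expRM (c : R) (E : set R) : measurable_fun E (fun x : R => expR (c * x)).
Proof.
by apply: measurable_funTS; apply: continuous_measurable_fun; exact: continuous_expRM.
Qed.

Variable a : R.
Hypothesis a0 : 0 < a.

Lemma measurable_exp_div : measurable_fun D (fun x : R => expR (- a * x) / x).
Proof. by apply: measurable_funM; [exact: measurable_expRM|exact: measurable_invr_0y]. Qed.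

Let eqD : {in D, (fun x : R => expR (- a * x)) =1 (fun x : R => x * (expR (- a * x) / x))}.
Proof.
move=> x; rewrite inE /= in_itv /= andbT => x0.
by rewrite mulrCA divff ?mulr1// gt_eqF.
Qed.

Lemma integrable_id_exp_div :
  leb.-integrable D (EFin \o (fun x => x * (expR (- a * x) / x))).
Proof.
have [i _] := exp_integral a0; apply: eq_integrable i => // x xD.
by rewrite /= -eqD.
Qed.

(** e^{-ax} dx/x is the Levy measure of the exponential law of rate [a]. Since |e^{itx} - 1| is at
    most |tx|, no truncation term is needed for convergence. *)
Definition exp_kernel (t x : R) : R[i] :=
  (cexp ((t * x)*i) - 1) * (expR (- a * x) / x)%:C.

Lemma Re_exp_kernel t x : complex.Re (exp_kernel t x) =
  (cos (t * x) - 1) * (expR (- a * x) / x).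
Proof. by rewrite /exp_kernel ReM /= expR0; ring. Qed.

Lemma Im_exp_kernel t x : complex.Im (exp_kernel t x) =
  sin (t * x) * (expR (- a * x) / x).
Proof. by rewrite /exp_kernel ImM /= expR0; ring. Qed.

(** Differentiating the exponent F replaces 1/x by i, so F'(t) is i times the Laplace transform of
    e^{itx}, that is i/(a - it). This cancels the logarithmic derivative -i/(a - it) of the linear
    factor. *)
Lemma cexp_Cintegral_exp_kernel t :
  (a%:C - t*i) * cexp (Cintegral leb D (exp_kernel t)) = a%:C.
Proof.
pose C t := \int[leb]_(x in D) ((cos (t * x) - 1) * (expR (- a * x) / x)).
pose S t := \int[leb]_(x in D) (sin (t * x) * (expR (- a * x) / x)).
have [ma i1] := (measurable_exp_div, integrable_id_exp_div).
have at0 s : a ^+ 2 + s ^+ 2 != 0 by rewrite gt_eqF// ltr_pwDl ?exprn_gt0 ?sqr_ge0.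
have dC (s : R) : is_derive s (1 : R) C (- (s / (a ^+ 2 + s ^+ 2))).
  have := @is_derive_int_cos R leb D measurable_0y _ ma i1 s.
  move=> h; apply: is_derive_eq h _.
  have [_ [i2 <-]] := exp_cos_sin_integral a0 s.
  rewrite -[RHS]mulN1r -RintegralZl//.
  by apply: eq_Rintegral => x xD; rewrite -eqD//; ring.
have dS (s : R) : is_derive s (1 : R) S (a / (a ^+ 2 + s ^+ 2)).
  have := @is_derive_int_sin R leb D measurable_0y _ ma i1 s.
  move=> h; apply: is_derive_eq h _.
  have [[i2 <-] _] := exp_cos_sin_integral a0 s.
  by apply: eq_Rintegral => x xD; rewrite -eqD//; ring.
have h := @mul_cexp_cst R (fun=> a) (fun t => -1 * t) C S (fun=> 0) (fun=> -1) _ _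
   (is_derive_cstr a) (fun s => is_derive_Ml (-1) s) dC dS.
have -> : Cintegral leb D (exp_kernel t) = C t +i* S t.
  apply: complexP => /=; apply: eq_Rintegral => x _.
  - by rewrite expR0; ring.
  - by rewrite expR0; ring.
have -> : a%:C - t*i = a +i* (-1 * t).
  by apply: complexP; rewrite ?ReB ?ImB /=; ring.
rewrite h.
- have -> : C 0 = 0.
    rewrite /C; under eq_Rintegral do rewrite mul0r cos0 subrr mul0r.
    by rewrite Rintegral_cst// mul0r.
  have -> : S 0 = 0.
    rewrite /S; under eq_Rintegral do rewrite mul0r sin0 mul0r.
    by rewrite Rintegral_cst// mul0r.
  by rewrite -[0 +i* 0]/(0 : R[i]) cexp0 mulr1 mulr0.
- by move=> s; field; rewrite at0.
- by move=> s; field; rewrite at0.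
Qed.

End frullani.

(** * Euler's limit formula for Gamma *)

Section power_integrals.
Context {R : realType}.
Local Notation leb := (@lebesgue_measure R).

(** The integrand may be singular at 0, so the interval is exhausted from the left by monotone
    convergence. The limit of F at 0 is taken along e^{-x} because F will be a function of [ln],
    which turns it into an exponential decay at infinity. *)
Lemma ge0_FTC_left (f F : R -> R) (M l : R) : 0 < M ->
  (forall x, 0 < x -> 0 <= f x) -> (forall x, 0 < x -> {for x, continuous f}) ->
  (forall x : R, 0 < x -> is_derive x (1 : R) F (f x)) ->
  F (expR (- x)) @[x --> +oo] --> l ->
  leb.-integrable `]0, M] (EFin \o f) /\ \int[leb]_(x in `]0, M]) f x = F M - l.
Proof.
move=> M0 f0 cf dF Fl.
have cF x : 0 < x -> {for x, continuous F}.
  move=> x0; apply: differentiable_continuous; apply/derivable1_diffP.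
  exact: (@ex_derive _ _ _ _ _ _ _ (dF _ x0)).
(* With this shift the left ends are e_n = M e^{-(n+1)}, which are below [M] for every [n]. *)
pose u n : R := n.+1%:R - ln M.
pose e n : R := expR (- u n).
have e0 n : 0 < e n by exact: expR_gt0.
have eM n : e n < M.
  by rewrite /e /u opprB expRD lnK ?posrE// gtr_pMr// expR_lt1 oppr_lt0 ltr0n.
have uy : u n @[n --> \oo] --> +oo.
  apply/cvgryPge => A; near=> n; rewrite /u lerBrDr.
  apply: (@le_trans _ _ n%:R); last by rewrite ler_nat.
  by near: n; exact: nbhs_infty_ger.
have e_small x : 0 < x -> exists n, e n <= x.
  move=> x0; move/cvgryPge : uy => /(_ (- ln x))[N _ h].
  exists N; have := h N (leqnn N); rewrite /e lerNl => h'.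
  by rewrite -[leRHS](lnK (x:=x)) ?posrE// ler_expR.
pose G n : set R := `[e n, M]%classic.
have mG n : measurable (G n : set (measurableTypeR R)) by exact: measurable_itv.
have mf : measurable_fun (`]0, +oo[%classic : set R) f.
  apply: open_continuous_measurable_fun; first exact: interval_open.
  by move=> x; rewrite inE /= in_itv /= andbT => x0; exact: cf.
have mfM : measurable_fun (`]0, M]%classic : set R) f.
  apply: measurable_funS mf => //.
  by move=> x /=; rewrite !in_itv /= andbT => /andP[].
have GU : \bigcup_n G n = `]0, M]%classic.
  apply/seteqP; split => x.
    move=> [n _]; rewrite /G /= !in_itv /= => /andP[h ->]; rewrite andbT.
    exact: lt_le_trans (e0 n) h.
  rewrite /= in_itv /= => /andP[x0 xM]; have [n en] := e_small _ x0.
  by exists n => //; rewrite /G /= in_itv /= en.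
have ndG : {homo G : n m / (n <= m)%N >-> (n <= m)%O}.
  move=> n m nm; apply/subsetPset => x; rewrite /G /= !in_itv /= => /andP[h ->].
  rewrite andbT (le_trans _ h)// /e ler_expR lerN2 /u lerD2r ler_nat.
  by rewrite ltnS.
have mfG n : measurable_fun (G n) (EFin \o f).
  apply/measurable_EFinP; apply: measurable_funS mf => // x.
  by rewrite /G /= !in_itv /= andbT => /andP[h _]; exact: lt_le_trans (e0 n) h.
have int_n n : (\int[leb]_(x in G n) (f x)%:E = (F M - F (e n))%:E)%E.
  rewrite EFinB; apply: continuous_FTC2 => //.
  - apply: continuous_in_subspaceT => x; rewrite inE /= in_itv /= => /andP[h _].
    by apply: cf; exact: lt_le_trans (e0 n) h.
  - split.
    + move=> x; rewrite in_itv /= => /andP[h _].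
      by apply: (@ex_derive _ _ _ _ _ _ _ (dF _ _)); exact: lt_trans (e0 n) h.
    + by apply: cvg_at_right_filter; exact: cF.
    + by apply: cvg_at_left_filter; exact: cF.
  - move=> x; rewrite in_itv /= => /andP[h _]; rewrite derive1E.
    by apply: (@derive_val _ _ _ _ _ _ _ (dF _ _)); exact: lt_trans (e0 n) h.
have lim2 : (\int[leb]_(x in G n) (f x)%:E)%E @[n --> \oo] --> (F M - l)%:E.
  under eq_fun do rewrite int_n.
  apply: cvg_EFin; first exact: nearW.
  apply: cvgB; first exact: cvg_cst.
  by apply: (@cvg_comp _ _ _ u (fun x => F (expR (- x))) _ (+oo : set_system R)).
pose I : set R := `]0, M]%classic.
have int_f : (\int[leb]_(x in I) (f x)%:E = (F M - l)%:E)%E.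
  rewrite /I -GU; apply: (@cvg_unique _ _ _ _ _ _ _ lim2) => //.
  apply: ge0_nondecreasing_set_cvg_integral => // n x Gx.
  rewrite lee_fin f0//; move: Gx; rewrite /G /= in_itv /= => /andP[h _].
  exact: lt_le_trans (e0 n) h.
split; last by rewrite /Rintegral -/I int_f.
apply/integrableP; split; first exact/measurable_EFinP.
rewrite -/I; under eq_integral => x xD.
  rewrite /= ger0_norm; last first.
    by apply: f0; move: xD; rewrite inE /I /= in_itv /= => /andP[].
  over.
by rewrite int_f ltry.
Unshelve. all: end_near. Qed.

Lemma Re_cpow (x : R) (z : R[i]) : complex.Re (cpow x z) =
  expR (complex.Re z * ln x) * cos (complex.Im z * ln x).
Proof.
rewrite /cpow Re_cexp ReM ImM /=; congr (expR _ * cos _); ring.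
Qed.

Lemma Im_cpow (x : R) (z : R[i]) : complex.Im (cpow x z) =
  expR (complex.Re z * ln x) * sin (complex.Im z * ln x).
Proof.
rewrite /cpow Im_cexp ReM ImM /=; congr (expR _ * sin _); ring.
Qed.

Lemma cpowD (x : R) (z w : R[i]) : cpow x (z + w) = cpow x z * cpow x w.
Proof. by rewrite /cpow mulrDr cexpD. Qed.

Lemma cpow1 (x : R) : 0 < x -> cpow x 1 = x%:C.
Proof.
move=> x0; apply: complexP; rewrite ?Re_cpow ?Im_cpow /= mul0r ?cos0 ?sin0 ?mulr0//.
by rewrite mul1r mulr1 lnK.
Qed.

Lemma is_derive_lnM (c x : R) : 0 < x -> is_derive x (1 : R) (fun y => c * ln y) (c / x).
Proof. by move=> x0; apply: is_derive_cstM; exact: is_derive1_ln. Qed.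

Lemma continuous_lnM (c x : R) : 0 < x -> {for x, continuous (fun y : R => c * ln y)}.
Proof. by move=> x0; apply: cvgM; [exact: cvg_cst|exact: continuous_ln]. Qed.

(* As for [exp_cos_sin_integral], the sign of the oscillating integrands is fixed
   by adding [x ^ (a - 1)]. *)
Lemma power_integral (M a b : R) : 0 < M -> 0 < a ->
  (leb.-integrable `]0, M] (EFin \o (fun x => expR ((a - 1) * ln x))) /\
   \int[leb]_(x in `]0, M]) expR ((a - 1) * ln x) = expR (a * ln M) / a) /\
  ((leb.-integrable `]0, M] (EFin \o (fun x => expR ((a - 1) * ln x) * cos (b * ln x))) /\
   \int[leb]_(x in `]0, M]) (expR ((a - 1) * ln x) * cos (b * ln x)) =
     expR (a * ln M) * (a * cos (b * ln M) + b * sin (b * ln M)) / (a ^+ 2 + b ^+ 2)) /\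
  (leb.-integrable `]0, M] (EFin \o (fun x => expR ((a - 1) * ln x) * sin (b * ln x))) /\
   \int[leb]_(x in `]0, M]) (expR ((a - 1) * ln x) * sin (b * ln x)) =
     expR (a * ln M) * (a * sin (b * ln M) - b * cos (b * ln M)) / (a ^+ 2 + b ^+ 2))).
Proof.
move=> M0 a0.
have ab0 : a ^+ 2 + b ^+ 2 != 0 by rewrite gt_eqF// ltr_pwDl ?exprn_gt0 ?sqr_ge0.
have expD1 x : 0 < x -> expR ((a - 1) * ln x) = expR (a * ln x) / x.
  by move=> x0; rewrite mulrBl mul1r expRB lnK.
have cexp1 x : 0 < x -> {for x, continuous (fun x : R => expR ((a - 1) * ln x))}.
  move=> x0; apply: continuous_comp; last exact: continuous_expR.
  exact: continuous_lnM.
have ccos x : 0 < x -> {for x, continuous (fun x : R => cos (b * ln x))}.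
  move=> x0; apply: continuous_comp; last exact: continuous_cos.
  exact: continuous_lnM.
have csin x : 0 < x -> {for x, continuous (fun x : R => sin (b * ln x))}.
  move=> x0; apply: continuous_comp; last exact: continuous_sin.
  exact: continuous_lnM.
have lim0 (h : R -> R) (k : R) : (forall x, `|h x| <= k) ->
    expR (a * ln (expR (- x))) * h (expR (- x)) @[x --> +oo] --> (0 : R).
  move=> hk; under eq_fun do rewrite expRK mulrN -mulNr.
  by apply: (@cvgy_expRN_bounded _ _ a0 _ k).
have [ie e] : leb.-integrable `]0, M] (EFin \o (fun x => expR ((a - 1) * ln x))) /\
   \int[leb]_(x in `]0, M]) expR ((a - 1) * ln x) = expR (a * ln M) / a.
  have [||||i ->] := @ge0_FTC_left (fun x => expR ((a - 1) * ln x))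
      (fun x => expR (a * ln x) * a^-1) M 0 M0.
  - by move=> x _; exact: expR_ge0.
  - exact: cexp1.
  - move=> x x0; apply: is_derive_eq (is_deriveMr (is_derive_exp (is_derive_lnM _ x0))
      (is_derive_cstr _ _)) _.
    by rewrite expD1//; field; rewrite !gt_eqF.
  - by apply: (lim0 (fun=> a^-1) `|a^-1|).
  - by rewrite subr0.
split => //.
pose k : R := a + `|b|.
have ia : 0 <= a^-1 by rewrite invr_ge0 ltW.
have bc (x : R) : `|a^-1 + (a * cos (b * ln x) + b * sin (b * ln x)) / (a ^+ 2 + b ^+ 2)|
    <= a^-1 + k / `|a ^+ 2 + b ^+ 2|.
  rewrite (le_trans (ler_normD _ _))// (ger0_norm ia) lerD2l.
  rewrite normrM normfV ler_wpM2r ?invr_ge0//.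
  rewrite (le_trans (ler_normD _ _))// !normrM (gtr0_norm a0) lerD//.
    by rewrite ler_piMr ?cos_max// ltW.
  by rewrite ler_piMr ?sin_max.
have bs (x : R) : `|a^-1 + (a * sin (b * ln x) - b * cos (b * ln x)) / (a ^+ 2 + b ^+ 2)|
    <= a^-1 + k / `|a ^+ 2 + b ^+ 2|.
  rewrite (le_trans (ler_normD _ _))// (ger0_norm ia) lerD2l.
  rewrite normrM normfV ler_wpM2r ?invr_ge0//.
  rewrite (le_trans (ler_normB _ _))// !normrM (gtr0_norm a0) lerD//.
    by rewrite ler_piMr ?sin_max// ltW.
  by rewrite ler_piMr ?cos_max.
have diff (h : R -> R) (r : R) :
    leb.-integrable `]0, M] (EFin \o (fun x => expR ((a - 1) * ln x) + expR ((a - 1) * ln x) * h x)) ->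
    \int[leb]_(x in `]0, M]) (expR ((a - 1) * ln x) + expR ((a - 1) * ln x) * h x)
      = expR (a * ln M) / a + r ->
    leb.-integrable `]0, M] (EFin \o (fun x => expR ((a - 1) * ln x) * h x)) /\
    \int[leb]_(x in `]0, M]) (expR ((a - 1) * ln x) * h x) = r.
  have mM : measurable (`]0, M]%classic : set (measurableTypeR R)) by exact: measurable_itv.
  move=> i1 e1.
  have i2 : leb.-integrable `]0, M] (EFin \o (fun x => expR ((a - 1) * ln x) * h x)).
    have := real_integrableB mM i1 ie; apply: eq_integrable => // x _ /=.
    by rewrite addrC addrA [X in X + _]addrC subrr add0r.
  by split => //; apply: (addrI (expR (a * ln M) / a)); rewrite -e1 -e -RintegralD.
have F1 := @ge0_FTC_left (fun x => expR ((a - 1) * ln x) + expR ((a - 1) * ln x) * cos (b * ln x))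
    (fun x => expR (a * ln x) * (a^-1 +
      (a * cos (b * ln x) + b * sin (b * ln x)) / (a ^+ 2 + b ^+ 2))) M 0 M0.
have F2 := @ge0_FTC_left (fun x => expR ((a - 1) * ln x) + expR ((a - 1) * ln x) * sin (b * ln x))
    (fun x => expR (a * ln x) * (a^-1 +
      (a * sin (b * ln x) - b * cos (b * ln x)) / (a ^+ 2 + b ^+ 2))) M 0 M0.
have [||||i1 e1] := F1.
- move=> x _; rewrite -[X in X + _]mulr1 -mulrDr mulr_ge0 ?expR_ge0//.
- move=> x x0; apply: cvgD; [|apply: cvgM; [|exact: ccos]]; exact: cexp1.
- move=> x x0; apply: is_derive_eq (is_deriveMr (is_derive_exp (is_derive_lnM _ x0))
    (is_deriveDr (is_derive_cstr _ _)
     (is_deriveMr (is_deriveDr (is_derive_cstM _ (is_derive_cosr (is_derive_lnM _ x0)))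
          (is_derive_cstM _ (is_derive_sinr (is_derive_lnM _ x0)))) (is_derive_cstr _ _)))) _.
  by rewrite expD1//; field; rewrite ab0 !gt_eqF.
- by apply: (lim0 (fun x => a^-1 +
      (a * cos (b * ln x) + b * sin (b * ln x)) / (a ^+ 2 + b ^+ 2))); exact: bc.
have [||||i2 e2] := F2.
- move=> x _; rewrite -[X in X + _]mulr1 -mulrDr mulr_ge0 ?expR_ge0//.
- move=> x x0; apply: cvgD; [|apply: cvgM; [|exact: csin]]; exact: cexp1.
- move=> x x0; apply: is_derive_eq (is_deriveMr (is_derive_exp (is_derive_lnM _ x0))
    (is_deriveDr (is_derive_cstr _ _)
     (is_deriveMr (is_deriveBr (is_derive_cstM _ (is_derive_sinr (is_derive_lnM _ x0)))
          (is_derive_cstM _ (is_derive_cosr (is_derive_lnM _ x0)))) (is_derive_cstr _ _)))) _.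
  by rewrite expD1//; field; rewrite ab0 !gt_eqF.
- by apply: (lim0 (fun x => a^-1 +
      (a * sin (b * ln x) - b * cos (b * ln x)) / (a ^+ 2 + b ^+ 2))); exact: bs.
split; apply: diff => //.
- by rewrite e1; field; rewrite ab0 gt_eqF.
- by rewrite e2; field; rewrite ab0 gt_eqF.
Qed.

End power_integrals.

Section euler_limit.
Context {R : realType}.

(* [1 - u >= e^-u (1 - u^2)] because [e^u >= 1 + u]; then Bernoulli. *)
Lemma expB_bounds (y : R) (n : nat) : 0 <= y -> y <= n.+1%:R ->
  expR (- y) * (1 - y ^+ 2 / n.+1%:R) <= (1 - y / n.+1%:R) ^+ n.+1 <= expR (- y).
Proof.
move=> y0 yn; pose u := y / n.+1%:R.
have n0 : (0 : R) < n.+1%:R by rewrite ltr0n.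
have u0 : 0 <= u by rewrite divr_ge0.
have u1 : u <= 1 by rewrite ler_pdivrMr// mul1r.
have yE : y = n.+1%:R * u by rewrite /u mulrCA divff ?mulr1// gt_eqF.
have eE : expR (- y) = expR (- u) ^+ n.+1 by rewrite -expRM_natl {1}yE mulrN.
have bernoulli (v : R) m : 0 <= v <= 1 -> 1 - m%:R * v <= (1 - v) ^+ m.
  move=> /andP[v0 v1]; elim: m => [|m IH]; first by rewrite expr0 mul0r subr0.
  rewrite exprS -natr1; have mv0 : 0 <= m%:R * v * v by rewrite !mulr_ge0.
  have := ler_wpM2l (_ : 0 <= 1 - v) IH; rewrite subr_ge0 => /(_ v1).
  by apply: le_trans; lra.
apply/andP; split; last first.
  rewrite eE lerXn2r ?nnegrE ?expR_ge0 ?subr_ge0//.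
  by have := expR_ge1Dx (- u).
have h1 : expR (- u) * (1 - u ^+ 2) <= 1 - u.
  have -> : 1 - u ^+ 2 = (1 + u) * (1 - u) by ring.
  rewrite mulrA ler_piMl ?subr_ge0//.
  by rewrite -(@ler_pM2l _ (expR u)) ?expR_gt0// mulrA -expRD subrr expR0 mul1r mulr1 expR_ge1Dx.
have u21 : u ^+ 2 <= 1 by rewrite expr_le1.
apply: (@le_trans _ _ ((expR (- u) * (1 - u ^+ 2)) ^+ n.+1)).
  rewrite exprMn eE ler_wpM2l ?exprn_ge0 ?expR_ge0//.
  have := bernoulli (u ^+ 2) n.+1; rewrite sqr_ge0 u21 => /(_ isT).
  apply: le_trans; rewrite le_eqVlt; apply/orP; left; apply/eqP.
  by rewrite /u; field; rewrite gt_eqF.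
by rewrite lerXn2r ?nnegrE ?subr_ge0// mulr_ge0 ?expR_ge0 ?subr_ge0.
Qed.

Lemma cvg_natV (c : R) : c / n.+1%:R @[n --> \oo] --> (0 : R).
Proof.
rewrite -[X in _ --> X](mulr0 c); apply: cvgM; first exact: cvg_cst.
exact: cvg_harmonic.
Qed.

Lemma cvg_euler (y : R) : 0 <= y ->
  (1 - y / n.+1%:R) ^+ n.+1 @[n --> \oo] --> expR (- y).
Proof.
move=> y0.
apply: (squeeze_cvgr (f := fun n => expR (- y) * (1 - y ^+ 2 / n.+1%:R))
  (h := fun=> expR (- y))).
- near=> n; apply: expB_bounds => //.
  apply: (@le_trans _ _ n%:R); last by rewrite ler_nat.
  by near: n; exact: nbhs_infty_ger.
- rewrite -[X in _ --> X]mulr1 -[X in _ * X]subr0.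
  apply: cvgM; first exact: cvg_cst.
  by apply: cvgB; [exact: cvg_cst|exact: cvg_natV].
- exact: cvg_cst.
Unshelve. all: end_near. Qed.

End euler_limit.

Section gauss_product.
Context {R : realType}.
Local Notation leb := (@lebesgue_measure R).

(** Euler's integral with e^{-t} replaced by a power. The length [M] is independent of [n] so that
    the induction on [n] can keep it fixed; both are set to n + 1 only in the limit. *)
Definition euler_beta (M : R) (n : nat) (z : R[i]) : R[i] :=
  Cintegral leb `]0, M] (fun t => cpow t (z - 1) * ((1 - t / M) ^+ n)%:C).

Lemma measurable_Re_cpow (z : R[i]) :
  measurable_fun (`]0, +oo[%classic : set R) (fun t => complex.Re (cpow t z)).
Proof.
under [fun t => complex.Re _]eq_fun do rewrite Re_cpow.
apply: open_continuous_measurable_fun; first exact: interval_open.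
move=> x; rewrite inE /= in_itv /= andbT => x0; apply: cvgM.
- apply: continuous_comp; last exact: continuous_expR.
  exact: continuous_lnM.
- apply: continuous_comp; last exact: continuous_cos.
  exact: continuous_lnM.
Qed.

Lemma measurable_Im_cpow (z : R[i]) :
  measurable_fun (`]0, +oo[%classic : set R) (fun t => complex.Im (cpow t z)).
Proof.
under [fun t => complex.Im _]eq_fun do rewrite Im_cpow.
apply: open_continuous_measurable_fun; first exact: interval_open.
move=> x; rewrite inE /= in_itv /= andbT => x0; apply: cvgM.
- apply: continuous_comp; last exact: continuous_expR.
  exact: continuous_lnM.
- apply: continuous_comp; last exact: continuous_sin.
  exact: continuous_lnM.
Qed.

Variable M : R.
Hypothesis M0 : 0 < M.
Let mM : measurable (`]0, M]%classic : set (measurableTypeR R)).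
Proof. exact: measurable_itv. Qed.

(* [B_(n+1)(z) = B_n(z) - B_n(z + 1) / M] spares an integration by parts. *)
Lemma euler_beta_correct n (z : R[i]) : 0 < complex.Re z ->
  cintegrable leb `]0, M] (fun t => cpow t (z - 1) * ((1 - t / M) ^+ n)%:C) /\
  euler_beta M n z * \prod_(k < n.+1) (z + k%:R%:C) = cpow M z * n`!%:R%:C.
Proof.
elim: n z => [|n IH] z z0.
  have [_ [[ic ec] [isn es]]] := power_integral (complex.Im z) M0 z0.
  have eqf : {in (`]0, M]%classic : set R), (fun t => cpow t (z - 1) * ((1 - t / M) ^+ 0)%:C) =1
      (fun t => (expR ((complex.Re z - 1) * ln t) * cos (complex.Im z * ln t)) +i*
         (expR ((complex.Re z - 1) * ln t) * sin (complex.Im z * ln t)))}.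
    move=> t _; rewrite expr0 mulr1.
    apply: complexP; rewrite ?Re_cpow ?Im_cpow ?ReB ?ImB /= ?subr0//.
  split.
    by apply: (eq_cintegrable mM (fun t tM => esym (eqf t tM))); split.
  rewrite /euler_beta (@eq_Cintegral _ _ (measurableTypeR R) leb _ _ _ eqf) big_ord_recl big_ord0 mulr1 addr0 mulr1.
  have ab0 : complex.Re z ^+ 2 + complex.Im z ^+ 2 != 0.
    by rewrite gt_eqF// ltr_pwDl ?exprn_gt0 ?sqr_ge0.
  apply: complexP; rewrite ?ReM ?ImM ?Re_cpow ?Im_cpow /= ?ec ?es; field => //.
have z10 : 0 < complex.Re (z + 1) by rewrite ReD addr_gt0.
have [i1 e1] := IH z z0; have [i2 e2] := IH (z + 1) z10.
have eqf : {in (`]0, M]%classic : set R), (fun t => cpow t (z - 1) * ((1 - t / M) ^+ n.+1)%:C) =1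
   (fun t => cpow t (z - 1) * ((1 - t / M) ^+ n)%:C
     - M^-1%:C * (cpow t (z + 1 - 1) * ((1 - t / M) ^+ n)%:C))}.
  move=> t; rewrite inE /= in_itv /= => /andP[t0 _].
  have -> : z + 1 - 1 = z - 1 + 1 by ring.
  rewrite (cpowD t (z - 1) 1) (cpow1 t0) exprS !rmorphM rmorphB rmorphM rmorph1 /=; ring.
have i3 := cintegrableZl mM (M^-1%:C) i2.
split.
  by apply: (eq_cintegrable mM (fun t tM => esym (eqf t tM))); exact: cintegrableB.
rewrite /euler_beta (@eq_Cintegral _ _ (measurableTypeR R) leb _ _ _ eqf) CintegralB// CintegralZl//.
rewrite -/(euler_beta M n z) -/(euler_beta M n (z + 1)).
rewrite mulrBl big_ord_recr /= mulrA e1.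
have -> : (\prod_(i < n.+1) (z + i%:R%:C)) * (z + n.+1%:R%:C) =
   z * \prod_(i < n.+1) (z + 1 + i%:R%:C).
  transitivity (\prod_(i < n.+2) (z + i%:R%:C)); first by rewrite [RHS]big_ord_recr.
  rewrite big_ord_recl /= addr0.
  by congr (_ * _); apply: eq_bigr => i _; rewrite /bump /= natrD rmorphD /= addrA.
transitivity (cpow M z * n`!%:R%:C * (z + n.+1%:R%:C) - M^-1%:C * z *
   (euler_beta M n (z + 1) * \prod_(i < n.+1) (z + 1 + i%:R%:C))); first by ring.
rewrite e2 cpowD cpow1// factS natrM rmorphM /=.
have MM : M^-1%:C * M%:C = 1 :> R[i].
  by rewrite -rmorphM /= mulVf ?rmorph1// gt_eqF.
transitivity (cpow M z * n`!%:R%:C * (z + n.+1%:R%:C) -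
  (M^-1%:C * M%:C) * z * cpow M z * n`!%:R%:C); first by ring.
by rewrite MM; ring.
Qed.

End gauss_product.

Section gamma_limit.
Context {R : realType}.
Local Notation leb := (@lebesgue_measure R).
Local Notation D := (`]0, +oo[%classic : set R).

Lemma integrable_setU d (T : measurableType d) (mu : {measure set T -> \bar R})
    (A B : set T) (f : T -> R) : measurable A -> measurable B ->
  mu.-integrable A (EFin \o f) -> mu.-integrable B (EFin \o f) ->
  mu.-integrable (A `|` B) (EFin \o f).
Proof.
move=> mA mB iA iB.
have mf : measurable_fun (A `|` B) f.
  by apply/measurable_funU => //; split; apply/measurable_EFinP; [case/integrableP : iA|case/integrableP : iB].
have h (E : set T) : measurable E -> mu.-integrable E (EFin \o f) ->
    mu.-integrable setT (EFin \o (fun x => `|(f \_ E) x|)).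
  move=> mE iE; apply: integrable_norm.
  by have := (integrable_mkcond _ mE).1 iE; rewrite restrict_EFin.
apply/(integrable_mkcond _ (measurableU _ _ mA mB)); rewrite restrict_EFin.
apply: (le_real_integrable measurableT _ (real_integrableD measurableT (h _ mA iA) (h _ mB iB))).
  exact: (measurable_restrictT f (measurableU _ _ mA mB)).1.
move=> x _; rewrite /patch in_setU.
by case: (x \in A); case: (x \in B) => /=; rewrite ?normr0 ?addr0 ?add0r// lerDl.
Qed.

Lemma real_integrable_cst d (T : measurableType d) (mu : {measure set T -> \bar R})
    (A : set T) (c : R) : measurable A -> (mu A < +oo)%E ->
  mu.-integrable A (EFin \o (fun=> c)).
Proof.
move=> mA fA; apply/integrableP; split; first exact: measurable_cst.
rewrite (_ : (fun x => _) = cst `|c|%:E)// integral_cst//.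
by apply: lte_mul_pinfty => //; rewrite lee_fin.
Qed.

Lemma integrable_gamma (a : R) : 0 < a ->
  leb.-integrable D (EFin \o (fun t => expR ((a - 1) * ln t) * expR (- t))).
Proof.
move=> a0.
have -> : D = (`]0, 1] `|` `]1, +oo[)%classic.
  by rewrite -itv_bndbnd_setU// bnd_simp.
have mf : measurable_fun D (fun t : R => expR ((a - 1) * ln t) * expR (- t)).
  apply: open_continuous_measurable_fun; first exact: interval_open.
  move=> x; rewrite inE /= in_itv /= andbT => x0; apply: cvgM.
    apply: continuous_comp; last exact: continuous_expR.
    exact: continuous_lnM.
  by apply: continuous_comp; [exact: continuousN|exact: continuous_expR].
apply: integrable_setU => //.
- have [[i _] _] := power_integral 0 ltr01 a0.
  apply: (le_real_integrable _ _ i) => //.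
    by apply: measurable_funS mf => //; apply: subset_itvl; rewrite bnd_simp.
  move=> x /=; rewrite in_itv /= => /andP[x0 _].
  rewrite normrM !ger0_norm ?expR_ge0// ler_piMr ?expR_ge0//.
  by rewrite expR_le1 oppr_le0 ltW.
- have h2 : (0 : R) < 2^-1 by [].
  have [i _] := exp_integral h2.
  pose k : R := `|a - 1|.
  (* From ln y <= y at y = x / (2 (k + 1)) one gets k ln x <= x/2 + k ln (2 (k + 1)). Half of the
     decay of e^{-x} thus absorbs the power, at the price of the factor [c]. *)
  pose c := expR (k * ln (2 * (k + 1))).
  have k0 : 0 <= k by exact: normr_ge0.
  have := real_integrableZl measurable_0y c i => {}i.
  have m1 : measurable (`]1, +oo[%classic : set (measurableTypeR R)) by exact: measurable_itv.
  apply: (@le_real_integrable _ _ (measurableTypeR R) leb _ m1 _ (fun x => c * expR (- 2^-1 * x))).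
  + by apply: measurable_funS mf => //; apply: subset_itvr; rewrite bnd_simp.
  + by apply: integrableS i => //; apply: subset_itvr; rewrite bnd_simp.
  move=> x /=; rewrite in_itv /= andbT => x1.
  have x0 : 0 < x by exact: lt_trans x1.
  rewrite normrM !ger0_norm ?expR_ge0// /c -!expRD ler_expR.
  have lx0 : 0 <= ln x by rewrite ln_ge0// ltW.
  have k1 : 0 < 2 * (k + 1) by rewrite mulr_gt0// ltr_wpDl.
  have h1 : (a - 1) * ln x <= k * ln x by rewrite ler_wpM2r// ler_norm.
  have h3 : ln x = ln (x / (2 * (k + 1))) + ln (2 * (k + 1)).
    by rewrite -lnM ?posrE ?divr_gt0// divfK// gt_eqF.
  have h4 : ln (x / (2 * (k + 1))) <= x / (2 * (k + 1)).
    by apply/ltW/ln_sublinear; rewrite divr_gt0.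
  have h5 : k * ln (x / (2 * (k + 1))) <= k * (x / (2 * (k + 1))) by exact: ler_wpM2l.
  have h6 : k * (x / (2 * (k + 1))) <= x / 2.
    have -> : k * (x / (2 * (k + 1))) = (x / 2) * (k / (k + 1)).
      by field; rewrite gt_eqF// ltr_wpDl.
    have kk : k / (k + 1) <= 1 by rewrite ler_pdivrMr ?ltr_wpDl// mul1r lerDl ler01.
    by rewrite ler_piMr// divr_ge0// ltW.
  have h7 : k * ln x = k * ln (x / (2 * (k + 1))) + k * ln (2 * (k + 1)).
    by rewrite h3 mulrDr.
  by lra.
Qed.

(** The integrands are extended by 0 beyond n + 1, so that all live on the half-line. By
    [expB_bounds] they are then dominated by the Gamma integrand at Re z. *)
Lemma ccvg_euler_beta (z : R[i]) : 0 < complex.Re z ->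
  ccvg (fun n => euler_beta n.+1%:R n.+1 z) (Gamma z).
Proof.
move=> z0.
pose P n : set R := `]0, n.+1%:R]%classic.
pose f n t : R[i] := cpow t (z - 1) * ((1 - t / n.+1%:R) ^+ n.+1)%:C.
pose g (t : R) : R := expR ((complex.Re z - 1) * ln t) * expR (- t).
have DP n : D `&` P n = P n.
  apply/seteqP; split => [x []//|x Px]; split => //.
  by move: Px; rewrite /P /= !in_itv /= andbT => /andP[].
have mP n : measurable (P n : set (measurableTypeR R)) by exact: measurable_itv.
have Ref n t : complex.Re (f n t) = complex.Re (cpow t (z - 1)) * (1 - t / n.+1%:R) ^+ n.+1.
  by rewrite /f ReM /=; ring.
have Imf n t : complex.Im (f n t) = complex.Im (cpow t (z - 1)) * (1 - t / n.+1%:R) ^+ n.+1.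
  by rewrite /f ImM /=; ring.
pose F n t : R[i] := ((fun t => complex.Re (f n t)) \_ (P n)) t +i*
   ((fun t => complex.Im (f n t)) \_ (P n)) t.
have eF n : euler_beta n.+1%:R n.+1 z = Cintegral leb D (F n).
  rewrite /euler_beta /Cintegral /F /=.
  by rewrite -!Rintegral_mkcondr DP.
have mpol n : measurable_fun D (fun t : R => (1 - t / n.+1%:R) ^+ n.+1).
  apply: measurable_funX; apply: measurable_funB => //.
  by apply: measurable_funM.
have mRe n : measurable_fun D (fun t => complex.Re (F n t)).
  apply/(measurable_restrict _ (mP n) measurable_0y); rewrite DP.
  apply: (measurable_funS measurable_0y); first by rewrite -DP; exact: subIsetl.
  under [fun t => complex.Re _]eq_fun do rewrite Ref.
  exact: (measurable_funM (measurable_Re_cpow _) (mpol n)).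
have mIm n : measurable_fun D (fun t => complex.Im (F n t)).
  apply/(measurable_restrict _ (mP n) measurable_0y); rewrite DP.
  apply: (measurable_funS measurable_0y); first by rewrite -DP; exact: subIsetl.
  under [fun t => complex.Im _]eq_fun do rewrite Imf.
  exact: (measurable_funM (measurable_Im_cpow _) (mpol n)).
have bpol n t : P n t -> 0 <= (1 - t / n.+1%:R) ^+ n.+1 <= expR (- t).
  rewrite /P /= in_itv /= => /andP[t0 tn].
  have /andP[_ ->] := expB_bounds (ltW t0) tn; rewrite andbT exprn_ge0//.
  by rewrite subr_ge0 ler_pdivrMr ?ltr0n// mul1r.
have abs_bound (c p e q : R) : 0 <= e -> `|c| <= 1 -> 0 <= p <= q -> `|e * c * p| <= e * q.
  move=> e0 c1 /andP[p0 pq]; rewrite !normrM (ger0_norm e0) (ger0_norm p0).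
  rewrite -mulrA ler_wpM2l//; apply: (@le_trans _ _ (1 * p)); last by rewrite mul1r.
  by rewrite ler_wpM2r.
have := @dominated_Cintegral _ _ (measurableTypeR R) leb D measurable_0y F
  (fun t => cpow t (z - 1) * (expR (- t))%:C) g mRe mIm _ _ _ _.
case.
- move=> t /=; rewrite in_itv /= andbT => t0.
  have tP : \forall n \near \oo, t \in P n.
    near=> n; rewrite inE /P /= in_itv /= t0 /=.
    apply: (@le_trans _ _ n%:R); last by rewrite ler_nat.
    by near: n; exact: nbhs_infty_ger.
  have cve := cvg_euler (ltW t0).
  split.
  + have : complex.Re (f n t) @[n --> \oo] --> complex.Re (cpow t (z - 1) * (expR (- t))%:C).
      rewrite ReM /= mulr0 subr0; under eq_fun do rewrite Ref.
      by apply: cvgM => //; exact: cvg_cst.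
    apply: cvg_trans; apply: near_eq_cvg; near=> n.
    by rewrite /F /= patchE; have -> : t \in P n by near: n.
  + have : complex.Im (f n t) @[n --> \oo] --> complex.Im (cpow t (z - 1) * (expR (- t))%:C).
      rewrite ImM /= mulr0 add0r; under eq_fun do rewrite Imf.
      by apply: cvgM => //; exact: cvg_cst.
    apply: cvg_trans; apply: near_eq_cvg; near=> n.
    by rewrite /F /= patchE; have -> : t \in P n by near: n.
- exact: integrable_gamma.
- move=> n t _; rewrite /F /= patchE; case: ifPn => [/set_mem tP|_].
    by rewrite Ref Re_cpow ReB; apply: abs_bound; rewrite ?expR_ge0 ?cos_max ?bpol.
  by rewrite normr0 mulr_ge0 ?expR_ge0.
- move=> n t _; rewrite /F /= patchE; case: ifPn => [/set_mem tP|_].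
    by rewrite Imf Im_cpow ReB; apply: abs_bound; rewrite ?expR_ge0 ?sin_max ?bpol.
  by rewrite normr0 mulr_ge0 ?expR_ge0.
move=> _ [h1 h2]; split.
- by under eq_fun do rewrite eF.
- by under eq_fun do rewrite eF.
Unshelve. all: end_near. Qed.

(** At a real point the integrand is real and positive. The constant [c] bounds it from below on
    [1, 2], where 0 <= ln x <= ln 2 and x <= 2. *)
Lemma Gamma_gt0 (a : R) : 0 < a -> Gamma a%:C != 0.
Proof.
move=> a0.
have i := integrable_gamma a0.
have h : complex.Re (Gamma a%:C) = \int[leb]_(x in D) (expR ((a - 1) * ln x) * expR (- x)).
  rewrite /Gamma /=; apply: eq_Rintegral => x _.
  have -> : ln x * (a - 1) - 0 * (0 - 0) = (a - 1) * ln x by ring.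
  have -> : ln x * (0 - 0) + 0 * (a - 1) = 0 by ring.
  by rewrite cos0 mulr1 mulr0 subr0.
suff : 0 < complex.Re (Gamma a%:C).
  by apply: contraTneq => ->; rewrite /= ltxx.
rewrite h.
pose c : R := expR (- `|a - 1| * ln 2) * expR (- 2).
have c0 : 0 < c by rewrite mulr_gt0 ?expR_gt0.
pose J : set R := `[1, 2]%classic.
have mJ : measurable (J : set (measurableTypeR R)) by exact: measurable_itv.
have lebJ : lebesgue_measure J = 1%:E.
  by rewrite /J lebesgue_measure_itv /= lte_fin ltr1n /= -EFinB; congr EFin; lra.
have JD : J `<=` D.
  by move=> x; rewrite /J /= !in_itv /= andbT => /andP[x1 _]; exact: lt_le_trans x1.
have iJ := integrableS measurable_0y mJ JD i.
apply: (@lt_le_trans _ _ (\int[leb]_(x in J) c)).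
  by rewrite Rintegral_cst// -[ltRHS]/(c * fine (lebesgue_measure J)) lebJ mulr1.
apply: (@le_trans _ _ (\int[leb]_(x in J) (expR ((a - 1) * ln x) * expR (- x)))).
  apply: le_Rintegral => //.
    by apply: real_integrable_cst => //; rewrite [X in (X < _)%E]lebJ ltry.
  move=> x; rewrite /J /= in_itv /= => /andP[x1 x2].
  rewrite /c -!expRD ler_expR lerD// ?lerN2//.
  have l0 : 0 <= ln x by exact: ln_ge0.
  have l2 : ln x <= ln 2 by rewrite ler_ln ?posrE// (lt_le_trans _ x1).
  rewrite mulNr lerNl -mulNr (le_trans (ler_norm _))// normrM normrN (ger0_norm l0).
  by rewrite ler_wpM2l.
rewrite /Rintegral fine_le//.
- exact: integrable_fin_num.
- exact: integrable_fin_num.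
- apply: ge0_subset_integral => //.
  by case/integrableP : i.
Qed.

End gamma_limit.

(** * Levy integrability, Frullani integrals and Malmsten's constant *)

Section levy_khintchine_integrand.
Context {R : realType}.
Local Notation T := (measurableTypeR R).

Definition sqr_min1 (x : R) : R := Num.min (`|x| ^+ 2) 1.

Lemma sqr_min1_ge0 x : 0 <= sqr_min1 x.
Proof. by rewrite /sqr_min1 le_min ler01 exprn_ge0. Qed.

Lemma measurable_sqr_min1 : measurable_fun (setT : set T) sqr_min1.
Proof.
apply: measurable_minr; last exact: measurable_cst.
by apply: measurable_funX; exact: normr_measurable.
Qed.

Lemma Re_LK (b t x : R) : complex.Re (LK_integrand b t x) = cos (t * x) - 1.
Proof. by rewrite /LK_integrand /= expR0; ring. Qed.

Lemma Im_LK (b t x : R) : complex.Im (LK_integrand b t x) =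
  sin (t * x) - t * x * \1_(`[- b, b] : set R) x.
Proof. by rewrite /LK_integrand /= expR0; ring. Qed.

Lemma measurable_Re_LK (b t : R) :
  measurable_fun (setT : set T) (fun x => complex.Re (LK_integrand b t x)).
Proof.
under [fun x => complex.Re _]eq_fun do rewrite Re_LK.
by apply: measurable_funB => //; exact: measurable_cosM.
Qed.

Lemma measurable_Im_LK (b t : R) :
  measurable_fun (setT : set T) (fun x => complex.Im (LK_integrand b t x)).
Proof.
under [fun x => complex.Im _]eq_fun do rewrite Im_LK.
apply: measurable_funB; first exact: measurable_sinM.
apply: measurable_funM; first exact: measurable_funM.
exact: measurable_indic.
Qed.

Lemma le_1Bcos_sqr (y : R) : 1 - cos y <= y ^+ 2.
Proof.
have hx : y = (y / 2) *+ 2 by rewrite -mulr_natr divfK.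
have -> : cos y = 1 - 2 * sin (y / 2) ^+ 2.
  rewrite {1}hx cos_mulr2n cos2sin2 mulr2n; lra.
have h1 := le_sin (y / 2).
have h2 : sin (y / 2) ^+ 2 <= (y / 2) ^+ 2.
  by rewrite -[leLHS]real_normK ?num_real// -[leRHS]real_normK ?num_real// lerXn2r ?nnegrE.
have : 0 <= y ^+ 2 by exact: sqr_ge0.
by move: h2; rewrite expr_div_n; lra.
Qed.

(** The mean value theorem gives sin y - y = y (cos c - 1) with c between 0 and y, and 1 - cos c <=
    |c|. The quadratic order is the one that the weight min(x^2, 1) asks for. *)
Lemma le_subr_sin (y : R) : `|sin y - y| <= y ^+ 2.
Proof.
wlog y0 : y / 0 <= y => [h|].
  have [|/ltW y0] := leP 0 y; first exact: h.
  have := h (- y); rewrite oppr_ge0 sinN sqrrN => /(_ y0).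
  have -> : - sin y - - y = - (sin y - y) by ring.
  by rewrite normrN.
have [->|yn0] := eqVneq y 0; first by rewrite sin0 subr0 normr0 expr0n.
have {}y0 : 0 < y by rewrite lt_neqAle eq_sym yn0.
pose f (x : R) := sin x - x.
have df (x : R) : is_derive x (1 : R) f (cos x - 1).
  by apply: is_deriveBr; exact: is_derive_sin.
have cf : {within `[0, y], continuous f}.
  apply: continuous_subspaceT => x; apply: cvgB; last exact: cvg_id.
  exact: continuous_sin.
have [c cy] := @MVT R f (fun x => cos x - 1) 0 y y0 (fun x _ => df x) cf.
rewrite {1}/f {1}/f sin0 !subr0 => ->.
rewrite normrM (gtr0_norm y0) expr2 ler_pM2r//.
have c1 : 0 <= 1 - cos c by rewrite subr_ge0 cos_le1.
rewrite distrC (ger0_norm c1) (le_trans (le_1Bcos _))//.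
by move: cy; rewrite in_itv /= => /andP[h1 h2]; rewrite gtr0_norm// ltW.
Qed.

Lemma LK_bound (b t : R) : 0 < b -> exists2 k : R, 0 <= k & forall x,
  `|complex.Re (LK_integrand b t x)| <= k * sqr_min1 x /\
  `|complex.Im (LK_integrand b t x)| <= k * sqr_min1 x.
Proof.
(* [k1] covers both kinds of bound on the integrand, (tx)^2 inside the truncation and the constant 2
   outside. [k2] compares with min(x^2, 1): its terms 1 and b^2 serve for |x| <= b, and b^-2 turns
   x^2 > b^2 into a lower bound 1. *)
move=> b0; pose k1 : R := 2 + t ^+ 2; pose k2 : R := 1 + b ^+ 2 + b ^- 2.
have b2 : 0 < b ^+ 2 by rewrite exprn_gt0.
have b2i : 0 < b ^- 2 by rewrite invr_gt0.
have k1_ge0 : 0 <= k1 by rewrite addr_ge0 ?sqr_ge0.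
have k2_ge1 : 1 <= k2 by rewrite /k2; lra.
exists (k1 * k2); first by rewrite mulr_ge0// (le_trans _ k2_ge1).
move=> x; rewrite -mulrA.
have xE : `|x| ^+ 2 = x ^+ 2 by rewrite real_normK ?num_real.
have big1 : b < `|x| -> 1 <= k2 * sqr_min1 x.
  move=> bx; rewrite /sqr_min1 minr_pMr ?le_min ?(le_trans _ k2_ge1)// mulr1 k2_ge1 andbT.
  have h : b ^+ 2 <= `|x| ^+ 2 by rewrite lerXn2r ?nnegrE ?(ltW b0)// ltW.
  have h3 : b ^- 2 * b ^+ 2 <= b ^- 2 * `|x| ^+ 2 by rewrite ler_pM2l.
  move: h3; rewrite mulVf ?gt_eqF// => h3.
  have : 0 <= (1 + b ^+ 2) * `|x| ^+ 2 by rewrite mulr_ge0 ?exprn_ge0// addr_ge0 ?ltW.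
  by rewrite /k2 !mulrDl; lra.
have small : `|x| <= b -> x ^+ 2 <= k2 * sqr_min1 x.
  move=> xb; rewrite /sqr_min1 minr_pMr ?le_min ?(le_trans _ k2_ge1)// mulr1 xE.
  have h : `|x| ^+ 2 <= b ^+ 2 by rewrite lerXn2r ?nnegrE ?(ltW b0).
  rewrite ler_peMl ?sqr_ge0//= /k2; move: h; rewrite xE; lra.
have m0 : 0 <= k2 * sqr_min1 x.
  by rewrite mulr_ge0 ?sqr_min1_ge0 ?(le_trans _ k2_ge1).
have t2 : 0 <= t ^+ 2 by exact: sqr_ge0.
rewrite Re_LK Im_LK indicE.
have c1 : 0 <= 1 - cos (t * x) by rewrite subr_ge0 cos_le1.
have c2 := cos_geN1 (t * x).
have c3 := le_1Bcos_sqr (t * x).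
have s1 := sin_max (t * x).
have s2 := le_subr_sin (t * x).
have k1m a c : 0 <= c -> 0 <= a -> a <= 2 + t ^+ 2 -> a * c <= k1 * c.
  by move=> ? ? h; rewrite ler_wpM2r.
have [xb|bx] := leP `|x| b.
  have -> : (x \in (`[- b, b]%classic : set R)) = true.
    by apply: mem_set; rewrite /= in_itv /= -ler_norml.
  rewrite mulr1 distrC (ger0_norm c1).
  have h : (t * x) ^+ 2 <= k1 * (k2 * sqr_min1 x).
    rewrite exprMn; apply: (@le_trans _ _ (t ^+ 2 * (k2 * sqr_min1 x))).
      by rewrite ler_wpM2l// small.
    by apply: k1m => //; lra.
  by split; [exact: le_trans c3 h|exact: le_trans s2 h].
have -> : (x \in (`[- b, b]%classic : set R)) = false.
  by apply/negbTE; rewrite notin_setE /= in_itv /= -ler_norml; apply/negP; rewrite -ltNge.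
rewrite mulr0 subr0 distrC (ger0_norm c1).
have h : 2 <= k1 * (k2 * sqr_min1 x).
  have := big1 bx => h; apply: (@le_trans _ _ (2 * (k2 * sqr_min1 x))).
    by rewrite ler_peMr.
  by apply: k1m => //; lra.
by split; lra.
Qed.

Lemma cintegrable_LK (m : {measure set T -> \bar R}) (D : set T) (b t : R) :
  measurable D -> 0 < b -> m.-integrable D (EFin \o sqr_min1) ->
  cintegrable m D (LK_integrand b t).
Proof.
move=> mD b0 im; have [k k0 hk] := LK_bound t b0.
apply: (@le_cintegrable _ _ _ _ _ mD _ (fun x => k * sqr_min1 x)) => //.
- by apply: measurable_funTS; exact: measurable_Re_LK.
- by apply: measurable_funTS; exact: measurable_Im_LK.
- exact: real_integrableZl.
- by move=> x _; case: (hk x).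
- by move=> x _; case: (hk x).
Qed.

End levy_khintchine_integrand.

Section exponential_estimates.
Context {R : realType}.
Local Notation leb := (@lebesgue_measure R).
Local Notation D := (`]0, +oo[%classic : set R).
Implicit Types x : R.

Lemma expRN_le x : 0 <= x -> expR (- x) <= (1 + x)^-1.
Proof.
move=> x0; rewrite expRN lef_pV2 ?posrE ?expR_gt0//; first exact: expR_ge1Dx.
by rewrite ltr_pwDl.
Qed.

Lemma expRN_le2 x : 0 <= x -> expR (- x) <= 1 - x + x ^+ 2.
Proof.
move=> x0; apply: (le_trans (expRN_le x0)).
have x1 : 0 < 1 + x by rewrite ltr_pwDl.
rewrite -(@ler_pM2r _ (1 + x))// mulVf ?gt_eqF//.
have -> : (1 - x + x ^+ 2) * (1 + x) = 1 + x ^+ 3 by ring.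
by rewrite lerDl exprn_ge0.
Qed.

Lemma onem_expRN_ge x : 0 <= x -> x / (1 + x) <= 1 - expR (- x).
Proof.
move=> x0; have := expRN_le x0; have x1 : 1 + x != 0 by rewrite gt_eqF// ltr_pwDl.
have -> : x / (1 + x) = 1 - (1 + x)^-1 by field.
lra.
Qed.

Lemma onem_expRN_gt0 x : 0 < x -> 0 < 1 - expR (- x).
Proof. by move=> x0; rewrite subr_gt0 expR_lt1 oppr_lt0. Qed.

Lemma onem_expRN_le x : 1 - expR (- x) <= x.
Proof. by have := expR_ge1Dx (- x); lra. Qed.

(** Half of the exponential absorbs the factor x, because ax/2 <= e^{ax/2}. *)
Lemma integrable_id_expRN (a : R) : 0 < a ->
  leb.-integrable D (EFin \o (fun x => x * expR (- a * x))).
Proof.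
move=> a0; have a20 : 0 < a / 2 by rewrite divr_gt0.
have [i _] := exp_integral a20.
have ih := real_integrableZl measurable_0y (2 / a) i.
apply: (@le_real_integrable _ _ (measurableTypeR R) leb _ measurable_0y _
  (fun x => 2 / a * expR (- (a / 2) * x))) => //.
  by apply: measurable_funM => //; exact: measurable_expRM.
move=> x /=; rewrite in_itv /= andbT => x0.
rewrite normrM (gtr0_norm x0) ger0_norm ?expR_ge0//.
have -> : - a * x = - (a / 2) * x + - (a / 2 * x) by field.
rewrite expRD mulrCA [leRHS]mulrC ler_wpM2l ?expR_ge0//.
rewrite expRN ler_pdivrMr ?expR_gt0//.
have h := expR_ge1Dx (a / 2 * x).
rewrite -(@ler_pM2l _ (a / 2))//.
have -> : a / 2 * (2 / a * expR (a / 2 * x)) = expR (a / 2 * x) by field; rewrite gt_eqF.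
lra.
Qed.

End exponential_estimates.

(** * The logarithm as a Frullani integral *)

Section frullani_logarithm.
Context {R : realType}.
Local Notation leb := (@lebesgue_measure R).
Local Notation D := (`]0, +oo[%classic : set R).

Lemma measurable_expRN (E : set R) : measurable_fun E (fun x : R => expR (- x)).
Proof.
apply: measurable_funTS; apply: continuous_measurable_fun => x.
by apply: continuous_comp; [exact: continuousN|exact: continuous_expR].
Qed.

Lemma exp_integral_itv (a b : R) : 0 < a -> 0 < b ->
  leb.-integrable `]0, b] (EFin \o (fun x => expR (- a * x))) /\
  \int[leb]_(x in `]0, b]) expR (- a * x) = (1 - expR (- a * b)) / a.
Proof.
move=> a0 b0.
have [||||i ->] := @ge0_FTC_left R (fun x => expR (- a * x))
    (fun x => - a^-1 * expR (- a * x)) b (- a^-1) b0.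
- by move=> x _; exact: expR_ge0.
- by move=> x _; exact: continuous_expRM.
- move=> x _; apply: is_derive_eq (is_derive_cstM _ (is_derive_exp (is_derive_Ml _ _))) _.
  by field; rewrite gt_eqF.
- rewrite -[X in _ --> X]mulr1 -expR0 -[X in expR X](mulr0 (- a)).
  apply: cvgM; first exact: cvg_cst.
  apply: (@cvg_comp _ _ _ (fun x : R => expR (- x)) (fun y => expR (- a * y)) _ (nbhs (0 : R))).
    exact: cvgr_expR.
  exact: (@continuous_expRM R (- a) 0).
by split => //; ring.
Qed.

Definition frullani_kernel (c x : R) : R := (expR (- x) - expR (- c * x)) / x.

(** Factor out the slower of the two exponentials and apply 1 - e^{-y} <= y. Which one is slower
    depends on whether [c] is below 1; the sum on the right covers both cases. *)
Lemma frullani_kernel_bound (c x : R) : 0 < x ->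
  `|frullani_kernel c x| <= `|c - 1| * (expR (- 1 * x) + expR (- c * x)).
Proof.
move=> x0; rewrite /frullani_kernel mulN1r normrM normfV (gtr0_norm x0) ler_pdivrMr//.
have eE (u v : R) : u <= v -> `|expR (- u * x) - expR (- v * x)| <= (v - u) * expR (- u * x) * x.
  move=> uv; have -> : - v * x = - u * x + - ((v - u) * x) by ring.
  rewrite expRD -[X in X - _]mulr1 -mulrBr normrM (ger0_norm (expR_ge0 _)).
  have uvx : 0 <= (v - u) * x by rewrite mulr_ge0 ?subr_ge0// ltW.
  have -> : (v - u) * expR (- u * x) * x = expR (- u * x) * ((v - u) * x) by ring.
  rewrite ler_wpM2l ?expR_ge0//.
  by rewrite ger0_norm ?onem_expRN_le// subr_ge0 expR_le1 oppr_le0.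
have [c1|/ltW c1] := leP c 1.
- have := eE c 1 c1; rewrite mulN1r distrC => h; apply: (le_trans h).
  have -> : `|c - 1| = 1 - c by rewrite distrC ger0_norm ?subr_ge0.
  apply: ler_wpM2r; first exact: ltW.
  by rewrite ler_wpM2l ?subr_ge0// lerDr expR_ge0.
- have := eE 1 c c1; rewrite mulN1r => h; apply: (le_trans h).
  have -> : `|c - 1| = c - 1 by rewrite ger0_norm ?subr_ge0.
  apply: ler_wpM2r; first exact: ltW.
  by rewrite ler_wpM2l ?subr_ge0// lerDl expR_ge0.
Qed.

Lemma measurable_frullani_kernel (c : R) : measurable_fun D (frullani_kernel c).
Proof.
apply: measurable_funM; last exact: measurable_invr_0y.
by apply: measurable_funB; [exact: measurable_expRN|exact: measurable_expRM].
Qed.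

Lemma integrable_frullani_kernel (c : R) : 0 < c ->
  leb.-integrable D (EFin \o frullani_kernel c).
Proof.
move=> c0; have [i1 _] := exp_integral (@ltr01 R); have [i2 _] := exp_integral c0.
have ih := real_integrableZl measurable_0y `|c - 1| (real_integrableD measurable_0y i1 i2).
apply: (@le_real_integrable _ _ (measurableTypeR R) leb _ measurable_0y _
  (fun x => `|c - 1| * (expR (- 1 * x) + expR (- c * x)))) => //.
- exact: measurable_frullani_kernel.
- by move=> x /=; rewrite in_itv /= andbT => x0; exact: frullani_kernel_bound.
Qed.

Lemma frullani_ln (c : R) : 0 < c -> \int[leb]_(x in D) frullani_kernel c x = ln c.
Proof.
pose J (c : R) := \int[leb]_(x in D) frullani_kernel c x.
have dk (s x : R) : 0 < x -> is_derive s (1 : R) (frullani_kernel^~ x) (expR (- s * x)).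
  move=> x0; rewrite /frullani_kernel.
  have e : (fun c0 : R => expR (- c0 * x)) = (fun c0 => expR (c0 * (- x))).
    by apply/funext => u; rewrite mulrN mulNr.
  have h := is_deriveMr (is_deriveBr (is_derive_cstr (expR (- x)) s)
     (is_derive_exp (is_derive_mulr_id (- x) s))) (is_derive_cstr x^-1 s).
  have -> : (fun x0 : R => (expR (- x) - expR (- x0 * x)) / x) =
    (fun x0 : R => (expR (- x) - expR (x0 * - x)) / x).
    by apply/funext => u; rewrite mulrN mulNr.
  apply: is_derive_eq h _.
  have -> : s * - x = - s * x by ring.
  by field; rewrite gt_eqF.
have dJ (s : R) : 0 < s -> is_derive s (1 : R) J s^-1.
  move=> s0; have s20 : 0 < s / 2 by rewrite divr_gt0.
  (* Staying to the right of s/2 gives the dominating function e^{-sx/2} for all parameters in the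
     window. *)
  have hI : `]s / 2, s + 1[%classic s.
    by rewrite /= in_itv /= ltrDl ltr01 andbT ltr_pdivrMr// ltr_pMr// ltr1n.
  have i_f u : `]s / 2, s + 1[%classic u -> leb.-integrable D (EFin \o frullani_kernel u).
    rewrite /= in_itv /= => /andP[h _]; apply: integrable_frullani_kernel.
    exact: lt_trans h.
  have dk' u x : `]s / 2, s + 1[%classic u -> D x -> derivable (frullani_kernel^~ x) u 1.
    move=> _ /=; rewrite in_itv /= andbT => x0.
    exact: (@ex_derive _ _ _ _ _ _ _ (dk u x x0)).
  have d1E u x : D x -> partial1of2 frullani_kernel u x = expR (- u * x).
    rewrite /= in_itv /= andbT => x0.
    by rewrite partial1of2E; exact: (@derive_val _ _ _ _ _ _ _ (dk u x x0)).
  have [ig _] := exp_integral s20.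
  have bd u x : `]s / 2, s + 1[%classic u -> D x ->
      `|partial1of2 frullani_kernel u x| <= expR (- (s / 2) * x).
    move=> hu Dx; rewrite d1E// ger0_norm ?expR_ge0// ler_expR !mulNr lerN2.
    move: hu Dx; rewrite /= !in_itv /= andbT => /andP[h _] x0.
    by rewrite ler_pM2r// ltW.
  have e1 := @derivable_under_integral R _ (measurableTypeR R) leb frullani_kernel D
    measurable_0y s _ _ hI i_f dk' _ (fun x => expR_ge0 _) ig bd.
  have e2 := @differentiation_under_integral R _ (measurableTypeR R) leb frullani_kernel D
    measurable_0y s _ _ hI i_f dk' _ (fun x => expR_ge0 _) ig bd.
  apply: DeriveDef => //; rewrite -derive1E e2.
  have [_ <-] := exp_integral s0.
  by apply: eq_Rintegral => x xD; rewrite d1E//; exact: set_mem.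
(* [J] is differentiable only on the positive reals. The substitution c = e^s turns J' = 1/c into a
   vanishing derivative on the whole line. *)
pose h s := J (expR s) - s.
have dh (s : R) : is_derive s (1 : R) h 0.
  have h1 := is_derive1_comp (dJ _ (expR_gt0 s)) (is_derive_expR s).
  apply: is_derive_eq (is_deriveBr h1 (is_derive_id s (1 : R))) _.
  by rewrite mulVf ?subrr// gt_eqF// expR_gt0.
have J1 : J 1 = 0.
  transitivity (\int[leb]_(x in D) (0 : R)).
    by apply: eq_Rintegral => x _; rewrite /frullani_kernel mulN1r subrr mul0r.
  by rewrite Rintegral_cst ?mul0r//; exact: measurable_0y.
move=> c0; have := @is_derive_0_is_cst R h (ln c) 0 dh.
rewrite /h lnK ?posrE// expR0 J1 subrr => /eqP.
by rewrite subr_eq0 => /eqP.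
Qed.

End frullani_logarithm.

(** * Malmsten's integral as a limit of sums minus logarithms *)

Section malmsten_constant.
Context {R : realType}.
Local Notation leb := (@lebesgue_measure R).
Variable s : R.
Hypothesis s0 : 0 < s.

Let E1 : set R := `]0, 1]%classic.
Let E2 : set R := `]1, +oo[%classic.
Let mE1 : measurable (E1 : set (measurableTypeR R)).
Proof. exact: measurable_itv. Qed.
Let mE2 : measurable (E2 : set (measurableTypeR R)).
Proof. exact: measurable_itv. Qed.

Let u x : R := expR (- s * x) / (1 - expR (- x)) - expR (- x) / x.
Let v x : R := expR (- s * x) / (1 - expR (- x)) - x^-1.

(** The geometric sum is split so that every piece is controlled near 0: 1/x removes the pole of
    e^{-sx}/(1 - e^{-x}) in [v], e^{-x}/x removes it in [u], and what is left over is exactly the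
    Frullani kernel whose integral is ln m. *)
Let geom_sum m x : 0 < x -> \sum_(k < m) expR (- (s + k%:R) * x) =
  u x - expR (- m%:R * x) * v x + frullani_kernel m%:R x.
Proof.
move=> x0; have x1 := onem_expRN_gt0 x0; rewrite /u /v /frullani_kernel.
have -> : \sum_(k < m) expR (- (s + k%:R) * x) =
    expR (- s * x) * ((1 - expR (- m%:R * x)) / (1 - expR (- x))).
  elim: m => [|m IH]; first by rewrite big_ord0 oppr0 mul0r expR0 subrr mul0r mulr0.
  rewrite big_ord_recr /= IH.
  have -> : - (s + m%:R) * x = - s * x + - m%:R * x by ring.
  have -> : - m.+1%:R * x = - m%:R * x + - x by rewrite -natr1; ring.
  by rewrite !expRD; field; rewrite gt_eqF.
by field; rewrite !gt_eqF.
Qed.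

(** Over the common denominator, x e^{-sx} and 1 - e^{-x} both equal x up to s x^2 and x^2
    respectively, while the denominator x (1 - e^{-x}) is at least x^2/2. *)
Let v_bound x : 0 < x -> x <= 1 -> `|v x| <= 2 * (s + 1).
Proof.
move=> x0 x1; have h1 := onem_expRN_gt0 x0.
have h2 := onem_expRN_ge (ltW x0); have h3 := onem_expRN_le x; have h4 := expRN_le2 (ltW x0).
have h5 : x / 2 <= 1 - expR (- x).
  by apply: le_trans h2; rewrite ler_pM2l// lef_pV2 ?posrE ?addr_gt0// lerD2l.
have sx0 : 0 <= s * x by rewrite mulr_ge0 ?ltW.
have h6 : x * expR (- s * x) <= x.
  by rewrite ger_pMr// expR_le1 mulNr oppr_le0.
have h7 : x - s * x ^+ 2 <= x * expR (- s * x).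
  have := expR_ge1Dx (- s * x); rewrite -(@ler_pM2l _ x)//.
  by apply: le_trans; rewrite le_eqVlt; apply/orP; left; apply/eqP; ring.
have -> : v x = (x * expR (- s * x) - (1 - expR (- x))) / (x * (1 - expR (- x))).
  by rewrite /v; field; rewrite !gt_eqF.
rewrite normrM normfV [`|x * _|]gtr0_norm ?mulr_gt0// ler_pdivrMr ?mulr_gt0//.
apply: (@le_trans _ _ ((s + 1) * x ^+ 2)).
  have x20 : 0 <= x ^+ 2 by exact: sqr_ge0.
  rewrite ler_norml; apply/andP; split; rewrite mulrDl; nra.
have -> : (s + 1) * x ^+ 2 = 2 * (s + 1) * (x * (x / 2)) by field.
rewrite ler_pM2l ?mulr_gt0 ?addr_gt0//.
by rewrite ler_pM2l.
Qed.

Let u_bound x : 0 < x -> x <= 1 -> `|u x| <= 2 * (s + 1) + 1.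
Proof.
move=> x0 x1.
have -> : u x = v x + (1 - expR (- x)) / x by rewrite /u /v; ring.
rewrite (le_trans (ler_normD _ _))// lerD ?v_bound//.
rewrite normrM normfV !gtr0_norm ?onem_expRN_gt0//.
by rewrite ler_pdivrMr// mul1r onem_expRN_le.
Qed.

Let E1D : E1 `<=` `]0, +oo[%classic.
Proof. by move=> x; rewrite /E1 /= !in_itv /= andbT => /andP[]. Qed.
Let E2D : E2 `<=` `]0, +oo[%classic.
Proof. by move=> x; rewrite /E2 /= !in_itv /= !andbT; exact: lt_trans. Qed.

Let mquot : measurable_fun (`]0, +oo[%classic : set R)
  (fun x : R => expR (- s * x) / (1 - expR (- x))).
Proof.
apply: open_continuous_measurable_fun; first exact: interval_open.
move=> x; rewrite inE /= in_itv /= andbT => x0.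
apply: cvgM; first exact: continuous_expRM.
apply: cvgV; first by rewrite gt_eqF// onem_expRN_gt0.
apply: cvgB; first exact: cvg_cst.
by apply: continuous_comp; [exact: continuousN|exact: continuous_expR].
Qed.

Let mu_ : measurable_fun E1 u.
Proof.
apply: (measurable_funS measurable_0y) E1D _.
apply: measurable_funB => //; apply: measurable_funM; last exact: measurable_invr_0y.
exact: measurable_expRN.
Qed.

Let mv_ : measurable_fun E1 v.
Proof.
apply: (measurable_funS measurable_0y) E1D _.
by apply: measurable_funB => //; exact: measurable_invr_0y.
Qed.

Let lebE1 : (leb E1 < +oo)%E.
Proof.
suff -> : leb E1 = 1%E by exact: ltry.
transitivity (lebesgue_measure E1) => //.
by rewrite /E1 lebesgue_measure_itv /= lte_fin ltr01 sube0.
Qed.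

Lemma integrable_malmsten : leb.-integrable E1 (EFin \o u).
Proof.
apply: (@le_real_integrable _ _ (measurableTypeR R) leb _ mE1 _ (fun=> 2 * (s + 1) + 1)) => //.
- exact: real_integrable_cst.
- by move=> x; rewrite /E1 /= in_itv /= => /andP[x0 x1]; exact: u_bound.
Qed.

(** The k-th term is the integral of e^{-(s+k)x} over ]0, 1]. On that interval the Frullani kernel
    in [geom_sum] cancels the part of ln (m + 1) that lives there. What remains is the integral of
    [w m] over ]0, 1], tending to that of [u], minus the Frullani integral over ]1, +oo[, tending to
    that of e^{-x}/x. *)
Lemma malmsten_constant :
  \sum_(k < m.+1) ((1 - expR (- (s + k%:R))) / (s + k%:R)) - ln m.+1%:R @[m --> \oo] -->
  (\int[leb]_(x in `[0%R, 1%R]) (expR (- s * x) / (1 - expR (- x)) - expR (- x) / x)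
   - \int[leb]_(x in `[1%R, +oo[) (expR (- x) / x)).
Proof.
have -> : \int[leb]_(x in `[0%R, 1%R]) (expR (- s * x) / (1 - expR (- x)) - expR (- x) / x)
    = \int[leb]_(x in E1) u x.
  by rewrite -Rintegral_itv_obnd_cbnd//; exact: integrable_malmsten.
have ie : leb.-integrable E2 (EFin \o (fun x => expR (- x) / x)).
  have [i _] := exp_integral (@ltr01 R).
  apply: (@le_real_integrable _ _ (measurableTypeR R) leb _ mE2 _ (fun x => expR (- 1 * x))).
  - apply: (measurable_funS measurable_0y) E2D _.
    by apply: measurable_funM; [exact: measurable_expRN|exact: measurable_invr_0y].
  - exact: (integrableS measurable_0y mE2 E2D i).
  - move=> x; rewrite /E2 /= in_itv /= andbT => x1.
    have x0 : 0 < x by exact: lt_trans x1.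
    rewrite normrM normfV (gtr0_norm x0) (ger0_norm (expR_ge0 _)) mulN1r.
    by rewrite ler_piMr ?expR_ge0// invf_le1// ltW.
have -> : \int[leb]_(x in `[1%R, +oo[) (expR (- x) / x) = \int[leb]_(x in E2) (expR (- x) / x).
  by rewrite -Rintegral_itv_obnd_cbnd.
have m0 m : (0 : R) < m.+1%:R by rewrite ltr0n.
have ifr m := @integrable_frullani_kernel R m.+1%:R (m0 m).
have lnE m : ln m.+1%:R = \int[leb]_(x in E1) frullani_kernel m.+1%:R x +
    \int[leb]_(x in E2) frullani_kernel m.+1%:R x.
  rewrite -frullani_ln// -Rintegral_setU//.
  - by congr (Rintegral _ _ _); rewrite /E1 /E2 -itv_bndbnd_setU// bnd_simp.
  - by rewrite /E1 /E2 -itv_bndbnd_setU// bnd_simp.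
  - apply/disj_setPS => x []; rewrite /E1 /E2 /= !in_itv /= andbT => /andP[_ x1].
    by rewrite ltNge x1.
have sk0 k : 0 < s + k%:R by rewrite ltr_wpDr.
have ik k := (@exp_integral_itv R _ _ (sk0 k) ltr01).
have sumE m : \sum_(k < m.+1) ((1 - expR (- (s + k%:R))) / (s + k%:R)) =
    \int[leb]_(x in E1) (\sum_(k < m.+1) expR (- (s + k%:R) * x)).
  rewrite /Rintegral; under [in RHS]eq_integral do rewrite -sumEFin.
  rewrite (integral_sum mE1 (fun k : 'I_m.+1 => (ik k).1)).
  rewrite (eq_bigr (fun k : 'I_m.+1 => ((1 - expR (- (s + k%:R))) / (s + k%:R))%:E)).
    by rewrite sumEFin.
  move=> k _; transitivity ((\int[leb]_(x in E1) expR (- (s + k%:R) * x))%:E).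
    by rewrite /Rintegral fineK//; apply: (integrable_fin_num mE1); exact: (ik k).1.
  by rewrite (ik k).2 mulr1.
have i1 := integrable_malmsten.
pose w m x : R := u x - expR (- m.+1%:R * x) * v x.
have wE m : {in E1, (fun x => \sum_(k < m.+1) expR (- (s + k%:R) * x)) =1
    (fun x => w m x + frullani_kernel m.+1%:R x)}.
  by move=> x; rewrite inE /E1 /= in_itv /= => /andP[x0 _]; rewrite geom_sum.
have emx (m : nat) x : 0 < x -> expR (- m.+1%:R * x) <= 1.
  by move=> x0; rewrite expR_le1 mulNr oppr_le0 mulr_ge0// ltW.
have w_bound m x : E1 x -> `|w m x| <= 2 * (s + 1) + 1 + 2 * (s + 1).
  rewrite /E1 /= in_itv /= => /andP[x0 x1].
  rewrite (le_trans (ler_normB _ _))// lerD ?u_bound// normrM ger0_norm ?expR_ge0//.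
  by rewrite (le_trans _ (v_bound x0 x1))// ler_piMl// emx.
have cst_int : leb.-integrable E1 (EFin \o (fun=> 2 * (s + 1) + 1 + 2 * (s + 1))).
  exact: real_integrable_cst.
have mw m : measurable_fun E1 (w m).
  apply: measurable_funB => //; apply: measurable_funM => //.
  exact: measurable_expRM.
have iw m : leb.-integrable E1 (EFin \o w m).
  exact: (le_real_integrable mE1 (mw m) cst_int (w_bound m)).
have decay x : 0 < x -> expR (- m.+1%:R * x) @[m --> \oo] --> (0 : R).
  move=> x0; have := @cvgy_expRN R x x0.
  move=> /(@cvg_comp _ _ _ (fun m : nat => m.+1%:R : R) _ \oo _ _) h.
  have := h _; rewrite (_ : (fun y => _) \o _ = (fun m : nat => expR (- m.+1%:R * x))).
    apply; apply/cvgryPge => A; near=> n.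
    apply: (@le_trans _ _ n%:R); last by rewrite ler_nat.
    by near: n; exact: nbhs_infty_ger.
  by apply/funext => m /=; congr expR; ring.
have cvw x : E1 x -> w m x @[m --> \oo] --> u x.
  rewrite /E1 /= in_itv /= => /andP[x0 _].
  rewrite /w -[X in _ --> X]subr0 -[X in _ - X](mul0r (v x)).
  apply: cvgB; first exact: cvg_cst.
  by apply: cvgM; [exact: decay|exact: cvg_cst].
have [_ c1] := @dominated_Rintegral _ _ (measurableTypeR R) leb E1 mE1 w u _ mw cvw cst_int w_bound.
have cvf x : E2 x -> frullani_kernel m.+1%:R x @[m --> \oo] --> expR (- x) / x.
  rewrite /E2 /= in_itv /= andbT => x1; have x0 : 0 < x by exact: lt_trans x1.
  rewrite /frullani_kernel; apply: cvgM; last exact: cvg_cst.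
  rewrite -[X in _ --> X]subr0; apply: cvgB; first exact: cvg_cst.
  exact: decay.
have mf m : measurable_fun E2 (frullani_kernel m.+1%:R).
  by apply: (measurable_funS measurable_0y) E2D _; exact: measurable_frullani_kernel.
have f_bound m x : E2 x -> `|frullani_kernel m.+1%:R x| <= expR (- 1 * x).
  rewrite /E2 /= in_itv /= andbT => x1; have x0 : 0 < x by exact: lt_trans x1.
  have h : expR (- m.+1%:R * x) <= expR (- x).
    by rewrite ler_expR mulNr lerN2 ler_pMl// ler1n.
  rewrite /frullani_kernel normrM normfV (gtr0_norm x0) mulN1r ger0_norm ?subr_ge0//.
  rewrite ler_pdivrMr// (@le_trans _ _ (expR (- x)))//.
    by rewrite gerBl expR_ge0.
  by rewrite ler_peMr ?expR_ge0// ltW.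
have iexp : leb.-integrable E2 (EFin \o (fun x : R => expR (- 1 * x))).
  have [i _] := exp_integral (@ltr01 R).
  exact: (integrableS measurable_0y mE2 E2D i).
have [_ c2] := @dominated_Rintegral _ _ (measurableTypeR R) leb E2 mE2
  (fun m => frullani_kernel m.+1%:R) (fun x => expR (- x) / x) _ mf cvf iexp f_bound.
rewrite (_ : (fun m => _) = (fun m => \int[leb]_(x in E1) w m x -
    \int[leb]_(x in E2) frullani_kernel m.+1%:R x)); first exact: cvgB.
apply/funext => m; rewrite sumE lnE.
rewrite (@eq_Rintegral _ (measurableTypeR R) _ leb _ _ _ (wE m)) RintegralD//.
  by ring.
exact: (integrableS measurable_0y mE1 E1D (ifr m)).
Unshelve. all: end_near. Qed.

End malmsten_constant.

(** * Levy-Khintchine form of Gamma *)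

Section levy_densities.
Context {R : realType}.
Local Notation leb := (@lebesgue_measure R).
Local Notation D := (`]0, +oo[%classic : set R).
Variable sigma : R.

Lemma gamma_densityE (x : R) : 0 < x ->
  gamma_density sigma x = expR (- sigma * x) / (x * (1 - expR (- (2 * x)))).
Proof.
move=> x0; rewrite /gamma_density indicE mem_set ?mulr1; last by rewrite /= in_itv /= x0.
rewrite mulNr (expRN (sigma * x)); field.
by rewrite !gt_eqF ?onem_expRN_gt0 ?expR_gt0 ?mulr_gt0.
Qed.

Lemma pole_densityE (x : R) : 0 < x ->
  pole_density sigma x = expR (- sigma * x) / x + expR (- (sigma - 1) * x) / x.
Proof.
move=> x0; rewrite /pole_density indicE mem_set ?mulr1; last by rewrite /= in_itv /= x0.
have -> : - (sigma - 1) * x = - sigma * x + x by ring.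
rewrite expRD mulNr expRN; field.
by rewrite !gt_eqF ?expR_gt0.
Qed.

(** The density is of order x^-2 at 0, so the full weight x^2 is consumed there. The bound 1 -
    e^{-2x} >= 2x/(1 + 2x) leaves at most (1 + x) e^{-sigma x}. *)
Lemma integrable_sqr_min1_gamma : 0 < sigma ->
  leb.-integrable D (EFin \o (fun x => sqr_min1 x * gamma_density sigma x)).
Proof.
move=> s0; have [i1 _] := exp_integral s0; have i2 := integrable_id_expRN s0.
apply: (@le_real_integrable _ _ (measurableTypeR R) leb _ measurable_0y _ _ _
  (real_integrableD measurable_0y i1 i2)).
  apply: measurable_funM; apply: measurable_funTS; first exact: measurable_sqr_min1.
  exact: measurable_gamma_density.
move=> x /=; rewrite in_itv /= andbT => x0.
have x20 : 0 <= 2 * x by rewrite mulr_ge0// ltW.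
have x21 : 0 < 2 * x by rewrite mulr_gt0.
have h1 := onem_expRN_gt0 x21.
have h2 := onem_expRN_ge x20.
have g0 := gamma_density_ge0 sigma x; rewrite (ger0_norm (mulr_ge0 (sqr_min1_ge0 x) g0)).
apply: (@le_trans _ _ (x ^+ 2 * gamma_density sigma x)).
  rewrite (ler_wpM2r g0)// /sqr_min1 ge_min.
  by rewrite real_normK ?num_real// lexx.
rewrite gamma_densityE//.
have -> : x ^+ 2 * (expR (- sigma * x) / (x * (1 - expR (- (2 * x))))) =
  expR (- sigma * x) * (x / (1 - expR (- (2 * x)))) by field; rewrite !gt_eqF.
have -> : expR (- sigma * x) + x * expR (- sigma * x) = expR (- sigma * x) * (1 + x) by ring.
rewrite ler_wpM2l ?expR_ge0// ler_pdivrMr//.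
have x12 : 0 < 1 + 2 * x by rewrite addr_gt0.
apply: (@le_trans _ _ ((1 + x) * (2 * x / (1 + 2 * x)))); last first.
  by rewrite ler_wpM2l// addr_ge0// ltW.
rewrite mulrA ler_pdivlMr//; nra.
Qed.

Lemma integrable_sqr_min1_pole : 1 < sigma ->
  leb.-integrable D (EFin \o (fun x => sqr_min1 x * pole_density sigma x)).
Proof.
move=> s1; have s0 : 0 < sigma by exact: lt_trans s1.
have s10 : 0 < sigma - 1 by rewrite subr_gt0.
apply: (@le_real_integrable _ _ (measurableTypeR R) leb _ measurable_0y _ _ _
  (real_integrableD measurable_0y (integrable_id_expRN s0) (integrable_id_expRN s10))).
  apply: measurable_funM; apply: measurable_funTS; first exact: measurable_sqr_min1.
  exact: measurable_pole_density.
move=> x /=; rewrite in_itv /= andbT => x0.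
have g0 := pole_density_ge0 sigma x; rewrite (ger0_norm (mulr_ge0 (sqr_min1_ge0 x) g0)).
apply: (@le_trans _ _ (x ^+ 2 * pole_density sigma x)).
  rewrite (ler_wpM2r g0)// /sqr_min1 ge_min.
  by rewrite real_normK ?num_real// lexx.
rewrite pole_densityE// le_eqVlt; apply/orP; left; apply/eqP.
by field; rewrite gt_eqF.
Qed.

End levy_densities.

Lemma ReMr (R : realType) (z : R[i]) (r : R) :
  complex.Re (z * r%:C) = complex.Re z * r.
Proof. by rewrite ReM mulr0 subr0. Qed.

Lemma ImMr (R : realType) (z : R[i]) (r : R) :
  complex.Im (z * r%:C) = complex.Im z * r.
Proof. by rewrite ImM mulr0 add0r. Qed.

Lemma Re_sum (R : realType) n (f : nat -> R[i]) :
  complex.Re (\sum_(k < n) f k) = \sum_(k < n) complex.Re (f k).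
Proof.
elim: n => [|n IH]; first by rewrite !big_ord0.
by rewrite !big_ord_recr /= ReD IH.
Qed.

Lemma Im_sum (R : realType) n (f : nat -> R[i]) :
  complex.Im (\sum_(k < n) f k) = \sum_(k < n) complex.Im (f k).
Proof.
elim: n => [|n IH]; first by rewrite !big_ord0.
by rewrite !big_ord_recr /= ImD IH.
Qed.

Section exponential_levy_khintchine.
Context {R : realType}.
Local Notation leb := (@lebesgue_measure R).
Local Notation D := (`]0, +oo[%classic : set R).
Variable t : R.

Definition exp_LK (a x : R) : R[i] :=
  LK_integrand (1 / 2) t x * (expR (- a * x) / x)%:C.

Lemma Re_exp_LK (a x : R) : complex.Re (exp_LK a x) =
  complex.Re (LK_integrand (1 / 2) t x) * (expR (- a * x) / x).
Proof. by rewrite /exp_LK ReM mulr0 subr0. Qed.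

Lemma Im_exp_LK (a x : R) : complex.Im (exp_LK a x) =
  complex.Im (LK_integrand (1 / 2) t x) * (expR (- a * x) / x).
Proof. by rewrite /exp_LK ImM mulr0 add0r. Qed.

Lemma half_gt0 : 0 < 1 / 2 :> R.
Proof. by rewrite divr_gt0. Qed.

Lemma cintegrable_exp_LK (a : R) : 0 < a -> cintegrable leb D (exp_LK a).
Proof.
move=> a0; have [k k0 hk] := LK_bound t half_gt0.
have ih := real_integrableZl measurable_0y k (integrable_id_expRN a0).
have bd (x r : R) : D x -> `|r| <= k * sqr_min1 x ->
    `|r * (expR (- a * x) / x)| <= k * (x * expR (- a * x)).
  rewrite /= in_itv /= andbT => x0 hr; rewrite normrM (@ger0_norm _ (expR _ / _)); last first.
    by rewrite divr_ge0 ?expR_ge0 ?ltW.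
  apply: (@le_trans _ _ (k * x ^+ 2 * (expR (- a * x) / x))).
    rewrite ler_wpM2r ?divr_ge0 ?expR_ge0 ?(ltW x0)// (le_trans hr)// ler_wpM2l//.
    by rewrite /sqr_min1 ge_min real_normK ?num_real// lexx.
  by rewrite le_eqVlt; apply/orP; left; apply/eqP; field; rewrite gt_eqF.
apply: (@le_cintegrable _ _ (measurableTypeR R) leb _ measurable_0y _ _ _ _ ih).
- under [fun x => complex.Re _]eq_fun do rewrite Re_exp_LK.
  by apply: measurable_funM; [apply: measurable_funTS; exact: measurable_Re_LK|
    exact: measurable_exp_div].
- under [fun x => complex.Im _]eq_fun do rewrite Im_exp_LK.
  by apply: measurable_funM; [apply: measurable_funTS; exact: measurable_Im_LK|
    exact: measurable_exp_div].
- by move=> x Dx; rewrite Re_exp_LK; apply: bd => //; case: (hk x).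
- by move=> x Dx; rewrite Im_exp_LK; apply: bd => //; case: (hk x).
Qed.

(** The truncation term tx 1_{]0, 1/2]}(x) against e^{-ax} dx/x is t times the integral of e^{-ax}
    over ]0, 1/2]. With a = sigma and a = sigma - 1 this produces the first two terms of
    [lambda]. *)
Lemma Cintegral_exp_kernelE (a : R) : 0 < a ->
  Cintegral leb D (exp_kernel a t) =
  Cintegral leb D (exp_LK a) + (t * ((1 - expR (- a * (1 / 2))) / a))*i.
Proof.
move=> a0; have [i e] := exp_integral_itv a0 half_gt0.
pose H : set R := `]0, 1 / 2]%classic.
have mH : measurable (H : set (measurableTypeR R)) by exact: measurable_itv.
have DH : D `&` H = H.
  apply/seteqP; split => [x []//|x Hx]; split => //.
  by move: Hx; rewrite /H /= !in_itv /= andbT => /andP[].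
pose f (x : R) : R := ((fun x => expR (- a * x)) \_ H) x.
have if_ : leb.-integrable D (EFin \o f).
  rewrite /f -restrict_EFin; apply/(integrable_restrict leb mH measurable_0y).
  by rewrite DH.
have ef : \int[leb]_(x in D) f x = (1 - expR (- a * (1 / 2))) / a.
  by rewrite -e -Rintegral_mkcondr DH.
have iK := cintegrable_exp_LK a0.
have ig : cintegrable leb D (fun x => (t * f x)*i).
  split; first exact: integrable0.
  exact: real_integrableZl.
have -> : (t * ((1 - expR (- a * (1 / 2))) / a))*i = Cintegral leb D (fun x => (t * f x)*i).
  apply: complexP => /=; first by rewrite Rintegral_cst ?mul0r//; exact: measurable_0y.
  by rewrite RintegralZl// ef.
rewrite -CintegralD//; apply: eq_Cintegral => x; rewrite inE /= in_itv /= andbT => x0.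
have ind : \1_(`[- (1 / 2), 1 / 2]%classic : set R) x = \1_H x :> R.
  rewrite !indicE; congr (nat_of_bool _)%:R; apply/idP/idP; rewrite !inE /H /= !in_itv /=.
    by case/andP => _ ->; rewrite x0.
  by case/andP => _ ->; rewrite andbT; lra.
apply: complexP.
- by rewrite ReD Re_exp_LK Re_LK Re_exp_kernel addr0.
- rewrite ImD Im_exp_LK Im_LK Im_exp_kernel ind indicE /f patchE /=.
  (* Off [H] the restricted function takes the default value [point], which must be recognised as
     0. *)
  have point0 : point = 0 :> R by [].
  by case: (x \in H) => /=; rewrite ?point0 ?mulr1n ?mulr0n; field; rewrite gt_eqF.
Qed.

Lemma cexp_exp_LK (a : R) : 0 < a ->
  a -i* t = a%:C * cexp (- (Cintegral leb D (exp_LK a) +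
     (t * ((1 - expR (- a * (1 / 2))) / a))*i)).
Proof.
move=> a0; rewrite -Cintegral_exp_kernelE// cexpN.
have h := cexp_Cintegral_exp_kernel a0 t.
rewrite -[X in X / _]h mulfK ?cexp_neq0//.
by apply: complexP; rewrite ?ReB ?ImB /=; ring.
Qed.

End exponential_levy_khintchine.

Section gamma_levy_khintchine.
Context {R : realType}.
Local Notation leb := (@lebesgue_measure R).
Local Notation D := (`]0, +oo[%classic : set R).
Variables sigma t : R.
Hypothesis sigma0 : 0 < sigma.

Let a k : R := sigma + 2 * k%:R.
Let a0 k : 0 < a k.
Proof. by rewrite /a ltr_wpDr// mulr_ge0. Qed.

Definition gamma_LK (x : R) : R[i] :=
  LK_integrand (1 / 2) t x * (gamma_density sigma x)%:C.

Lemma Re_gamma_LK (x : R) : complex.Re (gamma_LK x) =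
  complex.Re (LK_integrand (1 / 2) t x) * gamma_density sigma x.
Proof. by rewrite /gamma_LK ReM mulr0 subr0. Qed.

Lemma Im_gamma_LK (x : R) : complex.Im (gamma_LK x) =
  complex.Im (LK_integrand (1 / 2) t x) * gamma_density sigma x.
Proof. by rewrite /gamma_LK ImM mulr0 add0r. Qed.

(** A geometric sum of ratio e^{-2x}. The last factor lies in [0, 1] and tends to 1, so a bound for
    [gamma_LK] dominates all partial sums. *)
Lemma sum_exp_LK m x : 0 < x -> \sum_(k < m) exp_LK t (a k) x =
  gamma_LK x * (1 - expR (- m%:R * (2 * x)))%:C.
Proof.
move=> x0; rewrite /exp_LK -mulr_sumr -rmorph_sum /gamma_LK -mulrA -rmorphM /=.
congr (_ * _%:C); rewrite gamma_densityE//.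
have x20 : 0 < 2 * x by rewrite mulr_gt0.
have h1 := onem_expRN_gt0 x20.
elim: m => [|m IH]; first by rewrite big_ord0 oppr0 mul0r expR0 subrr mulr0.
rewrite big_ord_recr /= IH /a.
have -> : - (sigma + 2 * m%:R) * x = - sigma * x + - m%:R * (2 * x) by ring.
have -> : - m.+1%:R * (2 * x) = - m%:R * (2 * x) + - (2 * x) by rewrite -natr1; ring.
by rewrite !expRD; field; rewrite !gt_eqF.
Qed.

Lemma ccvg_sum_exp_LK :
  ccvg (fun m => \sum_(k < m) Cintegral leb D (exp_LK t (a k))) (Cintegral leb D gamma_LK).
Proof.
have [k k0 hk] := LK_bound t (@half_gt0 R).
have ih := real_integrableZl measurable_0y k (integrable_sqr_min1_gamma sigma0).
have ci j := cintegrable_exp_LK t (a0 j).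
have eS m : \sum_(k < m) Cintegral leb D (exp_LK t (a k)) =
    Cintegral leb D (fun x => \sum_(k < m) exp_LK t (a k) x).
  exact: esym (Cintegral_sum measurable_0y m ci).
have ciS m := cintegrable_sum measurable_0y m ci.
have bd (x c r : R) : 0 <= c <= 1 -> `|r| <= k * sqr_min1 x ->
    `|r * gamma_density sigma x * c| <= k * (sqr_min1 x * gamma_density sigma x).
  have g0 := gamma_density_ge0 sigma x.
  move=> /andP[c0 c1] hr; rewrite 2!normrM (ger0_norm c0) (ger0_norm g0).
  rewrite mulrA (@le_trans _ _ (k * sqr_min1 x * gamma_density sigma x * c))//.
    by apply: ler_wpM2r => //; apply: ler_wpM2r.
  rewrite ler_piMr//; apply: mulr_ge0 => //.
  by rewrite mulr_ge0 ?sqr_min1_ge0.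
have emx (m : nat) x : D x -> 0 <= 1 - expR (- m%:R * (2 * x)) <= 1.
  rewrite /= in_itv /= andbT => x0; rewrite subr_ge0 expR_le1 mulNr oppr_le0.
  by rewrite gerBl expR_ge0 andbT mulr_ge0// mulr_ge0// ltW.
have [|||||_] := @dominated_Cintegral _ _ (measurableTypeR R) leb D measurable_0y
  (fun m x => \sum_(k < m) exp_LK t (a k) x) gamma_LK
  (fun x => k * (sqr_min1 x * gamma_density sigma x)) _ _ _ ih _ _.
- move=> m; have := (ciS m).1 => /integrableP[/measurable_EFinP].
  by [].
- move=> m; have := (ciS m).2 => /integrableP[/measurable_EFinP].
  by [].
- move=> x; rewrite /= in_itv /= andbT => x0.
  have x20 : 0 < 2 * x by rewrite mulr_gt0.
  have := @cvgy_expRN R (2 * x) x20.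
  move=> /(@cvg_comp _ _ _ (fun m : nat => m%:R : R) _ \oo _ _) h.
  have cv : 1 - expR (- m%:R * (2 * x)) @[m --> \oo] --> (1 : R).
    rewrite -[X in _ --> X]subr0; apply: cvgB; first exact: cvg_cst.
    have := h _; rewrite (_ : (fun y => _) \o _ = (fun m : nat => expR (- m%:R * (2 * x)))).
      by apply; exact: cvgr_idn.
    by apply/funext => m /=; congr expR; ring.
  have e m := sum_exp_LK m x0.
  rewrite (_ : (fun m => _) = (fun m => gamma_LK x * (1 - expR (- m%:R * (2 * x)))%:C)).
    rewrite -[gamma_LK x in X in ccvg _ X]mulr1; apply: ccvgM; first exact: ccvg_cst.
    by split => //=; exact: cvg_cst.
  by apply/funext => m; exact: e.
- move=> m x Dx; have Dx' := Dx; move: Dx'; rewrite /= in_itv /= andbT => x0.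
  rewrite sum_exp_LK// ReMr Re_gamma_LK; apply: bd; first exact: emx.
  by case: (hk x).
- move=> m x Dx; have Dx' := Dx; move: Dx'; rewrite /= in_itv /= andbT => x0.
  rewrite sum_exp_LK// ImMr Im_gamma_LK; apply: bd; first exact: emx.
  by case: (hk x).
- by move=> h; under [fun m => _]eq_fun do rewrite eS.
Qed.

Definition malmsten_const : R :=
  \int[leb]_(x in `[0%R, 1%R]) (expR (- (sigma * x / 2)) / (1 - expR (- x)) - expR (- x) / x)
   - \int[leb]_(x in `[1%R, +oo[) (expR (- x) / x).

Let s := sigma / 2.
Let s0 : 0 < s. Proof. by rewrite divr_gt0. Qed.
Let z : R[i] := s +i* (- (t / 2)).

(** The exponent relating the Euler integrals at [z] and at [s]. The power 1 - t/M raised to n + 1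
    gives the n + 2 linear factors k = 0, ..., n + 1, whereas M = n + 1 gives the logarithm; hence
    the mismatch between [n.+2] and [n.+1]. *)
Let exponent n : R[i] := \sum_(k < n.+2) Cintegral leb D (exp_LK t (a k)) +
  (t / 2 * (\sum_(k < n.+2) ((1 - expR (- (s + k%:R))) / (s + k%:R)) - ln n.+1%:R))*i.

Let zkE k : z + k%:R%:C = 2^-1%:C * (a k -i* t).
Proof.
by apply: complexP; rewrite ?ReD ?ImD ?ReM ?ImM /= /s /a; field.
Qed.

Let skE k : s%:C + k%:R%:C = 2^-1%:C * (a k)%:C.
Proof.
by apply: complexP; rewrite ?ReD ?ImD ?ReM ?ImM /= /s /a; field.
Qed.

Let euler_beta_ratio n : euler_beta n.+1%:R n.+1 z =
  euler_beta n.+1%:R n.+1 s%:C * cexp (exponent n).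
Proof.
have n0 : (0 : R) < n.+1%:R by rewrite ltr0n.
have [_ e1] := @euler_beta_correct R n.+1%:R n0 n.+1 z s0.
have [_ e2] := @euler_beta_correct R n.+1%:R n0 n.+1 s%:C s0.
pose E k : R[i] := Cintegral leb D (exp_LK t (a k)) +
     (t * ((1 - expR (- a k * (1 / 2))) / a k))*i.
have prodE : \prod_(k < n.+2) (z + k%:R%:C) * cexp (\sum_(k < n.+2) E k) =
    \prod_(k < n.+2) (s%:C + k%:R%:C).
  rewrite cexp_sum -big_split; apply: eq_bigr => k _ /=.
  rewrite zkE skE cexp_exp_LK// -/(E k) cexpN.
  by rewrite -!mulrA mulVf ?cexp_neq0// mulr1.
have P0 : \prod_(k < n.+2) (z + k%:R%:C) != 0.
  apply/prodf_neq0 => k _; rewrite zkE; apply: mulf_neq0.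
    by rewrite eq_complex /= gt_eqF// invr_gt0.
  by rewrite eq_complex /= gt_eqF.
have cE : cpow n.+1%:R z = cpow n.+1%:R s%:C * cexp ((- (t / 2 * ln n.+1%:R))*i).
  rewrite /cpow -cexpD; congr cexp.
  by apply: complexP; rewrite ?ReD ?ImD ?ReM ?ImM /= /s; field.
have sE : exponent n = \sum_(k < n.+2) E k + (- (t / 2 * ln n.+1%:R))*i.
  rewrite /exponent /E big_split /= -addrA; congr (_ + _).
  apply: complexP.
    rewrite ReD addr0 (@Re_sum R n.+2 (fun i => (t * ((1 - expR (- a i * (1 / 2))) / a i))*i)) /=.
    by rewrite big1.
  rewrite ImD (@Im_sum R n.+2 (fun i => (t * ((1 - expR (- a i * (1 / 2))) / a i))*i)) /=.
  rewrite mulrBr mulr_sumr; congr (_ - _); apply: eq_bigr => k _.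
  have -> : - a k * (1 / 2) = - (s + k%:R) by rewrite /a /s; field.
  have -> : a k = 2 * (s + k%:R) by rewrite /a /s; field.
  by field; rewrite gt_eqF// ltr_wpDr.
apply: (mulIf P0); rewrite e1 cE sE cexpD mulrAC -!mulrA.
rewrite [cexp _ * (cexp _ * _)]mulrCA [cexp _ * \prod_(_ < _) _]mulrC prodE.
by rewrite [RHS]mulrCA e2 mulrA mulrC.
Qed.

Lemma Gamma_levy_khintchine :
  Gamma (sigma / 2 -i* (t / 2)) = Gamma (sigma / 2)%:C *
  cexp (Cintegral leb D gamma_LK + (t / 2 * malmsten_const)*i).
Proof.
have c1 : ccvg (fun n => euler_beta n.+1%:R n.+1 z) (Gamma z) by exact: ccvg_euler_beta.
have c2 : ccvg (fun n => euler_beta n.+1%:R n.+1 s%:C) (Gamma s%:C) by exact: ccvg_euler_beta.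
apply: (ccvg_unique c1).
rewrite (_ : (fun n => _) = (fun n => euler_beta n.+1%:R n.+1 s%:C * cexp (exponent n))); last first.
  by apply/funext => n; exact: euler_beta_ratio.
apply: ccvgM => //; apply: ccvg_cexp; apply: ccvgD.
  exact: (ccvg_shiftS (ccvg_shiftS ccvg_sum_exp_LK)).
split => /=; first exact: cvg_cst.
apply: cvgM; first exact: cvg_cst.
have h := malmsten_constant s0.
(* Makes up for the index mismatch in [exponent]: [malmsten_constant] pairs n + 2 terms with ln (n +
   2). *)
have ln0 : ln n.+2%:R - ln n.+1%:R @[n --> \oo] --> (0 : R).
  rewrite (_ : (fun n : nat => _) = (fun n : nat => ln (1 + 1 / n.+1%:R))); last first.
    apply/funext => n; rewrite -ln_div ?posrE ?ltr0n//; congr ln.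
    by rewrite -natr1; field; rewrite gt_eqF// ltr0n.
  rewrite -(@ln1 R) -[X in ln X]addr0.
  apply: continuous_cvg; first by apply: continuous_ln; rewrite addr0.
  by apply: cvgD; [exact: cvg_cst|exact: cvg_natV].
have e1 : \int[leb]_(x in `[0%R, 1%R]) (expR (- (sigma * x / 2)) / (1 - expR (- x)) - expR (- x) / x)
    = \int[leb]_(x in `[0%R, 1%R]) (expR (- s * x) / (1 - expR (- x)) - expR (- x) / x).
  apply: eq_Rintegral => x _.
  by have -> : - (sigma * x / 2) = - s * x by rewrite /s; field.
rewrite /malmsten_const e1 -[X in _ --> X]addr0.
rewrite (_ : (fun n : nat => _) = (fun n : nat =>
  (\sum_(k < n.+2) ((1 - expR (- (s + k%:R))) / (s + k%:R)) - ln n.+2%:R) +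
  (ln n.+2%:R - ln n.+1%:R))); last by apply/funext => n; ring.
apply: cvgD => //.
have := h; rewrite -(@cvg_shiftS _ (fun m : nat =>
  \sum_(k < m.+1) ((1 - expR (- (s + k%:R))) / (s + k%:R)) - ln m.+1%:R)).
by [].
Qed.

End gamma_levy_khintchine.

(** * The Euler product *)

Section dirichlet_series.
Context {R : realType}.
Variable s : R[i].
Hypothesis s1 : 1 < complex.Re s.

Let sigma := complex.Re s.
Let sigma0 : 0 < sigma. Proof. exact: lt_trans s1. Qed.

(** [zeta] is a [limn] for the norm of [R[i]]. A positive element of [R[i]] is real, so e/2 in each
    component suffices. *)
Lemma ccvg_cvg (u : nat -> R[i]^o) (l : R[i]^o) : ccvg u l -> u @ \oo --> l.
Proof.
move=> [h1 h2]; apply/cvgrPdist_lt => e e0.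
have [e' e'0 eE] : exists2 e', 0 < e' & e = e'%:C.
  move: e0; rewrite ltcE => /andP[/eqP ei er]; exists (complex.Re e) => //.
  by apply: complexP.
have e20 : 0 < e' / 2 by rewrite divr_gt0.
move/cvgrPdist_lt : h1 => /(_ _ e20) h1; move/cvgrPdist_lt : h2 => /(_ _ e20) h2.
near=> n.
rewrite eE normc_def ltcR.
have a1 : `|complex.Re (l - u n)| < e' / 2 by rewrite ReB; near: n.
have a2 : `|complex.Im (l - u n)| < e' / 2 by rewrite ImB; near: n.
set x := complex.Re (l - u n) in a1 *; set y := complex.Im (l - u n) in a2 *.
rewrite -(ger0_norm (ltW e'0)) -sqrtr_sqr ltr_sqrt ?exprn_gt0//.
rewrite -[x ^+ 2]real_normK ?num_real// -[y ^+ 2]real_normK ?num_real//.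
have := normr_ge0 x; have := normr_ge0 y; nra.
Unshelve. all: end_near. Qed.

Definition dirichlet_term (n : nat) : R[i] := cpow n%:R (- s).
Definition dirichlet_bound (n : nat) : R := expR (- sigma * ln n%:R).

Lemma dirichlet_term_bound n : `|complex.Re (dirichlet_term n)| <= dirichlet_bound n /\
  `|complex.Im (dirichlet_term n)| <= dirichlet_bound n.
Proof.
rewrite /dirichlet_term Re_cpow Im_cpow ReN !normrM (ger0_norm (expR_ge0 _)).
by split; rewrite ler_piMr ?expR_ge0 ?cos_max ?sin_max.
Qed.

Lemma dirichlet_bound_gt0 n : 0 < dirichlet_bound n.
Proof. exact: expR_gt0. Qed.

(** A discrete integral test for N^{-sigma} with N = n + 2. The concavity bound ln (1 - 1/N) <= -1/N
    gives ln N - ln (N - 1) >= 1/N, and e^y >= 1 + y converts it into a difference of powers of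
    exponent 1 - sigma. *)
Lemma dirichlet_bound_telescope n : (sigma - 1) * dirichlet_bound n.+2 <=
  expR (- (sigma - 1) * ln n.+1%:R) - expR (- (sigma - 1) * ln n.+2%:R).
Proof.
have b0 : 0 < sigma - 1 by rewrite subr_gt0.
have n1 : (0 : R) < n.+1%:R by rewrite ltr0n.
have n2 : (0 : R) < n.+2%:R by rewrite ltr0n.
pose d : R := ln n.+2%:R - ln n.+1%:R.
have d_ge : n.+2%:R^-1 <= d.
  have h : -1 < - (n.+2%:R^-1 : R).
    by rewrite ltrN2 invf_lt1// ltr1n.
  have := le_ln1Dx h.
  have -> : 1 + - n.+2%:R^-1 = n.+1%:R / n.+2%:R :> R.
    have -> : n.+1%:R = n.+2%:R - 1 :> R by rewrite -[n.+2%:R]natr1 addrK.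
    by field; rewrite gt_eqF.
  by rewrite ln_div ?posrE// => h'; rewrite /d -lerN2 opprB.
have -> : - (sigma - 1) * ln n.+1%:R = - (sigma - 1) * ln n.+2%:R + (sigma - 1) * d.
  by rewrite /d; ring.
have fac (A B : R) : A * B - A = A * (B - 1) by ring.
rewrite expRD fac.
have -> : dirichlet_bound n.+2 = expR (- (sigma - 1) * ln n.+2%:R) / n.+2%:R.
  rewrite /dirichlet_bound -[X in _ / X](@lnK R) ?posrE// -expRN -expRD.
  by congr expR; ring.
rewrite mulrCA ler_wpM2l ?expR_ge0//.
have := expR_ge1Dx ((sigma - 1) * d).
have h1 : (sigma - 1) * n.+2%:R^-1 <= (sigma - 1) * d by rewrite ler_pM2l.
by move=> h2; rewrite lerBrDl (le_trans _ h2)// lerD2l.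
Qed.

Definition dirichlet_bound_sum (N : nat) : R := \sum_(k < N) dirichlet_bound k.+1.

Lemma is_cvg_dirichlet_bound_sum : cvgn dirichlet_bound_sum.
Proof.
have b0 : 0 < sigma - 1 by rewrite subr_gt0.
apply: nondecreasing_is_cvgn.
  apply/nondecreasing_seqP => n; rewrite /dirichlet_bound_sum big_ord_recr lerDl.
  exact/ltW/dirichlet_bound_gt0.
exists (1 + (sigma - 1)^-1) => _ [n _ <-].
case: n => [|n]; first by rewrite /dirichlet_bound_sum big_ord0 addr_ge0// invr_ge0 ltW.
(* The plain bound 1 + 1/(sigma - 1) is not inductive; keeping the telescoping remainder makes it
   so. *)
suff : dirichlet_bound_sum n.+1 <=
    1 + (sigma - 1)^-1 * (1 - expR (- (sigma - 1) * ln n.+1%:R)).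
  move=> h; apply: (le_trans h); rewrite lerD2l ler_piMr ?invr_ge0 ?(ltW b0)//.
rewrite /dirichlet_bound_sum; elim: n => [|n IH].
  by rewrite big_ord_recr big_ord0 /= add0r /dirichlet_bound ln1 !mulr0 expR0 subrr mulr0 addr0.
rewrite big_ord_recr /=; have := dirichlet_bound_telescope n.
rewrite -(@ler_pM2l _ (sigma - 1)^-1) ?invr_gt0// mulKf ?gt_eqF//.
move: IH; rewrite !mulrBr; lra.
Qed.

Definition filtered_sum (P : pred nat) (N : nat) : R[i] :=
  \sum_(k < N | P k.+1) dirichlet_term k.+1.

Lemma filtered_sumS P N : filtered_sum P N.+1 = filtered_sum P N +
  (if P N.+1 then dirichlet_term N.+1 else 0).
Proof. by rewrite /filtered_sum big_mkcond big_ord_recr /= -big_mkcond. Qed.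

Lemma is_ccvg_filtered_sum P : exists l, ccvg (filtered_sum P) l.
Proof.
have mono (f : nat -> R) : (forall n, `|f n| <= dirichlet_bound n) ->
    cvgn (fun N => \sum_(k < N) (if P k.+1 then f k.+1 else 0)).
  move=> hf; pose v k := if P k.+1 then f k.+1 else 0.
  have hv k : `|v k| <= dirichlet_bound k.+1.
    rewrite /v; case: ifP => _; first exact: hf.
    by rewrite normr0 ltW// dirichlet_bound_gt0.
  have -> : (fun N => \sum_(k < N) (if P k.+1 then f k.+1 else 0)) = series v.
    by apply/funext => N; rewrite /series /= big_mkord.
  apply: normed_cvg; apply: (@series_le_cvg _ _ (fun k => dirichlet_bound k.+1)).
  - by move=> n; exact: normr_ge0.
  - by move=> n; exact/ltW/dirichlet_bound_gt0.
  - exact: hv.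
  - rewrite (_ : series _ = dirichlet_bound_sum); first exact: is_cvg_dirichlet_bound_sum.
    by apply/funext => N; rewrite /series /= big_mkord.
have /cvg_ex[a ha] := mono (fun n => complex.Re (dirichlet_term n)) (fun n => (dirichlet_term_bound n).1).
have /cvg_ex[b hb] := mono (fun n => complex.Im (dirichlet_term n)) (fun n => (dirichlet_term_bound n).2).
exists (a +i* b); split => /=.
- rewrite (_ : (fun n => _) = (fun N => \sum_(k < N) (if P k.+1 then complex.Re (dirichlet_term k.+1) else 0)))//.
  apply/funext => N; rewrite /filtered_sum big_mkcond.
  rewrite (@Re_sum R N (fun k => if P k.+1 then dirichlet_term k.+1 else 0)).
  by apply: eq_bigr => k _; case: ifP.
- rewrite (_ : (fun n => _) = (fun N => \sum_(k < N) (if P k.+1 then complex.Im (dirichlet_term k.+1) else 0)))//.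
  apply/funext => N; rewrite /filtered_sum big_mkcond.
  rewrite (@Im_sum R N (fun k => if P k.+1 then dirichlet_term k.+1 else 0)).
  by apply: eq_bigr => k _; case: ifP.
Qed.

Lemma ccvg_zeta : ccvg (filtered_sum xpredT) (zeta s).
Proof.
have [l hl] := is_ccvg_filtered_sum xpredT.
suff -> : zeta s = l by [].
have h := ccvg_cvg hl.
rewrite /zeta.
apply: (@cvg_lim _ (@norm_hausdorff _ R[i]^o)).
apply: cvg_trans h; apply: near_eq_cvg; apply: nearW => n.
by rewrite /series /= big_mkord.
Qed.

Lemma dirichlet_termM k m : (0 < k)%N -> (0 < m)%N ->
  dirichlet_term (k * m) = dirichlet_term k * dirichlet_term m.
Proof.
move=> k0 m0; rewrite /dirichlet_term /cpow -cexpD natrM lnM ?posrE ?ltr0n//.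
by rewrite rmorphD /= mulrDl.
Qed.

(** Each block of [k] consecutive integers has exactly one multiple of [k], its last element.
    Raising [N] by 1 on the right therefore adds the same term as adding a whole block on the
    left. *)
Lemma filtered_sum_multiples (P : pred nat) k N : (0 < k)%N ->
  (forall m, P (k * m)%N = P m) ->
  filtered_sum (fun n => P n && (k %| n)%N) (k * N) = dirichlet_term k * filtered_sum P N.
Proof.
move=> k0 Pk; elim: N => [|N IH].
  by rewrite muln0 /filtered_sum !big_ord0 mulr0.
rewrite filtered_sumS mulrDr -IH mulnS addnC.
have block j : (j < k)%N ->
    filtered_sum (fun n => P n && (k %| n)%N) (k * N + j) = filtered_sum (fun n => P n && (k %| n)%N) (k * N).
  elim: j => [|j IHj] jk; first by rewrite addn0.
  rewrite addnS filtered_sumS IHj ?(ltnW jk)// -addnS /dvdn [(k * N)%N]mulnC modnMDl modn_small//.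
  by rewrite andbF addr0.
have kE : (k * N + k = (k * N + k.-1).+1)%N by rewrite -addnS prednK.
rewrite kE filtered_sumS block ?ltn_predL// -kE.
have -> : (k * N + k = k * N.+1)%N by rewrite mulnS addnC.
rewrite dvdn_mulr// andbT Pk; congr (_ + _).
by case: ifP => _; rewrite ?mulr0// dirichlet_termM.
Qed.

(* Sieving: multiplying by [1 - k^-s] removes the multiples of the prime [k], so
   that the partial Euler product sums over the integers with no prime factor below [k]. *)
Definition rough (k : nat) : pred nat :=
  fun n => all (fun p => prime p ==> ~~ (p %| n)%N) (iota 0 k).

Lemma roughS k n : rough k.+1 n = rough k n && (prime k ==> ~~ (k %| n)%N).
Proof. by rewrite /rough -addn1 iotaD all_cat /= andbT add0n. Qed.

Lemma roughM k m : prime k -> rough k (k * m) = rough k m.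
Proof.
move=> pk; apply: eq_in_all => p; rewrite mem_iota add0n => /andP[_ pk'].
have [pp|//] := boolP (prime p).
by rewrite /= Euclid_dvdM// dvdn_prime2// ltn_eqF.
Qed.

Lemma filtered_sumB (P Q : pred nat) N :
  filtered_sum (fun n => P n && Q n) N + filtered_sum (fun n => P n && ~~ Q n) N =
  filtered_sum P N.
Proof.
elim: N => [|N IH]; first by rewrite /filtered_sum !big_ord0 addr0.
rewrite !filtered_sumS addrACA IH; congr (_ + _).
by case: (P N.+1); case: (Q N.+1); rewrite /= ?addr0 ?add0r.
Qed.

Lemma ccvg_rough k : ccvg (filtered_sum (rough k))
  (zeta s * \prod_(p < k | prime p) (1 - dirichlet_term p)).
Proof.
elim: k => [|k IH].
  rewrite big_ord0 mulr1.
  by rewrite (_ : filtered_sum _ = filtered_sum xpredT)//; exact: ccvg_zeta.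
rewrite big_mkcond big_ord_recr /= -big_mkcond /= mulrA.
have [pk|npk] := boolP (prime k); last first.
  rewrite mulr1; rewrite (_ : filtered_sum _ = filtered_sum (rough k))//.
  apply/funext => N; apply: eq_bigl => n.
  by rewrite roughS (negbTE npk) andbT.
set Z := zeta s * _ in IH *.
have k0 : (0 < k)%N by exact: prime_gt0.
have [l hl] := is_ccvg_filtered_sum (rough k.+1).
suff -> : Z * (1 - dirichlet_term k) = l by [].
(* The sieve identity is exact at the cutoffs k N, without remainder. As the limit [l] is known to
   exist, this subsequence is enough to identify it. *)
have eS N : filtered_sum (rough k.+1) (k * N) + dirichlet_term k * filtered_sum (rough k) N =
    filtered_sum (rough k) (k * N).
  rewrite -filtered_sum_multiples//; last by move=> m; exact: roughM.
  rewrite -[RHS](filtered_sumB _ (fun n => (k %| n)%N)) addrC; congr (_ + _).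
  by apply: eq_bigl => n; rewrite roughS pk.
have sub (u : nat -> R[i]) x : ccvg u x -> ccvg (fun N => u (k * N)%N) x.
  have kN : (k * N)%N @[N --> \oo] --> \oo.
    apply/cvgnyPge => A; near=> N.
    apply: (@leq_trans N); last by rewrite leq_pmull.
    by near: N; exact: nbhs_infty_ge.
  move=> [c1 c2]; split.
  - exact: (@cvg_comp _ _ _ (fun N => k * N)%N (fun n => complex.Re (u n)) _ \oo _ kN c1).
  - exact: (@cvg_comp _ _ _ (fun N => k * N)%N (fun n => complex.Im (u n)) _ \oo _ kN c2).
have c1 := ccvgD (sub _ _ hl) (ccvgM (ccvg_cst (dirichlet_term k)) IH).
have c2 := sub _ _ IH.
have : l + dirichlet_term k * Z = Z.
  by apply: ccvg_unique c2; rewrite (_ : (fun N => _) = (fun N =>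
    filtered_sum (rough k.+1) (k * N) + dirichlet_term k * filtered_sum (rough k) N))//;
    apply/funext => N; rewrite eS.
by move=> e; rewrite mulrBr mulr1 -{1}e; ring.
Unshelve. all: end_near. Qed.

Lemma dirichlet_term1 : dirichlet_term 1 = 1.
Proof. by rewrite /dirichlet_term /cpow ln1 rmorph0 mul0r cexp0. Qed.

Lemma rough1 k : rough k 1.
Proof.
apply/allP => p _; apply/implyP => pp; rewrite dvdn1.
by apply: contraTneq pp => ->.
Qed.

Lemma rough_lt k n : (1 < n)%N -> (n < k)%N -> rough k n = false.
Proof.
move=> n1 nk; apply/negbTE/allPn; exists (pdiv n).
  by rewrite mem_iota add0n /= (leq_ltn_trans _ nk)// pdiv_leq// ltnW.
by rewrite pdiv_prime//= negbK pdiv_dvd.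
Qed.

(** An integer n > 1 free of prime factors up to [k] exceeds [k]. So the sum up to k is exactly its
    first term 1, and everything later is bounded by the tail of the absolute series. *)
Lemma filtered_sum_rough_tail k N : (0 < k)%N -> (k <= N)%N ->
  `|complex.Re (filtered_sum (rough k.+1) N - 1)| <=
    dirichlet_bound_sum N - dirichlet_bound_sum k /\
  `|complex.Im (filtered_sum (rough k.+1) N - 1)| <=
    dirichlet_bound_sum N - dirichlet_bound_sum k.
Proof.
move=> k0; elim: N => [|N IH]; first by rewrite leqNgt k0.
rewrite leq_eqVlt => /predU1P[<-|kN]; last first.
  have [h1 h2] := IH kN.
  have [b1 b2] := dirichlet_term_bound N.+1.
  rewrite filtered_sumS /dirichlet_bound_sum big_ord_recr /= -/(dirichlet_bound_sum N).
  have eC (a b c : R[i]) : a + b - c = (a - c) + b by ring.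
  have eR (a b c : R) : a + b - c = (a - c) + b by ring.
  rewrite eC ReD ImD eR -/(dirichlet_bound_sum k).
  have z0 := dirichlet_bound_gt0 N.+1.
  split; rewrite (le_trans (ler_normD _ _))// lerD//; case: ifP => _ //=; by rewrite normr0 ltW.
rewrite subrr.
suff -> : filtered_sum (rough k.+1) k = 1 by rewrite subrr normr0.
case: k k0 {IH} => // k _.
have H j : (j <= k)%N -> filtered_sum (rough k.+2) j.+1 = 1.
  elim: j => [|j IHj] jk.
    by rewrite filtered_sumS /filtered_sum big_ord0 add0r rough1 dirichlet_term1.
  by rewrite filtered_sumS IHj ?(ltnW jk)// rough_lt// ?addr0// !ltnS.
exact: H.
Qed.

(** Letting N tend to infinity in the tail estimate leaves an error A - S_k, which tends to 0.
    Stated as a product tending to 1, the formula needs no division and yields the nonvanishing of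
    [zeta] at once. *)
Lemma ccvg_euler_product :
  ccvg (fun k => zeta s * \prod_(p < k | prime p) (1 - dirichlet_term p)) 1.
Proof.
have /cvg_ex[A hA] := is_cvg_dirichlet_bound_sum.
have key k : (0 < k)%N ->
    `|complex.Re (zeta s * \prod_(p < k.+1 | prime p) (1 - dirichlet_term p)) - 1| <=
       A - dirichlet_bound_sum k /\
    `|complex.Im (zeta s * \prod_(p < k.+1 | prime p) (1 - dirichlet_term p)) - 0| <=
       A - dirichlet_bound_sum k.
  move=> k0; have [c1 c2] := ccvg_rough k.+1.
  have cA : dirichlet_bound_sum N - dirichlet_bound_sum k @[N --> \oo] --> A - dirichlet_bound_sum k.
    by apply: cvgB => //; exact: cvg_cst.
  split.
  - have c1' : `|complex.Re (filtered_sum (rough k.+1) N) - 1| @[N --> \oo] -->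
       `|complex.Re (zeta s * \prod_(p < k.+1 | prime p) (1 - dirichlet_term p)) - 1|.
      by apply: cvg_norm; apply: cvgB => //; exact: cvg_cst.
    apply: (ler_cvg_to c1' cA); near=> N.
    have [] := @filtered_sum_rough_tail k N k0 _; last by rewrite ReB.
    by near: N; exact: nbhs_infty_ge.
  - have c2' : `|complex.Im (filtered_sum (rough k.+1) N) - 0| @[N --> \oo] -->
       `|complex.Im (zeta s * \prod_(p < k.+1 | prime p) (1 - dirichlet_term p)) - 0|.
      by apply: cvg_norm; apply: cvgB => //; exact: cvg_cst.
    apply: (ler_cvg_to c2' cA); near=> N.
    have [] := @filtered_sum_rough_tail k N k0 _; last by rewrite ImB.
    by near: N; exact: nbhs_infty_ge.
have cA0 : A - dirichlet_bound_sum k @[k --> \oo] --> (0 : R).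
  by rewrite -[X in _ --> X](subrr A); apply: cvgB => //; exact: cvg_cst.
have sq (f : nat -> R) l : (forall k, (0 < k)%N -> `|f k.+1 - l| <= A - dirichlet_bound_sum k) ->
    f k @[k --> \oo] --> l.
  move=> hf; rewrite -(@cvg_shiftS _ f); apply/subr_cvg0; apply: norm_cvg0.
  apply: (squeeze_cvgr (f := cst 0) (h := fun k => A - dirichlet_bound_sum k)) => //.
  - near=> k; rewrite /= normr_ge0 hf//.
    by near: k; exact: nbhs_infty_gt.
  - exact: cvg_cst.
split.
- by apply: sq => k k0; have [] := key k k0.
- by apply: sq => k k0; have [] := key k k0.
Unshelve. all: end_near. Qed.

Lemma zeta_neq0 : zeta s != 0.
Proof.
apply/eqP => z0; have := ccvg_euler_product; rewrite z0.
under eq_fun do rewrite mul0r.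
move=> /(ccvg_unique (ccvg_cst 0))/esym/eqP; by rewrite oner_eq0.
Qed.

End dirichlet_series.

(** * Levy-Khintchine form of zeta *)

Section prime_atoms.
Context {R : realType}.
Local Notation T := (measurableTypeR R).
Variable sigma : R.
Hypothesis sigma1 : 1 < sigma.

Let sigma0 : 0 < sigma. Proof. exact: lt_trans sigma1. Qed.

Lemma nneseries_lty (a : nat -> \bar R) (c : R) : (forall n, (0 <= a n)%E) ->
  (forall n, (\sum_(k < n) a k <= c%:E)%E) -> (\sum_(k <oo) a k < +oo)%E.
Proof.
move=> a0 ac; apply: (@le_lt_trans _ _ c%:E); last exact: ltry.
apply: lime_le; first by apply: is_cvg_nneseries => n _ _.
by apply: nearW => n; rewrite big_mkord.
Qed.

Definition prime_weight (p r : nat) : R := p%:R `^ (- (r%:R * sigma)) / r%:R.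

Lemma integral_prime_power_atom p r (f : T -> \bar R) : measurable_fun setT f ->
  (forall x, 0 <= f x)%E ->
  (\int[prime_power_atom sigma p r]_x f x = (prime_weight p r)%:E * f (r%:R * ln p%:R)%R)%E.
Proof.
move=> mf f0; rewrite /prime_power_atom ge0_integral_mscale//=.
by rewrite integral_dirac// diracT mul1e.
Qed.

Lemma integrable_prime_power_atom p r (f : T -> R) : measurable_fun setT f ->
  (prime_power_atom sigma p r).-integrable setT (EFin \o f).
Proof.
move=> mf; apply/integrableP; split; first exact/measurable_EFinP.
rewrite integral_prime_power_atom//; last first.
  by apply: measurableT_comp => //; exact/measurable_EFinP.
by rewrite /= -EFinM ltry.
Qed.

Lemma Rintegral_prime_power_atom p r (f : T -> R) : measurable_fun setT f ->
  \int[prime_power_atom sigma p r]_x f x = prime_weight p r * f (r%:R * ln p%:R).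
Proof.
move=> mf.
have pos (g : T -> R) : measurable_fun setT g -> (forall x, 0 <= g x) ->
    \int[prime_power_atom sigma p r]_x g x = prime_weight p r * g (r%:R * ln p%:R).
  move=> mg g0; rewrite /Rintegral integral_prime_power_atom//.
  exact/measurable_EFinP.
have mn : measurable_fun setT (fun x => `|f x|) by exact: measurableT_comp.
have mg : measurable_fun setT (fun x => f x + `|f x|) by exact: measurable_funD.
have -> : \int[prime_power_atom sigma p r]_x f x =
   \int[prime_power_atom sigma p r]_x (f x + `|f x|) - \int[prime_power_atom sigma p r]_x `|f x|.
  rewrite -RintegralB//; try exact: integrable_prime_power_atom.
  by apply: eq_Rintegral => x _; rewrite addrK.
rewrite !pos//; first by ring.
by move=> x; have := ler_norm (- f x); rewrite normrN; lra.
Qed.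

(** Starts at r = 0, as the lemmas on [mseries] expect. The extra atom has weight 0, because
    division by 0 gives 0. *)
Definition all_prime_powers p : {measure set T -> \bar R} :=
  mseries (prime_power_atom sigma p) 0.

Lemma prime_weight0 p : prime_weight p 0 = 0.
Proof. by rewrite /prime_weight invr0 mulr0. Qed.

Lemma prime_atomsE p (A : set T) : prime p -> prime_atoms sigma p A = all_prime_powers p A.
Proof.
move=> pp; rewrite /prime_atoms pp /all_prime_powers /= /mseries.
rewrite [RHS]nneseries_recl//.
rewrite [X in (X + _)%E](_ : _ = 0%E) ?add0e//.
by rewrite /prime_power_atom /= /mscale /= invr0 mulr0 mul0e.
Qed.

Section one_prime.
Variable p : nat.
Hypothesis pp : prime p.

Let l : R := ln p%:R.
Let q : R := expR (- sigma * l).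
Let p1 : (1 : R) < p%:R. Proof. by rewrite ltr1n prime_gt1. Qed.
Let p0 : (0 : R) < p%:R. Proof. exact: lt_trans p1. Qed.
Let l0 : 0 < l. Proof. exact: ln_gt0. Qed.

Lemma prime_weightE r : prime_weight p r = q ^+ r / r%:R.
Proof.
rewrite /prime_weight /powR gt_eqF// /q -expRM_natl; congr (expR _ / _).
by rewrite /l; ring.
Qed.

Lemma le_prime_q : q <= 2^-1.
Proof.
have p2 : (2 : R) <= p%:R by rewrite ler_nat prime_gt1.
apply: (@le_trans _ _ p%:R^-1); last by rewrite lef_pV2 ?posrE.
rewrite /q -[in leRHS](lnK (x := p%:R)) ?posrE// -expRN ler_expR mulNr lerN2.
by rewrite ler_peMl ?ltW.
Qed.

Let q0 : 0 < q. Proof. exact: expR_gt0. Qed.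

Lemma geometric_bound n : \sum_(k < n) q ^+ k.+1 <= 2 * q.
Proof.
have h := le_prime_q; suff : \sum_(k < n) q ^+ k.+1 <= 2 * q * (1 - q ^+ n).
  move/le_trans; apply; rewrite ler_piMr ?mulr_ge0 ?(ltW q0)//.
  by rewrite gerBl exprn_ge0// ltW.
elim: n => [|n IH]; first by rewrite big_ord0 expr0 subrr mulr0.
rewrite big_ord_recr /=; apply: (le_trans (lerD IH (lexx _))).
have qn : 0 <= q ^+ n by rewrite exprn_ge0// ltW.
rewrite !exprS -subr_ge0; set Q := q ^+ n.
rewrite (_ : _ - _ = Q * q * (1 - 2 * q)); last by ring.
by rewrite !mulr_ge0 ?(ltW q0)//; lra.
Qed.

Lemma prime_weight_bound r : prime_weight p r.+1 <= q ^+ r.+1.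
Proof.
rewrite prime_weightE ler_piMr ?exprn_ge0 ?(ltW q0)//.
by rewrite invf_le1 ?ltr0n// ler1n.
Qed.

Lemma integral_all_prime_powers (f : T -> \bar R) : measurable_fun setT f ->
  (forall x, 0 <= f x)%E ->
  (\int[all_prime_powers p]_x f x =
   \sum_(r <oo) (prime_weight p r)%:E * f (r%:R * l)%R)%E.
Proof.
move=> mf f0; rewrite ge0_integral_measure_series//.
by apply: eq_eseriesr => r _; rewrite integral_prime_power_atom.
Qed.

Lemma prime_atoms_mass : (prime_atoms sigma p setT <= (2 * q)%:E)%E.
Proof.
rewrite prime_atomsE// -(mul1e (all_prime_powers p setT)) -integral_cst//.
rewrite integral_all_prime_powers//.
apply: lime_le.
  apply: is_cvg_nneseries => n _ _; rewrite mule1 lee_fin.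
  by rewrite /prime_weight divr_ge0// powR_ge0.
apply: nearW => -[|n]; rewrite big_mkord.
  by rewrite big_ord0 lee_fin mulr_ge0// ltW.
rewrite big_ord_recl prime_weight0 mul0e add0e.
apply: (@le_trans _ _ (\sum_(k < n) (q ^+ k.+1)%:E)%E).
  apply: lee_sum => k _; rewrite mule1 lee_fin; exact: prime_weight_bound.
by rewrite sumEFin lee_fin geometric_bound.
Qed.

(** At the atom r log p the factor x cancels the 1/r of the weight, leaving log p times a geometric
    series. The shape x * 1 is that of the characteristic exponent lemmas with weight function 1. *)
Lemma integrable_id_all_prime_powers :
  (all_prime_powers p).-integrable setT (EFin \o (fun x : R => x * 1)).
Proof.
have mi : measurable_fun (setT : set T) (fun x : R => x * 1) by exact: measurable_funM.
apply/integrableP; split; first exact/measurable_EFinP.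
rewrite integral_all_prime_powers//; last first.
  by apply: measurableT_comp => //; exact/measurable_EFinP.
apply: (@nneseries_lty _ (2 * q * l)).
  by move=> n; rewrite mule_ge0// lee_fin /prime_weight divr_ge0// powR_ge0.
case=> [|n]; first by rewrite big_ord0 lee_fin !mulr_ge0// ltW.
rewrite big_ord_recl prime_weight0 mul0e add0e.
apply: (@le_trans _ _ (\sum_(k < n) (q ^+ k.+1 * l)%:E)%E).
  apply: lee_sum => k _; rewrite /= -EFinM lee_fin mulr1 ger0_norm; last first.
    by rewrite mulr_ge0// ltW.
  rewrite prime_weightE /bump /= add1n mulrA divfK// pnatr_eq0//.
by rewrite sumEFin lee_fin -mulr_suml ler_wpM2r ?(ltW l0)// geometric_bound.
Qed.

Section characteristic_exponent_of_one_prime.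
Variable t : R.

Let z : R[i] := cexp ((- sigma * l) +i* (t * l)).

Let z_exp n : z ^+ n = (q ^+ n * cos (t * (n%:R * l))) +i* (q ^+ n * sin (t * (n%:R * l))).
Proof.
have -> : z ^+ n = cexp ((n%:R * (- sigma * l)) +i* (t * (n%:R * l))).
  elim: n => [|n IH].
    by rewrite expr0 !mul0r mulr0 -[0 +i* 0]/(0 : R[i]) cexp0.
  rewrite exprS IH /z -cexpD; congr cexp.
  by apply: complexP; rewrite ?ReD ?ImD /= -natr1; ring.
by apply: complexP; rewrite ?Re_cexp ?Im_cexp /= expRM_natl.
Qed.

Let z1 : 1 - z != 0.
Proof.
rewrite subr_eq0; apply/eqP => z1; have := congr1 (@complex.Re R) z1.
rewrite /z Re_cexp /= -/q => e.
have := cos_le1 (t * l); have := le_prime_q; have := q0; nra.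
Qed.

Let X : R[i] := z / (1 - z).

Let XE : X * (1 - z) = z. Proof. by rewrite /X divfK. Qed.

Let sum_z n : \sum_(k < n) z ^+ k.+1 = X * (1 - z ^+ n).
Proof.
rewrite /X; elim: n => [|n IH]; first by rewrite big_ord0 expr0 subrr mulr0.
by rewrite big_ord_recr /= IH exprS; field.
Qed.

Let ccvg_sum_z : ccvg (fun n => \sum_(k < n) z ^+ k.+1) X.
Proof.
have qn : q ^+ n @[n --> \oo] --> (0 : R).
  apply: cvg_expr; rewrite gtr0_norm// (le_lt_trans le_prime_q)//.
  by rewrite invf_lt1// ltr1n.
have nqn : - q ^+ n @[n --> \oo] --> (0 : R) by rewrite -[X in _ --> X]oppr0; exact: cvgN.
have qn0 n : 0 <= q ^+ n by rewrite exprn_ge0// ltW.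
have zn : ccvg (fun n => z ^+ n) 0.
  split => /=.
  - apply: (squeeze_cvgr (f := fun n => - q ^+ n) (h := fun n => q ^+ n)) => //.
    apply: nearW => n; rewrite -ler_norml z_exp /= normrM (ger0_norm (qn0 n)).
    by rewrite ler_piMr// cos_max.
  - apply: (squeeze_cvgr (f := fun n => - q ^+ n) (h := fun n => q ^+ n)) => //.
    apply: nearW => n; rewrite -ler_norml z_exp /= normrM (ger0_norm (qn0 n)).
    by rewrite ler_piMr// sin_max.
rewrite (_ : (fun n => _) = (fun n => X * (1 + (-1) * z ^+ n))); last first.
  by apply/funext => n; rewrite sum_z mulN1r.
rewrite -[X in ccvg _ X]mulr1; apply: ccvgM; first exact: ccvg_cst.
rewrite -[X in ccvg _ X]addr0; apply: ccvgD; first exact: ccvg_cst.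
by rewrite -[X in ccvg _ X](mulr0 (-1)); apply: ccvgM => //; exact: ccvg_cst.
Qed.

Let sum_weight (f : R -> R) n :
  \sum_(r < n.+1) prime_weight p r * (f (r%:R * l) * (r%:R * l * 1)) =
  l * \sum_(r < n) q ^+ r.+1 * f (r.+1%:R * l).
Proof.
rewrite big_ord_recl prime_weight0 mul0r add0r mulr_sumr; apply: eq_bigr => r _.
rewrite lift0 prime_weightE; field.
by rewrite addrC natr1 pnatr_eq0.
Qed.

Let int_sum (f : R -> R) : measurable_fun (setT : set T) f -> (forall x, `|f x| <= 1) ->
  l * \sum_(r < n) q ^+ r.+1 * f (r.+1%:R * l) @[n --> \oo] -->
  \int[all_prime_powers p]_x (f x * (x * 1)).
Proof.
move=> mf f1.
have mfx : measurable_fun (setT : set T) (fun x : R => f x * (x * 1)).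
  by apply: measurable_funM => //; exact: measurable_funM.
have ifx : (all_prime_powers p).-integrable setT (EFin \o (fun x : R => f x * (x * 1))).
  apply: (le_real_integrable measurableT mfx (integrable_norm integrable_id_all_prime_powers)).
  by move=> x _ /=; rewrite normrM ler_piMl.
have := Rintegral_mseries measurableT ifx.
rewrite -(@cvg_shiftS _ (fun n => \sum_(k < n) _)).
apply: cvg_trans; apply: near_eq_cvg; apply: nearW => n.
rewrite -sum_weight; apply: eq_bigr => r _.
by rewrite Rintegral_prime_power_atom.
Qed.

Let cos_int : \int[all_prime_powers p]_x (cos (t * x) * (x * 1)) = l * complex.Re X.
Proof.
have h := int_sum (measurable_cosM t) (fun x => cos_max _).
apply: (cvg_unique _ h) => //.
apply: cvgM; first exact: cvg_cst.
have [+ _] := ccvg_sum_z; apply: cvg_trans; apply: near_eq_cvg; apply: nearW => n.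
rewrite (@Re_sum R n (fun k => z ^+ k.+1)).
by apply: eq_bigr => r _; rewrite z_exp.
Qed.

Let sin_int : \int[all_prime_powers p]_x (sin (t * x) * (x * 1)) = l * complex.Im X.
Proof.
have h := int_sum (measurable_sinM t) (fun x => sin_max _).
apply: (cvg_unique _ h) => //.
apply: cvgM; first exact: cvg_cst.
have [_ +] := ccvg_sum_z; apply: cvg_trans; apply: near_eq_cvg; apply: nearW => n.
rewrite (@Im_sum R n (fun k => z ^+ k.+1)).
by apply: eq_bigr => r _; rewrite z_exp.
Qed.

(** With z = p^{-(sigma - it)}, X is the geometric sum z/(1 - z). It is exported through X (1 - z) =
    z, the only relation that the differential equation uses. *)
Lemma prime_powers_integrals : exists2 X : R[i],
  X * ((1 - q * cos (t * l)) +i* (- (q * sin (t * l)))) = (q * cos (t * l)) +i* (q * sin (t * l)) &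
  \int[all_prime_powers p]_x (cos (t * x) * (x * 1)) = l * complex.Re X /\
  \int[all_prime_powers p]_x (sin (t * x) * (x * 1)) = l * complex.Im X.
Proof.
exists X; last by rewrite cos_int sin_int.
have zE : z = (q * cos (t * l)) +i* (q * sin (t * l)) by [].
rewrite -zE -XE; congr (_ * _).
by apply: complexP; rewrite ?ReB ?ImB zE /=; ring.
Qed.

End characteristic_exponent_of_one_prime.

(** The exponent has derivative i l X and 1 - z has derivative -i l z, so X (1 - z) = z makes the
    product constant; at t = 0 it equals 1 - q. *)
Lemma cexp_prime_powers t :
  ((1 - q * cos (t * l)) +i* (- (q * sin (t * l)))) *
  cexp ((\int[all_prime_powers p]_x ((cos (t * x) - 1) * 1)) +i*
        (\int[all_prime_powers p]_x (sin (t * x) * 1))) = (1 - q)%:C.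
Proof.
have m1 : measurable_fun (setT : set T) (fun=> 1 : R) by exact: measurable_cst.
have dC := is_derive_int_cos measurableT m1 integrable_id_all_prime_powers.
have dS := is_derive_int_sin measurableT m1 integrable_id_all_prime_powers.
have du (s : R) : is_derive s (1 : R) (fun t => 1 - q * cos (l * t)) (q * l * sin (l * s)).
  apply: is_derive_eq (is_deriveBr (is_derive_cstr 1 s)
    (is_derive_cstM q (is_derive_cosr (is_derive_Ml l s)))) _.
  by ring.
have dv (s : R) : is_derive s (1 : R) (fun t => - q * sin (l * t)) (- q * l * cos (l * s)).
  apply: is_derive_eq (is_derive_cstM (- q) (is_derive_sinr (is_derive_Ml l s))) _.
  by ring.
have sinN (s : R) : \int[all_prime_powers p]_x (- sin (s * x) * (x * 1)) =
    - \int[all_prime_powers p]_x (sin (s * x) * (x * 1)).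
  under eq_Rintegral do rewrite mulNr -mulN1r.
  rewrite RintegralZl ?mulN1r//.
  have mfx : measurable_fun (setT : set T) (fun x : R => sin (s * x) * (x * 1)).
    by apply: measurable_funM; [exact: measurable_sinM|exact: measurable_funM].
  apply: (le_real_integrable measurableT mfx (integrable_norm integrable_id_all_prime_powers)).
  by move=> x _ /=; rewrite normrM ler_piMl// sin_max.
have h := mul_cexp_cst du dv dC dS.
rewrite ![t * l]mulrC -[- (q * sin _)]mulNr (h _ _ t).
- rewrite mulr0 cos0 sin0 mulr1 mulr0.
  have -> : \int[all_prime_powers p]_x ((cos (0 * x) - 1) * 1) = 0.
    under eq_Rintegral do rewrite mul0r cos0 subrr mul0r.
    by rewrite Rintegral_cst// mul0r.
  have -> : \int[all_prime_powers p]_x (sin (0 * x) * 1) = 0.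
    under eq_Rintegral do rewrite mul0r sin0 mul0r.
    by rewrite Rintegral_cst// mul0r.
  by rewrite -[0 +i* 0]/(0 : R[i]) cexp0 mulr1.
- move=> s; have [X eX [eR eI]] := prime_powers_integrals s; rewrite sinN eR eI.
  have := congr1 (@complex.Im R) eX; rewrite ImM /= [s * l]mulrC => e.
  rewrite (_ : _ - _ = l * (q * sin (l * s) - (complex.Re X * (- (q * sin (l * s))) + complex.Im X * (1 - q * cos (l * s))))); last by ring.
  by rewrite e subrr mulr0.
- move=> s; have [X eX [eR eI]] := prime_powers_integrals s; rewrite sinN eR eI.
  have := congr1 (@complex.Re R) eX; rewrite ReM /= [s * l]mulrC => e.
  rewrite (_ : _ + _ = l * (complex.Re X * (1 - q * cos (l * s)) - complex.Im X * (- (q * sin (l * s))) - q * cos (l * s))); last by ring.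
  by rewrite e subrr mulr0.
Qed.

End one_prime.

End prime_atoms.

Lemma Rintegral_support d (T : measurableType d) (R : realType)
    (m : {measure set T -> \bar R}) (D : set T) (f : T -> R) :
  measurable D -> m (~` D) = 0%E -> m.-integrable setT (EFin \o f) ->
  \int[m]_x f x = \int[m]_(x in D) f x.
Proof.
move=> mD m0 fi; rewrite /Rintegral.
by rewrite (negligible_integral (measurableC mD) measurableT fi m0) setTD setCK.
Qed.

(** The smallest atom is at log 2, so the truncation at 1/2 never meets an atom and the primes
    contribute nothing to the drift. *)
Lemma half_lt_ln2 (R : realType) : 1 / 2 < ln 2 :> R.
Proof.
rewrite -ltr_expR lnK ?posrE// -[1 / 2]opprK expRN -[X in _ < X]invrK ltf_pV2 ?posrE ?expR_gt0//.
have h : - (1 / 2) != 0 :> R by apply/eqP; lra.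
by apply: le_lt_trans (expR_gt1Dx h); lra.
Qed.

Section prime_measure.
Context {R : realType}.
Local Notation T := (measurableTypeR R).
Local Notation half_line := (`]0, +oo[%classic : set T).
Variable sigma : R.
Hypothesis sigma1 : 1 < sigma.

Lemma prime_atoms_support p (D : set T) : measurable D -> (forall x, ln 2 <= x -> D x) ->
  prime_atoms sigma p (~` D) = 0%E.
Proof.
move=> mD hD; rewrite /prime_atoms; case: ifP => // pp.
rewrite /= /mseries eseries0// => r r1 _.
rewrite /prime_power_atom /= /mscale /= diracE memNset ?mule0//; apply; apply: hD.
have p2 : (2 : R) <= p%:R by rewrite ler_nat prime_gt1.
apply: (@le_trans _ _ (ln p%:R)); first by rewrite ler_ln ?posrE// (lt_le_trans _ p2).
by rewrite ler_peMl ?ler1n// ln_ge0// (le_trans _ p2)// ler1n.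
Qed.

(** The atoms over p have mass at most 2 p^{-sigma}; summing over all integers instead of primes
    gives a convergent bound. *)
Lemma prime_atoms_mass_lty : (mseries (prime_atoms sigma) 0 setT < +oo)%E.
Proof.
have cv := @is_cvg_dirichlet_bound_sum R sigma%:C sigma1.
have b0 := @dirichlet_bound_gt0 R sigma%:C.
apply: (@nneseries_lty R _ (2 * limn (dirichlet_bound_sum sigma%:C))) => // -[|n].
  rewrite big_ord0 lee_fin mulr_ge0//.
  apply: limr_ge => //; apply: nearW => k.
  by apply: sumr_ge0 => i _; exact/ltW/b0.
apply: (@le_trans _ _ (\sum_(k < n) (2 * dirichlet_bound sigma%:C k.+1)%:E)%E).
  rewrite big_ord_recl /prime_atoms /= /mzero add0e; apply: lee_sum => k _.
  rewrite (_ : bump 0 k = k.+1)//; case: ifP => [pp|_]; last by rewrite /= /mzero lee_fin mulr_ge0// ltW.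
  by have := prime_atoms_mass sigma1 pp; rewrite /prime_atoms pp.
rewrite sumEFin lee_fin -mulr_sumr ler_pM2l//.
apply: (@nondecreasing_cvgn_le _ (dirichlet_bound_sum sigma%:C)) => //.
by apply/nondecreasing_seqP => k; rewrite /dirichlet_bound_sum big_ord_recr lerDl ltW.
Qed.

Lemma integrable_sqr_min1_primes (D : set T) : measurable D ->
  (mseries (prime_atoms sigma) 0).-integrable D (EFin \o sqr_min1).
Proof.
move=> mD.
have h : (mseries (prime_atoms sigma) 0).-integrable setT (EFin \o (fun=> 1)).
  by apply: real_integrable_cst => //; exact: prime_atoms_mass_lty.
have : (mseries (prime_atoms sigma) 0).-integrable setT (EFin \o sqr_min1).
  apply: (le_real_integrable measurableT measurable_sqr_min1 h) => x _.
  by rewrite (ger0_norm (sqr_min1_ge0 x)) /sqr_min1 ge_min lexx orbT.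
by apply: integrableS.
Qed.

Lemma cintegrable_LK_primes t : cintegrable (mseries (prime_atoms sigma) 0) half_line
  (LK_integrand (1 / 2) t).
Proof.
have m0 : measurable half_line by exact: measurable_0y.
exact: (cintegrable_LK t m0 (half_gt0 (R := R)) (integrable_sqr_min1_primes m0)).
Qed.

Lemma dirichlet_term_conj t p :
  dirichlet_term (sigma -i* t) p =
  (expR (- sigma * ln p%:R) * cos (t * ln p%:R)) +i*
  (expR (- sigma * ln p%:R) * sin (t * ln p%:R)).
Proof.
rewrite /dirichlet_term /cpow /=.
rewrite !mul0r !subr0 !addr0 opprK ![ln _ * _]mulrC //.
Qed.

Lemma dirichlet_term_real p :
  dirichlet_term sigma%:C p = (expR (- sigma * ln p%:R))%:C.
Proof.
have := dirichlet_term_conj 0 p; rewrite mul0r cos0 sin0 mulr1 mulr0.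
by rewrite oppr0 => ->.
Qed.

Lemma cexp_prime_atoms t p : prime p ->
  (1 - dirichlet_term (sigma -i* t) p) *
  cexp (Cintegral (prime_atoms sigma p) half_line (LK_integrand (1 / 2) t)) =
  1 - dirichlet_term sigma%:C p.
Proof.
move=> pp; have := cexp_prime_powers sigma1 pp t.
have m0 : measurable half_line by exact: measurable_0y.
pose D : set T := (`[ln 2, +oo[)%classic.
have mD : measurable D by exact: measurable_itv.
have sD : prime_atoms sigma p (~` D) = 0%E.
  by apply: prime_atoms_support => // x; rewrite /D /= in_itv /= andbT.
have s0 : prime_atoms sigma p (~` half_line) = 0%E.
  apply: prime_atoms_support => // x x2 /=; rewrite in_itv /= andbT.
  by apply: lt_le_trans x2; apply: lt_trans (half_lt_ln2 R); exact: half_gt0.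
have fin : (prime_atoms sigma p).-integrable setT (EFin \o (fun=> 1)).
  apply: real_integrable_cst => //.
  by apply: le_lt_trans (prime_atoms_mass sigma1 pp) _; exact: ltry.
have bdd (f : T -> R) (c : R) : measurable_fun setT f -> (forall x, `|f x| <= c) ->
    (prime_atoms sigma p).-integrable setT (EFin \o f).
  move=> mf fc; apply: (le_real_integrable measurableT mf
    (real_integrableZl measurableT c fin)) => x _.
  by rewrite mulr1.
have sqr : (prime_atoms sigma p).-integrable setT (EFin \o sqr_min1).
  apply: (bdd _ 1) measurable_sqr_min1 _ => x.
  by rewrite (ger0_norm (sqr_min1_ge0 x)) /sqr_min1 ge_min lexx orbT.
have [lk1 lk2] := cintegrable_LK t measurableT (half_gt0 (R := R)) sqr.
have eI (f : T -> R) : \int[all_prime_powers sigma p]_x f x = \int[prime_atoms sigma p]_x f x.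
  rewrite /Rintegral; congr fine; apply: eq_measure_integral => A _ _.
  by rewrite prime_atomsE.
rewrite !eI => h.
have -> : Cintegral (prime_atoms sigma p) half_line (LK_integrand (1 / 2) t) =
    (\int[prime_atoms sigma p]_x ((cos (t * x) - 1) * 1)) +i*
    (\int[prime_atoms sigma p]_x (sin (t * x) * 1)).
  apply: complexP; rewrite [LHS]/= [RHS]/=.
    rewrite -(Rintegral_support m0 s0 lk1); apply: eq_Rintegral => x _.
    by rewrite Re_LK mulr1.
  (* Both integrals are moved to [ln 2, +oo[, where the indicator of the truncation vanishes. *)
  rewrite -(Rintegral_support m0 s0 lk2) (Rintegral_support mD sD lk2).
  rewrite [RHS](Rintegral_support mD sD); last first.
    apply: (bdd _ 1) => [|x]; last by rewrite mulr1 sin_max.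
    by apply: measurable_funM => //; exact: measurable_sinM.
  apply: eq_Rintegral => x; rewrite inE /D [X in X -> _]/= in_itv [X in X -> _]/= andbT => x2.
  rewrite Im_LK mulr1 indicE memNset ?mulr0 ?subr0// /= in_itv /=.
  by move=> /andP[_]; rewrite leNgt (lt_le_trans (half_lt_ln2 R) x2).
rewrite dirichlet_term_conj dirichlet_term_real.
have -> : (1 - (expR (- sigma * ln p%:R))%:C : R[i]) = (1 - expR (- sigma * ln p%:R))%:C.
  by apply: complexP; rewrite ?ReB ?ImB /=; ring.
rewrite -h; congr (_ * _); apply: complexP; rewrite ?ReB ?ImB /=; ring.
Qed.

(** Multiply each partial Euler product by the zeta value at the other point. By [prodE] the two
    resulting sequences coincide once the exponential of the partial sums is included, and their
    limits are the two sides. *)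
Lemma zeta_levy_khintchine t :
  zeta (sigma -i* t) = zeta sigma%:C *
    cexp (Cintegral (mseries (prime_atoms sigma) 0) half_line (LK_integrand (1 / 2) t)).
Proof.
set E := Cintegral _ _ _.
pose F p := Cintegral (prime_atoms sigma p) half_line (LK_integrand (1 / 2) t).
have [lk1 lk2] := cintegrable_LK_primes t.
have cF : ccvg (fun n => \sum_(p < n) F p) E.
  split.
  - rewrite (_ : (fun n => _) = (fun n => \sum_(p < n) complex.Re (F p))).
      exact: (Rintegral_mseries measurable_0y lk1).
    by apply/funext => n; rewrite (@Re_sum R n F).
  - rewrite (_ : (fun n => _) = (fun n => \sum_(p < n) complex.Im (F p))).
      exact: (Rintegral_mseries measurable_0y lk2).
    by apply/funext => n; rewrite (@Im_sum R n F).
have F0 p : prime p = false -> F p = 0.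
  move=> pp; have i0 (f : T -> R) : \int[prime_atoms sigma p]_(x in half_line) f x = 0.
    by rewrite /Rintegral /prime_atoms pp integral_measure_zero.
  by apply: complexP; rewrite [LHS]/= i0.
have prodE k : (\prod_(p < k | prime p) (1 - dirichlet_term (sigma -i* t) p)) *
    cexp (\sum_(p < k) F p) = \prod_(p < k | prime p) (1 - dirichlet_term sigma%:C p).
  rewrite (@cexp_sum R k F) big_mkcond [RHS]big_mkcond -big_split.
  apply: eq_bigr => p _; case: ifP => pp; first exact: cexp_prime_atoms.
  by rewrite F0// cexp0; exact: mulr1.
have s1 : 1 < complex.Re (sigma -i* t) by [].
have c1 := ccvg_euler_product s1.
have c2 := @ccvg_euler_product R sigma%:C sigma1.
have c3 := ccvgM (ccvg_cst (zeta sigma%:C)) (ccvgM c1 (ccvg_cexp cF)).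
have c4 := ccvgM (ccvg_cst (zeta (sigma -i* t))) c2.
rewrite mul1r in c3; rewrite mulr1 in c4.
apply/esym/(ccvg_unique c3); move: c4; congr ccvg; apply/funext => n.
by rewrite -prodE; ring.
Qed.

End prime_measure.

(** * Levy-Khintchine form of Xi *)

Lemma Cintegral_measure_add d (T : measurableType d) (R : realType)
    (m1 m2 : {measure set T -> \bar R}) (D : set T) (f : T -> R[i]) : measurable D ->
  cintegrable m1 D f -> cintegrable m2 D f ->
  Cintegral (measure_add m1 m2) D f = Cintegral m1 D f + Cintegral m2 D f.
Proof.
move=> mD [f1 g1] [f2 g2]; apply: complexP; rewrite ?ReD ?ImD /= /Rintegral.
- by rewrite (integral_measure_add mD f1 f2) fineD ?integrable_fin_num.
- by rewrite (integral_measure_add mD g1 g2) fineD ?integrable_fin_num.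
Qed.

Lemma Cintegral_density (R : realType) (g : R -> R)
    (mg : measurable_fun (setT : set (measurableTypeR R)) g) (g0 : forall x, 0 <= g x)
    (D : set (measurableTypeR R)) (f : R -> R[i]) : measurable D ->
  cintegrable (density_measure mg g0) D f ->
  Cintegral (density_measure mg g0) D f =
  Cintegral (@lebesgue_measure R) D (fun x => f x * (g x)%:C).
Proof.
move=> mD [f1 f2].
have m1 : measurable_fun D (fun x => complex.Re (f x)).
  by case/integrableP : f1 => /measurable_EFinP.
have m2 : measurable_fun D (fun x => complex.Im (f x)).
  by case/integrableP : f2 => /measurable_EFinP.
apply: complexP; rewrite [LHS]/= [RHS]/=.
- rewrite Rintegral_density//; last exact: density_integrable f1.
  by apply: eq_Rintegral => x _; rewrite ReMr.
- rewrite Rintegral_density//; last exact: density_integrable f2.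
  by apply: eq_Rintegral => x _; rewrite ImMr.
Qed.

Section levy_khintchine_of_Xi.
Context {R : realType}.
Local Notation T := (measurableTypeR R).
Local Notation leb := (@lebesgue_measure R).
Local Notation half_line := (`]0, +oo[%classic : set T).
Variable sigma : R.
Hypothesis sigma1 : 1 < sigma.

Let sigma0 : 0 < sigma. Proof. exact: lt_trans sigma1. Qed.
Let sigma10 : 0 < sigma - 1. Proof. by rewrite subr_gt0. Qed.
Let m0 : measurable half_line. Proof. exact: measurable_0y. Qed.

Local Notation gamma_measure :=
  (density_measure (measurable_gamma_density sigma) (gamma_density_ge0 sigma)).

Lemma sqr_min1_gamma_measure : gamma_measure.-integrable half_line (EFin \o sqr_min1).
Proof.
apply: integrable_density => //; last exact: integrable_sqr_min1_gamma.
by apply: measurable_funTS; exact: measurable_sqr_min1.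
Qed.

Lemma sqr_min1_nu_neg : (nu_neg sigma).-integrable half_line (EFin \o sqr_min1).
Proof.
apply: integrable_density => //; last exact: integrable_sqr_min1_pole.
by apply: measurable_funTS; exact: measurable_sqr_min1.
Qed.

Lemma Cintegral_nu_pos t :
  Cintegral (nu_pos sigma) half_line (LK_integrand (1 / 2) t) =
  Cintegral leb half_line (gamma_LK sigma t) +
  Cintegral (mseries (prime_atoms sigma) 0) half_line (LK_integrand (1 / 2) t).
Proof.
have h := cintegrable_LK t m0 (half_gt0 (R := R)) sqr_min1_gamma_measure.
rewrite Cintegral_measure_add//; last exact: cintegrable_LK_primes.
by rewrite Cintegral_density.
Qed.

Lemma Cintegral_nu_neg t :
  Cintegral (nu_neg sigma) half_line (LK_integrand (1 / 2) t) =
  Cintegral leb half_line (exp_LK t sigma) + Cintegral leb half_line (exp_LK t (sigma - 1)).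
Proof.
have h := cintegrable_LK t m0 (half_gt0 (R := R)) sqr_min1_nu_neg.
rewrite Cintegral_density// -CintegralD//; try exact: cintegrable_exp_LK.
apply: eq_Cintegral => x; rewrite inE /= in_itv /= andbT => x0.
by rewrite pole_densityE// /exp_LK -mulrDr -rmorphD.
Qed.

Lemma cpow_pi t : cpow pi (- ((sigma -i* t) / 2)) =
  cpow pi (- (sigma%:C / 2)) * cexp ((t * (ln pi / 2))*i).
Proof.
rewrite /cpow -cexpD; congr cexp.
have -> : (2 : R[i]) = (2 : R)%:C by rewrite rmorphMn.
rewrite -fmorphV.
by apply: complexP; rewrite ?ReD ?ImD ?ReM ?ImM /=; ring.
Qed.

Lemma half_complex (a b : R) : (a +i* b) / 2 = (a / 2) +i* (b / 2).
Proof.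
have -> : (2 : R[i]) = (2 : R)%:C by rewrite rmorphMn.
by rewrite -fmorphV; apply: complexP; rewrite ?ReM ?ImM /=; ring.
Qed.

Lemma xi_neq0 : xi sigma%:C != 0.
Proof.
rewrite /xi !mulf_neq0 ?cexp_neq0//.
- by rewrite eq_complex /= gt_eqF.
- by rewrite -[1]/(1%:C) -rmorphB eq_complex /= gt_eqF.
- by rewrite half_complex mul0r; apply: Gamma_gt0; rewrite divr_gt0.
- exact: (@zeta_neq0 R sigma%:C sigma1).
Qed.

Lemma Xi_levy_khintchine t : Xi sigma t =
  cexp ((t * lambda sigma)*i
        + signed_integral (nu_pos sigma) (nu_neg sigma) half_line (LK_integrand (1 / 2) t)).
Proof.
rewrite /signed_integral Cintegral_nu_pos Cintegral_nu_neg.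
apply: (mulIf xi_neq0); rewrite /Xi divfK ?xi_neq0//.
rewrite /xi cpow_pi !half_complex mul0r mulNr Gamma_levy_khintchine// (zeta_levy_khintchine sigma1).
have e2 := cexp_exp_LK t sigma10.
have e1 : (sigma -i* t) - 1 = (sigma - 1) -i* t.
  by apply: complexP; rewrite ?ReB ?ImB /=; ring.
have e3 : ((sigma - 1)%:C : R[i]) = sigma%:C - 1.
  by apply: complexP; rewrite ?ReB ?ImB /=; ring.
rewrite e1 e2 (cexp_exp_LK t sigma0) e3.
set A := Cintegral leb _ (exp_LK _ sigma).
set B := Cintegral leb _ (exp_LK _ (sigma - 1)).
set G := Cintegral leb _ (gamma_LK _ _).
set Z := Cintegral (mseries (prime_atoms sigma) 0) _ (LK_integrand _ _).
(* The drift is distributed over the factors: the two linear factors, the power of pi, Gamma and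
   zeta, the last of which carries none. *)
have -> : (t * lambda sigma)*i + (G + Z - (A + B)) =
  - (A + (t * ((1 - expR (- sigma * (1 / 2))) / sigma))*i)
  + - (B + (t * ((1 - expR (- (sigma - 1) * (1 / 2))) / (sigma - 1)))*i)
  + (t * (ln pi / 2))*i
  + (G + (t / 2 * malmsten_const sigma)*i) + Z.
  have -> : lambda sigma = - ((1 - expR (- sigma * (1 / 2))) / sigma)
      - (1 - expR (- (sigma - 1) * (1 / 2))) / (sigma - 1)
      + ln pi / 2 + malmsten_const sigma / 2.
    rewrite /lambda /malmsten_const.
    have -> : - sigma * (1 / 2) = - (sigma / 2) by ring.
    have -> : - (sigma - 1) * (1 / 2) = (1 - sigma) / 2 by ring.
    by field; rewrite !gt_eqF.
  move: A B G Z => A B G Z.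
  by apply: complexP; rewrite ?(ReB, ReD, ReN, ImB, ImD, ImN) /=; ring.
rewrite [in RHS]cexpD [cexp (_ + _ + _ + _)]cexpD [cexp (_ + _ + _)]cexpD [cexp (- _ + - _)]cexpD.
by rewrite -[sigma / 2 +i* 0]/((sigma / 2)%:C); ring.
Qed.

End levy_khintchine_of_Xi.

(** * Jordan decomposition and quasi-infinite divisibility *)

Section Jordan_decomposition.
Context {R : realType}.
Local Notation T := (measurableTypeR R).
Local Notation leb := (@lebesgue_measure R).
Local Notation half_line := (`]0, +oo[%classic : set T).

(** A countable, hence Lebesgue null, set carrying every atom, since r log p = log (p^r). *)
Definition log_integers : set T := (fun n : nat => ln n%:R : R) @` setT.

Lemma countable_log_integers : countable log_integers.
Proof. exact: card_image_le. Qed.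

Lemma measurable_log_integers : measurable log_integers.
Proof.
apply: countable_measurable; last exact: countable_log_integers.
by move=> x; exact: measurable_set1.
Qed.

Lemma integrable_support (m : {measure set T -> \bar R}) (D : set T) (f : T -> R) :
  measurable D -> m (~` D) = 0%E -> measurable_fun setT f ->
  m.-integrable D (EFin \o f) -> m.-integrable setT (EFin \o f).
Proof.
move=> mD mD0 mf fD; have mC : measurable (~` D) by exact: measurableC.
rewrite -(setvU D) setUC; apply: integrable_setU => //.
apply/integrableP; split; first by apply/measurable_EFinP; exact: measurable_funTS.
rewrite null_set_integral//.
by apply/measurableT_comp => //; apply/measurable_EFinP; exact: measurable_funTS.
Qed.

Lemma density_null (g : R -> R) (mg : measurable_fun (setT : set T) g)
    (g0 : forall x, 0 <= g x) (D : set T) : (forall x, D x -> g x = 0) ->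
  density_measure mg g0 D = 0%E.
Proof.
move=> gD; rewrite /= /density_measure integral0_eq// => x Dx; by rewrite gD.
Qed.

Lemma log_integers_null (g : R -> R) (mg : measurable_fun (setT : set T) g)
    (g0 : forall x, 0 <= g x) : density_measure mg g0 log_integers = 0%E.
Proof.
have mL := measurable_log_integers.
rewrite /= /density_measure; apply: null_set_integral => //.
  by apply/measurable_EFinP; exact: measurable_funTS.
exact: countable_lebesgue_measure0 countable_log_integers.
Qed.

Variable sigma : R.
Hypothesis sigma1 : 1 < sigma.

Let sigma0 : 0 < sigma. Proof. exact: lt_trans sigma1. Qed.
Let m0 : measurable half_line. Proof. exact: measurable_0y. Qed.

Lemma primes_support (D : set T) : (forall n, (1 < n)%N -> D (ln n%:R)) ->
  mseries (prime_atoms sigma) 0 (~` D) = 0%E.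
Proof.
move=> hD; rewrite /= /mseries eseries0// => p _ _; rewrite /prime_atoms.
case: ifP => // pp; rewrite /= /mseries eseries0// => r r1 _.
rewrite /prime_power_atom /= /mscale /= diracE memNset ?mule0//; apply.
rewrite [X in D X](_ : _ = ln (p ^ r)%:R).
  apply: hD; rewrite -(exp1n r) ltn_exp2r//; exact: prime_gt1.
by rewrite natrX lnXn ?mulr_natl// ltr0n prime_gt0.
Qed.

Lemma primes_half_line : mseries (prime_atoms sigma) 0 (~` half_line) = 0%E.
Proof.
apply: primes_support => n n1; rewrite /= in_itv /= andbT.
by apply: ln_gt0; rewrite ltr1n.
Qed.

Lemma half_line_gamma_density x : (~` half_line) x -> gamma_density sigma x = 0.
Proof. by move=> x0; rewrite /gamma_density indicE memNset// mulr0. Qed.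

Lemma half_line_pole_density x : (~` half_line) x -> pole_density sigma x = 0.
Proof. by move=> x0; rewrite /pole_density indicE memNset// mulr0. Qed.

Definition net_density x := gamma_density sigma x - pole_density sigma x.
Definition pos_density x := Num.max (net_density x) 0.
Definition neg_density x := Num.max (- net_density x) 0.

Lemma measurable_net_density : measurable_fun (setT : set T) net_density.
Proof.
apply: measurable_funB; first exact: measurable_gamma_density.
exact: measurable_pole_density.
Qed.

Lemma measurable_pos_density : measurable_fun (setT : set T) pos_density.
Proof. by apply: measurable_maxr => //; exact: measurable_net_density. Qed.

Lemma measurable_neg_density : measurable_fun (setT : set T) neg_density.
Proof.
apply: measurable_maxr => //; apply: measurable_funN.
exact: measurable_net_density.
Qed.

Lemma pos_density_ge0 x : 0 <= pos_density x.
Proof. by rewrite /pos_density le_max lexx orbT. Qed.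

Lemma neg_density_ge0 x : 0 <= neg_density x.
Proof. by rewrite /neg_density le_max lexx orbT. Qed.

Lemma pos_neg_density x : pos_density x - neg_density x = net_density x.
Proof.
rewrite /pos_density /neg_density.
case: (boolP (0 <= net_density x)) => [h|]; last rewrite -ltNge => /ltW h.
  by rewrite max_l// max_r ?oppr_le0// subr0.
by rewrite max_r// max_l ?oppr_ge0// sub0r opprK.
Qed.

Lemma pos_density_le x : pos_density x <= gamma_density sigma x.
Proof.
rewrite /pos_density ge_max gamma_density_ge0 andbT /net_density gerBl.
exact: pole_density_ge0.
Qed.

Lemma neg_density_le x : neg_density x <= pole_density sigma x.
Proof.
rewrite /neg_density ge_max pole_density_ge0 andbT /net_density opprB gerBl.
exact: gamma_density_ge0.
Qed.

Definition jordan_pos : {measure set T -> \bar R} :=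
  measure_add (density_measure measurable_pos_density pos_density_ge0)
    (mseries (prime_atoms sigma) 0).

Definition jordan_neg : {measure set T -> \bar R} :=
  density_measure measurable_neg_density neg_density_ge0.

Lemma jordan_posE (A : set T) : jordan_pos A =
  (density_measure measurable_pos_density pos_density_ge0 A
   + mseries (prime_atoms sigma) 0 A)%E.
Proof. exact: measure_addE. Qed.

(** The set where the net density is nonnegative separates the two densities. Adjoining the
    logarithms of integers catches atoms at points where that density is negative, and costs nothing
    on the other side, which is absolutely continuous. *)
Lemma jordan_mutually_singular : mutually_singular jordan_pos jordan_neg.
Proof.
have mL := measurable_log_integers.
pose H0 : set T := [set x | 0 <= net_density x].
have mH0 : measurable H0.
  have := measurable_fun_le measurableT
    (measurable_cst (0 : R) : measurable_fun (setT : set T) _) measurable_net_density.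
  by rewrite setTI.
exists (H0 `|` log_integers); first exact: measurableU.
split.
- rewrite jordan_posE density_null ?add0e.
    by apply: primes_support => n _; right; exists n.
  move=> x h; apply/max_r/ltW; rewrite ltNge; apply/negP => hx; apply: h.
  by left.
- apply: null_set_setU => //; last exact: log_integers_null.
  by apply: density_null => x h; apply: max_r; rewrite oppr_le0.
Qed.

Lemma sqr_min1_jordan_pos_density :
  (density_measure measurable_pos_density pos_density_ge0).-integrable half_line
    (EFin \o sqr_min1).
Proof.
have mD := measurable_funTS (D := half_line) measurable_sqr_min1.
apply: integrable_density => //.
apply: (le_real_integrable m0 _ (integrable_sqr_min1_gamma sigma0)).
  by apply: measurable_funM => //; apply: measurable_funTS; exact: measurable_pos_density.
move=> x _; rewrite (ger0_norm (mulr_ge0 (sqr_min1_ge0 x) (pos_density_ge0 x))).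
by rewrite ler_wpM2l ?pos_density_le// sqr_min1_ge0.
Qed.

Lemma sqr_min1_jordan_neg : jordan_neg.-integrable half_line (EFin \o sqr_min1).
Proof.
have mD := measurable_funTS (D := half_line) measurable_sqr_min1.
apply: integrable_density => //.
apply: (le_real_integrable m0 _ (integrable_sqr_min1_pole sigma1)).
  by apply: measurable_funM => //; apply: measurable_funTS; exact: measurable_neg_density.
move=> x _; rewrite (ger0_norm (mulr_ge0 (sqr_min1_ge0 x) (neg_density_ge0 x))).
by rewrite ler_wpM2l ?neg_density_le// sqr_min1_ge0.
Qed.

Lemma jordan_pos_half_line : jordan_pos (~` half_line) = 0%E.
Proof.
rewrite jordan_posE primes_half_line adde0; apply: density_null => x h.
by rewrite /pos_density /net_density half_line_gamma_density// half_line_pole_density// subr0 maxxx.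
Qed.

Lemma jordan_neg_half_line : jordan_neg (~` half_line) = 0%E.
Proof.
apply: density_null => x h.
by rewrite /neg_density /net_density half_line_gamma_density// half_line_pole_density// subr0 oppr0 maxxx.
Qed.

Lemma integrable_measure_add d (S : measurableType d) (m1 m2 : {measure set S -> \bar R})
    (D : set S) (f : S -> R) : measurable D ->
  m1.-integrable D (EFin \o f) -> m2.-integrable D (EFin \o f) ->
  (measure_add m1 m2).-integrable D (EFin \o f).
Proof.
move=> mD /integrableP[mf i1] /integrableP[_ i2]; apply/integrableP; split => //.
rewrite ge0_integral_measure_add//; last exact: measurableT_comp.
exact: lte_add_pinfty.
Qed.

Lemma sqr_min1_jordan_pos : jordan_pos.-integrable setT (EFin \o sqr_min1).
Proof.
apply: (integrable_support m0 jordan_pos_half_line measurable_sqr_min1).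
apply: integrable_measure_add => //; first exact: sqr_min1_jordan_pos_density.
exact: integrable_sqr_min1_primes.
Qed.

Lemma sqr_min1_jordan_negT : jordan_neg.-integrable setT (EFin \o sqr_min1).
Proof.
apply: (integrable_support m0 jordan_neg_half_line measurable_sqr_min1).
exact: sqr_min1_jordan_neg.
Qed.

Lemma jordan_sqr_min1 :
  (\int[measure_add jordan_pos jordan_neg]_x (Num.min (`|x : R| ^+ 2) 1)%:E < +oo)%E.
Proof.
have /integrableP[_] := integrable_measure_add measurableT sqr_min1_jordan_pos sqr_min1_jordan_negT.
by under eq_integral do rewrite [X in `|X|%E]/= gee0_abs ?lee_fin ?sqr_min1_ge0//.
Qed.

Lemma Cintegral_support (m : {measure set T -> \bar R}) (D : set T) (f : T -> R[i]) :
  measurable D -> m (~` D) = 0%E -> cintegrable m setT f ->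
  Cintegral m setT f = Cintegral m D f.
Proof.
by move=> mD mD0 [f1 f2]; congr Complex; apply: Rintegral_support.
Qed.

(** The two pairs of measures share their atoms, and their densities have the same difference
    pointwise, so they represent one signed measure. *)
Lemma signed_integral_jordan b t : 0 < b ->
  signed_integral jordan_pos jordan_neg setT (LK_integrand b t) =
  signed_integral (nu_pos sigma) (nu_neg sigma) half_line (LK_integrand b t).
Proof.
move=> b0; rewrite /signed_integral.
rewrite (Cintegral_support m0 jordan_pos_half_line); last first.
  by apply: cintegrable_LK => //; exact: sqr_min1_jordan_pos.
rewrite (Cintegral_support m0 jordan_neg_half_line); last first.
  by apply: cintegrable_LK => //; exact: sqr_min1_jordan_negT.
have ip := cintegrable_LK t m0 b0 sqr_min1_jordan_pos_density.
have in_ := cintegrable_LK t m0 b0 sqr_min1_jordan_neg.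
have ig := cintegrable_LK t m0 b0 (sqr_min1_gamma_measure sigma1).
have io := cintegrable_LK t m0 b0 (sqr_min1_nu_neg sigma1).
have iz := cintegrable_LK t m0 b0 (integrable_sqr_min1_primes sigma1 m0).
rewrite (Cintegral_measure_add m0 ip iz) (Cintegral_measure_add m0 ig iz).
rewrite (Cintegral_density m0 ip) (Cintegral_density m0 in_).
rewrite (Cintegral_density m0 ig) (Cintegral_density m0 io).
have addBr3 (u v x y w : R[i]) : u - v = x - y -> u + w - v = x + w - y.
  by move=> h; rewrite addrAC h addrAC.
apply: addBr3.
have di (g : R -> R) (mg : measurable_fun (setT : set T) g) (g0 : forall x, 0 <= g x) :
    cintegrable (density_measure mg g0) half_line (LK_integrand b t) ->
    cintegrable leb half_line (fun x => LK_integrand b t x * (g x)%:C).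
  move=> [d1 d2]; split.
  - under [fun x => complex.Re _]eq_fun do rewrite ReMr.
    by apply: density_integrable d1 => //; apply: measurable_funTS; exact: measurable_Re_LK.
  - under [fun x => complex.Im _]eq_fun do rewrite ImMr.
    by apply: density_integrable d2 => //; apply: measurable_funTS; exact: measurable_Im_LK.
rewrite -!CintegralB//; try exact: (di _ _ _ ip); try exact: (di _ _ _ in_);
  try exact: (di _ _ _ ig); try exact: (di _ _ _ io).
apply: eq_Cintegral => x _; rewrite -!mulrBr -!rmorphB; congr (_ * _%:C).
exact: pos_neg_density.
Qed.

Lemma Re_Cintegral (m : {measure set T -> \bar R}) (D : set T) (f : T -> R[i]) :
  complex.Re (Cintegral m D f) = \int[m]_(x in D) complex.Re (f x).
Proof. by []. Qed.

Lemma Im_Cintegral (m : {measure set T -> \bar R}) (D : set T) (f : T -> R[i]) :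
  complex.Im (Cintegral m D f) = \int[m]_(x in D) complex.Im (f x).
Proof. by []. Qed.

(* A change of truncation only shifts the drift, by the integral of
   [x (1_[-c, c] - 1_[-b, b])], written here as a difference of imaginary parts
   at [t = 1] because these are known to be integrable. *)
Lemma Cintegral_LK_shift (m : {measure set T -> \bar R}) (D : set T) b c t : measurable D ->
  0 < b -> 0 < c -> m.-integrable D (EFin \o sqr_min1) ->
  Cintegral m D (LK_integrand b t) = Cintegral m D (LK_integrand c t) +
    (t * (complex.Im (Cintegral m D (LK_integrand b 1)) -
          complex.Im (Cintegral m D (LK_integrand c 1))))*i.
Proof.
move=> mD b0 c0 im.
have [bt1 bt2] := cintegrable_LK t mD b0 im.
have [ct1 ct2] := cintegrable_LK t mD c0 im.
have [_ b2] := cintegrable_LK 1 mD b0 im.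
have [_ c2] := cintegrable_LK 1 mD c0 im.
apply: complexP; rewrite ?ReD ?ImD !(Re_Cintegral, Im_Cintegral).
  rewrite -[complex.Re (_ *i)]/0 addr0; apply: eq_Rintegral => x _; by rewrite !Re_LK.
rewrite -[complex.Im (_ *i)]/(t * _) -RintegralB// -RintegralZl//; last exact: real_integrableB.
rewrite -RintegralD//; last exact/real_integrableZl/real_integrableB.
by apply: eq_Rintegral => x _; rewrite !Im_LK; ring.
Qed.

Lemma quasi_infinitely_divisible_Xi (mu : probability T R) b :
  (forall t, charfun mu t = Xi sigma t) -> 0 < b -> quasi_infinitely_divisible b mu.
Proof.
move=> hmu b0.
have h0 : (0 : R) < 1 / 2 by exact: half_gt0.
(* The drift correction for passing from the truncation 1/2 of the formula to an arbitrary [b]. *)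
pose shift (m : {measure set T -> \bar R}) :=
  complex.Im (Cintegral m half_line (LK_integrand b 1)) -
  complex.Im (Cintegral m half_line (LK_integrand (1 / 2) 1)).
have mn0 : measurable ([set 0] : set T) by exact: measurable_set1.
have n0 : (~` half_line) (0 : R) by rewrite /= in_itv /= ltxx.
exists 0, (lambda sigma - (shift (nu_pos sigma) - shift (nu_neg sigma))), jordan_pos, jordan_neg.
split.
- exact: jordan_mutually_singular.
- exact: jordan_sqr_min1.
- split.
    by apply: subset_measure0 jordan_pos_half_line => //; [exact: measurableC|move=> _ ->].
  by apply: subset_measure0 jordan_neg_half_line => //; [exact: measurableC|move=> _ ->].
- have ip : (nu_pos sigma).-integrable half_line (EFin \o sqr_min1).
    apply: integrable_measure_add m0 _ _; first exact: sqr_min1_gamma_measure.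
    exact: integrable_sqr_min1_primes.
  move=> t; rewrite hmu (Xi_levy_khintchine sigma1) (signed_integral_jordan _ b0) /signed_integral.
  rewrite (Cintegral_LK_shift t m0 b0 h0 ip).
  rewrite (Cintegral_LK_shift t m0 b0 h0 (sqr_min1_nu_neg sigma1)).
  rewrite -/(shift _) -/(shift _); congr cexp.
  move: (shift _) (shift _) (Cintegral _ _ _) (Cintegral (nu_neg sigma) _ _) => u v A B.
  by apply: complexP; rewrite ?(ReB, ReD, ReN, ImB, ImD, ImN) /=; ring.
Qed.

End Jordan_decomposition.

(** * Convolution roots *)

Section bounded_integrals.
Context {R : realType} d (S : measurableType d) (m : probability S R).

Lemma bounded_integrable (f : S -> R) (c : R) : measurable_fun setT f ->
  (forall x, `|f x| <= c) -> m.-integrable setT (EFin \o f).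
Proof.
move=> mf fc; apply: (le_real_integrable measurableT mf (h' := fun=> c)) => [|x _//].
apply: real_integrable_cst => //.
by apply: le_lt_trans (probability_le1 m measurableT) _; exact: ltry.
Qed.

Lemma RintegralN (f : S -> R) (c : R) : measurable_fun setT f ->
  (forall x, `|f x| <= c) -> \int[m]_x (- f x) = - \int[m]_x f x.
Proof.
move=> mf fc; under eq_Rintegral do rewrite -mulN1r.
by rewrite RintegralZl ?mulN1r//; exact: bounded_integrable mf fc.
Qed.

Lemma Rintegral_lincomb (a b : R) (f g : S -> R) : m.-integrable setT (EFin \o f) ->
  m.-integrable setT (EFin \o g) ->
  \int[m]_x (a * f x + b * g x) = a * (\int[m]_x f x) + b * (\int[m]_x g x).
Proof.
by move=> fi gi; rewrite -!RintegralZl// RintegralD//; exact: real_integrableZl.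
Qed.

End bounded_integrals.

Section convolution_charfun.
Context {R : realType}.
Local Notation T := (measurableTypeR R).
Implicit Types mu nu : probability T R.

Lemma charfunE mu t :
  charfun mu t = (\int[mu]_x cos (t * x)) +i* (\int[mu]_x sin (t * x)).
Proof.
by apply: complexP => /=; apply: eq_Rintegral => x _; rewrite /= expR0 mul1r.
Qed.

Lemma Rintegral_product mu nu (f : T * T -> R) (c : R) : measurable_fun setT f ->
  (forall z, `|f z| <= c) ->
  \int[(mu \x nu)%E]_z f z = \int[mu]_x \int[nu]_y f (x, y).
Proof.
move=> mf fc; have i := bounded_integrable (mu \x nu)%E mf fc.
rewrite {1}/Rintegral -(integral12_prod_meas1 i) /Rintegral.
congr fine; apply: eq_integral => x _; rewrite /fubini_F fineK//.
apply: integrable_fin_num => //; apply: bounded_integrable (fun y => fc (x, y)).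
by apply: measurableT_comp => //; exact: pair1_measurable.
Qed.

Let measurable_lin (t u : R) : measurable_fun setT (fun z : T * T => t * z.1 + u * z.2).
Proof.
by apply: measurable_funD; apply: measurable_funM.
Qed.

Let mcos : measurable_fun (setT : set T) (@cos R).
Proof. by apply: continuous_measurable_fun; exact: continuous_cos. Qed.

Let msin : measurable_fun (setT : set T) (@sin R).
Proof. by apply: continuous_measurable_fun; exact: continuous_sin. Qed.

Lemma integral_cos_product mu nu t u :
  \int[(mu \x nu)%E]_z cos (t * z.1 + u * z.2) =
  (\int[mu]_x cos (t * x)) * (\int[nu]_x cos (u * x)) -
  (\int[mu]_x sin (t * x)) * (\int[nu]_x sin (u * x)).
Proof.
have ic (m : probability T R) s := bounded_integrable m (measurable_cosM s) (fun x => cos_max _).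
have is_ (m : probability T R) s := bounded_integrable m (measurable_sinM s) (fun x => sin_max _).
rewrite (Rintegral_product _ _ (measurableT_comp mcos (measurable_lin t u)) (fun x => cos_max _)).
transitivity (\int[mu]_x ((\int[nu]_y cos (u * y)) * cos (t * x) +
    (- \int[nu]_y sin (u * y)) * sin (t * x))).
  apply: eq_Rintegral => x _; under eq_Rintegral do rewrite /comp /= cosD -mulNr.
  by rewrite (Rintegral_lincomb _ _ (ic nu u) (is_ nu u)); ring.
by rewrite (Rintegral_lincomb _ _ (ic mu t) (is_ mu t)); ring.
Qed.

Lemma integral_sin_product mu nu t u :
  \int[(mu \x nu)%E]_z sin (t * z.1 + u * z.2) =
  (\int[mu]_x sin (t * x)) * (\int[nu]_x cos (u * x)) +
  (\int[mu]_x cos (t * x)) * (\int[nu]_x sin (u * x)).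
Proof.
have ic (m : probability T R) s := bounded_integrable m (measurable_cosM s) (fun x => cos_max _).
have is_ (m : probability T R) s := bounded_integrable m (measurable_sinM s) (fun x => sin_max _).
rewrite (Rintegral_product _ _ (measurableT_comp msin (measurable_lin t u)) (fun x => sin_max _)).
transitivity (\int[mu]_x ((\int[nu]_y cos (u * y)) * sin (t * x) +
    (\int[nu]_y sin (u * y)) * cos (t * x))).
  apply: eq_Rintegral => x _; under eq_Rintegral do rewrite /comp /= sinD.
  by rewrite (Rintegral_lincomb _ _ (ic nu u) (is_ nu u)); ring.
by rewrite (Rintegral_lincomb _ _ (is_ mu t) (ic mu t)); ring.
Qed.

Lemma charfun_convolution mu nu t :
  charfun (convolution mu nu) t = charfun mu t * charfun nu t.
Proof.
have dist (f : T -> R) : measurable_fun setT f -> (forall x, `|f x| <= 1) ->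
    \int[convolution mu nu]_x f x = \int[(mu \x nu)%E]_z f (z.1 + z.2).
  move=> mf f1; rewrite /Rintegral integral_distribution//.
    exact/measurable_EFinP.
  apply: (@bounded_integrable _ _ _ (mu \x nu)%E (f \o sum2) 1); last by move=> z; exact: f1.
  by apply: measurableT_comp => //; exact: measurable_sum2.
rewrite !charfunE; apply: complexP; rewrite ?ReM ?ImM [LHS]/= [RHS]/=.
- rewrite dist; [|exact: measurable_cosM|by move=> x; exact: cos_max].
  under eq_Rintegral do rewrite mulrDr.
  by rewrite integral_cos_product.
- rewrite dist; [|exact: measurable_sinM|by move=> x; exact: sin_max].
  under eq_Rintegral do rewrite mulrDr.
  by rewrite integral_sin_product addrC.
Qed.

Lemma charfun_convolution_power mu n t :
  charfun (convolution_power mu n) t = charfun mu t ^+ n.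
Proof.
elim: n => [|n IH] /=; last by rewrite charfun_convolution IH exprS.
rewrite charfunE expr0 /Rintegral.
rewrite !integral_dirac//.
- by rewrite diracT !mul1e /= mulr0 cos0 sin0.
- by apply/measurable_EFinP; exact: measurable_sinM.
- by apply/measurable_EFinP; exact: measurable_cosM.
Qed.

Lemma charfun_root mu n : infinitely_divisible mu -> (0 < n)%N ->
  exists nu, forall t, charfun mu t = charfun nu t ^+ n.
Proof.
move=> h n0; have [nu hnu] := h n n0; exists nu => t.
rewrite -charfun_convolution_power !charfunE /Rintegral.
by congr (fine _ +i* fine _); apply: eq_measure_integral => A mA _; exact: hnu.
Qed.

Definition normsq (z : R[i]) : R := complex.Re z ^+ 2 + complex.Im z ^+ 2.

Lemma normsq_ge0 z : 0 <= normsq z.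
Proof. by rewrite addr_ge0// sqr_ge0. Qed.

Lemma normsqX z n : normsq (z ^+ n) = normsq z ^+ n.
Proof.
elim: n => [|n IH]; first by rewrite !expr0 /normsq /= expr0n addr0 expr1n.
by rewrite !exprS -IH /normsq ReM ImM; ring.
Qed.

Lemma normsq_cexp z : normsq (cexp z) = expR (2 * complex.Re z).
Proof.
rewrite /normsq Re_cexp Im_cexp !exprMn -mulrDr cos2Dsin2 mulr1 expr2 -expRD.
by congr expR; ring.
Qed.

Lemma integral_cos_difference mu t :
  \int[(mu \x mu)%E]_z cos (t * (z.1 - z.2)) = normsq (charfun mu t).
Proof.
have -> : \int[(mu \x mu)%E]_z cos (t * (z.1 - z.2)) =
    \int[(mu \x mu)%E]_z cos (t * z.1 + (- t) * z.2).
  by apply: eq_Rintegral => z _; congr cos; ring.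
rewrite integral_cos_product charfunE /normsq /=.
have -> : \int[mu]_x cos (- t * x) = \int[mu]_x cos (t * x).
  by apply: eq_Rintegral => x _; rewrite mulNr cosN.
have -> : \int[mu]_x sin (- t * x) = - \int[mu]_x sin (t * x).
  rewrite -(RintegralN mu (measurable_sinM t) (fun x => sin_max _)).
  by apply: eq_Rintegral => x _; rewrite mulNr sinN.
by ring.
Qed.

(* The characteristic function of the difference of two independent copies is
   [|charfun nu t|^2], which avoids choosing a branch of the n-th root. *)
Lemma infinitely_divisible_root mu (psi : R -> R[i]) n : infinitely_divisible mu ->
  (forall t, charfun mu t = cexp (psi t)) ->
  exists nu, forall t, \int[(nu \x nu)%E]_z cos (t * (z.1 - z.2)) =
    expR (2 * complex.Re (psi t) / n.+1%:R).
Proof.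
move=> h hpsi; have [nu hnu] := charfun_root h (ltn0Sn n); exists nu => t.
rewrite integral_cos_difference; apply: (@pexpIrn R n.+1) => //.
- by rewrite nnegrE normsq_ge0.
- by rewrite nnegrE expR_ge0.
- rewrite -normsqX -hnu hpsi normsq_cexp -expRM_natl; congr expR; field.
  by rewrite addrC natr1 pnatr_eq0.
Qed.

End convolution_charfun.

(** * Positivity forced by infinite divisibility *)

Section finite_sums_of_integrals.
Context {R : realType} d (S : measurableType d) (m : {measure set S -> \bar R}).

Lemma Rintegral_lincomb_seq (I : Type) (s : seq I) (a : I -> R) (f : I -> S -> R) :
  (forall i, m.-integrable setT (EFin \o f i)) ->
  m.-integrable setT (EFin \o (fun x => \sum_(i <- s) a i * f i x)) /\
  \int[m]_x (\sum_(i <- s) a i * f i x) = \sum_(i <- s) a i * \int[m]_x f i x.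
Proof.
move=> fi; elim: s => [|i s [IH1 IH2]].
  under [fun x => _]eq_fun do rewrite big_nil.
  split; first exact: integrable0.
  by rewrite big_nil; rewrite Rintegral_cst// mul0r.
have h := real_integrableZl measurableT (a i) (fi i).
under [fun x => _]eq_fun do rewrite big_cons.
split; first exact: real_integrableD.
by rewrite RintegralD// RintegralZl// IH2 big_cons.
Qed.

End finite_sums_of_integrals.

Section cosine_polynomials.
Context {R : realType}.
Implicit Types f g : R -> R.

(** Frequencies are arbitrary reals. Only cosines occur, because the symmetrised roots give access
    to Re psi alone. *)
Definition cosine_polynomial f := exists s : seq (R * R),
  forall x, f x = \sum_(p <- s) p.1 * cos (p.2 * x).

Lemma cosine_polynomial_cst c : cosine_polynomial (fun=> c).
Proof. by exists [:: (c, 0)] => x; rewrite big_seq1 mul0r cos0 mulr1. Qed.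

Lemma cosine_polynomial_cos t : cosine_polynomial (fun x => cos (t * x)).
Proof. by exists [:: (1, t)] => x; rewrite big_seq1 mul1r. Qed.

Lemma eq_cosine_polynomial f g : f =1 g -> cosine_polynomial f -> cosine_polynomial g.
Proof. by move=> fg [s hs]; exists s => x; rewrite -fg. Qed.

Lemma cosine_polynomialD f g : cosine_polynomial f -> cosine_polynomial g ->
  cosine_polynomial (fun x => f x + g x).
Proof. by move=> [s hs] [s' hs']; exists (s ++ s') => x; rewrite big_cat hs hs'. Qed.

Let cosine_polynomialMcos a t g : cosine_polynomial g ->
  cosine_polynomial (fun x => a * cos (t * x) * g x).
Proof.
move=> [s hs]; exists ([seq (a * p.1 / 2, t + p.2) | p <- s] ++
  [seq (a * p.1 / 2, t - p.2) | p <- s]) => x.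
rewrite big_cat /= !big_map -big_split /= hs mulr_sumr; apply: eq_bigr => p _ /=.
by rewrite mulrDl mulrBl cosD cosB; field.
Qed.

Lemma cosine_polynomialM f g : cosine_polynomial f -> cosine_polynomial g ->
  cosine_polynomial (fun x => f x * g x).
Proof.
move=> [s hs] hg; suff : cosine_polynomial (fun x => (\sum_(p <- s) p.1 * cos (p.2 * x)) * g x).
  by apply: eq_cosine_polynomial => x; rewrite hs.
elim: s {f hs} => [|p s IH].
  by apply: eq_cosine_polynomial (cosine_polynomial_cst 0) => x; rewrite big_nil mul0r.
apply: eq_cosine_polynomial (cosine_polynomialD (cosine_polynomialMcos p.1 p.2 hg) IH) => x.
by rewrite big_cons mulrDl.
Qed.

Lemma cosine_polynomialX f n : cosine_polynomial f -> cosine_polynomial (fun x => f x ^+ n).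
Proof.
move=> hf; elim: n => [|n IH].
  by apply: eq_cosine_polynomial (cosine_polynomial_cst 1) => x; rewrite expr0.
by apply: eq_cosine_polynomial (cosine_polynomialM hf IH) => x; rewrite exprS.
Qed.

Lemma cosine_polynomialZ c f : cosine_polynomial f -> cosine_polynomial (fun x => c * f x).
Proof. exact/cosine_polynomialM/cosine_polynomial_cst. Qed.

Lemma cosine_polynomialB f g : cosine_polynomial f -> cosine_polynomial g ->
  cosine_polynomial (fun x => f x - g x).
Proof.
move=> hf hg; apply: eq_cosine_polynomial (cosine_polynomialD hf (cosine_polynomialZ (-1) hg)).
by move=> x; rewrite mulN1r.
Qed.

End cosine_polynomials.

Lemma cvg_sum_seq (R : realType) (I : Type) (s : seq I) (u : I -> nat -> R) (l : I -> R) :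
  (forall i, u i n @[n --> \oo] --> l i) ->
  \sum_(i <- s) u i n @[n --> \oo] --> \sum_(i <- s) l i.
Proof.
move=> h; elim: s => [|i s IH].
  by under eq_fun do rewrite big_nil; rewrite big_nil; exact: cvg_cst.
by under eq_fun do rewrite big_cons; rewrite big_cons; exact: cvgD.
Qed.

(** Squeezed between y and y e^{y/n}: both bounds come from e^v >= 1 + v, at v = y/n and at v =
    -y/n. *)
Lemma cvg_expR_slope (R : realType) (y : R) :
  n.+1%:R * (expR (y / n.+1%:R) - 1) @[n --> \oo] --> y.
Proof.
apply: (squeeze_cvgr (f := fun=> y) (h := fun n => y * expR (y / n.+1%:R))).
- apply: nearW => n; set N : R := n.+1%:R; have N0 : 0 < N by rewrite ltr0n.
  have yE : y = N * (y / N) by field; rewrite gt_eqF.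
  set e := expR (y / N); apply/andP; split.
    rewrite [leLHS]yE ler_pM2l// lerBrDl; exact: expR_ge1Dx.
  rewrite {1}yE -mulrA ler_pM2l//.
  have e0 : 0 < e by exact: expR_gt0.
  have := expR_ge1Dx (- (y / N)); rewrite expRN -/e -(ler_pM2r e0) mulVf ?gt_eqF//.
  by rewrite mulrBl mul1r lerBlDr lerBlDl.
- exact: cvg_cst.
- suff : y * expR (y / n.+1%:R) @[n --> \oo] --> y * expR 0 by rewrite expR0 mulr1.
  apply: cvgM; first exact: cvg_cst.
  apply: (cvg_comp (fun n : nat => y / n.+1%:R) expR (cvg_natV y)).
  exact: continuous_expR.
Qed.

Lemma cvg_chord_sqr (R : realType) (x : R) :
  k.+1%:R ^+ 2 * (2 - 2 * cos (k.+1%:R^-1 * x)) @[k --> \oo] --> x ^+ 2.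
Proof.
have bd k : `|k.+1%:R ^+ 2 * (2 - 2 * cos (k.+1%:R^-1 * x)) - x ^+ 2| <= `|x| ^+ 3 / k.+1%:R.
  set K : R := k.+1%:R; have K0 : 0 < K by rewrite ltr0n.
  (* Passing to the half angle y turns the squared chord into 4 sin^2 y, to be compared with (2y)^2
     = (x/K)^2. *)
  have [y yE] : exists y, x = 2 * y * K by exists (x / K / 2); field; rewrite gt_eqF.
  have -> : K^-1 * x = y + y by rewrite yE; field; rewrite gt_eqF.
  have -> : K ^+ 2 * (2 - 2 * cos (y + y)) - x ^+ 2 =
      4 * K ^+ 2 * ((sin y - y) * (sin y + y)).
    rewrite cosD -!expr2 cos2sin2 {1}yE; ring.
  have h1 := le_subr_sin y; have h2 := le_sin y.
  have h3 : `|sin y + y| <= 2 * `|y|.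
    by apply: (le_trans (ler_normD _ _)); lra.
  have k2 : 0 <= 4 * K ^+ 2 by rewrite mulr_ge0// exprn_ge0// ltW.
  rewrite normrM (ger0_norm k2) normrM.
  apply: (@le_trans _ _ (4 * K ^+ 2 * (y ^+ 2 * (2 * `|y|)))).
    by rewrite ler_wpM2l// ler_pM.
  rewrite yE !normrM (gtr0_norm K0) (@gtr0_norm _ 2)// -[y ^+ 2]real_normK ?num_real//.
  rewrite le_eqVlt; apply/orP; left; apply/eqP; field.
  by rewrite gt_eqF.
rewrite -[X in _ --> X]add0r.
rewrite (_ : (fun k => _) = (fun k => (k.+1%:R ^+ 2 * (2 - 2 * cos (k.+1%:R^-1 * x)) - x ^+ 2) + x ^+ 2)); last first.
  by apply/funext => k; rewrite subrK.
apply: cvgD; last exact: cvg_cst.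
apply: (squeeze_cvgr (f := fun k => - (`|x| ^+ 3 / k.+1%:R)) (h := fun k => `|x| ^+ 3 / k.+1%:R)).
- by apply: nearW => k; rewrite -ler_norml.
- rewrite -[X in _ --> X]oppr0; apply: cvgN; exact: cvg_natV.
- exact: cvg_natV.
Qed.

Section integrable_cosine.
Context {R : realType}.
Local Notation T := (measurableTypeR R).

Lemma integrable_cosB1 (m : {measure set T -> \bar R}) t :
  m.-integrable setT (EFin \o sqr_min1) ->
  m.-integrable setT (EFin \o (fun x : T => cos (t * x) - 1)).
Proof.
move=> h; have [h1 _] := cintegrable_LK t measurableT (half_gt0 (R := R)) h.
by move: h1; under [fun x => complex.Re _]eq_fun do rewrite Re_LK.
Qed.

Lemma measurable_1Bcos : measurable_fun (setT : set T) (fun x : R => 1 - cos x).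
Proof.
apply: measurable_funB => //.
by apply: continuous_measurable_fun; exact: continuous_cos.
Qed.

Lemma onemcos_ge0 (x : R) : 0 <= 1 - cos x.
Proof. by rewrite subr_ge0 cos_le1. Qed.

Lemma integrable_1Bcos (m : {measure set T -> \bar R}) :
  m.-integrable setT (EFin \o sqr_min1) ->
  m.-integrable setT (EFin \o (fun x : T => 1 - cos x)).
Proof.
move=> hm; apply: (le_real_integrable measurableT measurable_1Bcos
  (integrable_norm (integrable_cosB1 1 hm))) => x _ /=.
by rewrite mul1r distrC.
Qed.

End integrable_cosine.

Section positivity.
Context {R : realType}.
Local Notation T := (measurableTypeR R).
Variables (mu : probability T R) (psi : R -> R[i]) (P N : {measure set T -> \bar R}).
Hypothesis mu_id : infinitely_divisible mu.
Hypothesis mu_psi : forall t, charfun mu t = cexp (psi t).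
Hypothesis sqrP : P.-integrable setT (EFin \o sqr_min1).
Hypothesis sqrN : N.-integrable setT (EFin \o sqr_min1).
Hypothesis Re_psi : forall t,
  complex.Re (psi t) = \int[P]_x (cos (t * x) - 1) - \int[N]_x (cos (t * x) - 1).

(* [q] has nonnegative mean under the difference of two copies of the n-th root,
   so [sum_j a_j n (exp (2 Re psi (t_j) / n) - 1) >= 0]; let n go to infinity. *)
Lemma cosine_polynomial_integral_ge0 (q : R -> R) : cosine_polynomial q ->
  (forall x, 0 <= q x) -> q 0 = 0 -> \int[N]_x q x <= \int[P]_x q x.
Proof.
move=> [s hs] q0 q00.
(* Because q(0) = 0, each cosine may be replaced by cosine minus 1, which is integrable although the
   measures may have infinite mass near 0. *)
have s0 : \sum_(p <- s) p.1 = 0.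
  by rewrite -[RHS]q00 hs; apply: eq_bigr => p _; rewrite mulr0 cos0 mulr1.
have qE x : q x = \sum_(p <- s) p.1 * (cos (p.2 * x) - 1).
  rewrite hs -[LHS]subr0 -[X in _ - X = _]s0 -sumrB.
  by apply: eq_bigr => p _; rewrite mulrBr mulr1.
have intE (m : {measure set T -> \bar R}) : m.-integrable setT (EFin \o sqr_min1) ->
    \int[m]_x q x = \sum_(p <- s) p.1 * \int[m]_x (cos (p.2 * x) - 1).
  move=> hm; under eq_Rintegral do rewrite qE.
  by have [] := Rintegral_lincomb_seq s fst (fun p : R * R => integrable_cosB1 p.2 hm).
rewrite !intE// -subr_ge0 -sumrB.
have -> : \sum_(p <- s) (p.1 * \int[P]_x (cos (p.2 * x) - 1) -
    p.1 * \int[N]_x (cos (p.2 * x) - 1)) = \sum_(p <- s) p.1 * complex.Re (psi p.2).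
  by apply: eq_bigr => p _; rewrite Re_psi mulrBr.
have lim : \sum_(p <- s) p.1 * (n.+1%:R * (expR (2 * complex.Re (psi p.2) / n.+1%:R) - 1))
    @[n --> \oo] --> \sum_(p <- s) p.1 * (2 * complex.Re (psi p.2)).
  by apply: cvg_sum_seq => p; apply: cvgM; [exact: cvg_cst|exact: cvg_expR_slope].
have : 0 <= \sum_(p <- s) p.1 * (2 * complex.Re (psi p.2)).
  apply: (ler_cvg_to (cvg_cst 0) lim); apply: nearW => n.
  have [nu hnu] := infinitely_divisible_root n mu_id mu_psi.
  have [_ e] := Rintegral_lincomb_seq s fst (m := (nu \x nu)%E)
    (f := fun (p : R * R) (z : T * T) => cos (p.2 * (z.1 - z.2)))
    (fun p => bounded_integrable (nu \x nu)%E (c := 1)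
      (measurableT_comp (measurable_cosM p.2) (measurable_funB measurable_fst measurable_snd))
      (fun z => cos_max _)).
  have -> : \sum_(p <- s) p.1 * (n.+1%:R * (expR (2 * complex.Re (psi p.2) / n.+1%:R) - 1)) =
      n.+1%:R * \sum_(p <- s) p.1 * expR (2 * complex.Re (psi p.2) / n.+1%:R).
    rewrite -[X in n.+1%:R * X]subr0 -[X in _ * (_ - X)]s0 -sumrB mulr_sumr.
    by apply: eq_bigr => p _; ring.
  rewrite mulr_ge0//.
  under eq_bigr do rewrite -hnu; rewrite -e.
  apply: Rintegral_ge0 => z _; rewrite -hs; exact: q0.
rewrite (_ : \sum_(p <- s) p.1 * (2 * _) = 2 * \sum_(p <- s) p.1 * complex.Re (psi p.2)).
  by rewrite pmulr_rge0.
by rewrite mulr_sumr; apply: eq_bigr => p _; ring.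
Qed.


(** 1 - cos x is of order min(x^2, 1), hence an integrable majorant for any multiplier with values
    in [0, 1]. *)
Let dominated_1Bcos (m : {measure set T -> \bar R}) (h_ : nat -> R -> R) (h : R -> R) :
  m.-integrable setT (EFin \o sqr_min1) ->
  (forall n, measurable_fun (setT : set T) (h_ n)) ->
  (forall x, h_ n x @[n --> \oo] --> h x) -> (forall n x, 0 <= h_ n x <= 1) ->
  \int[m]_x ((1 - cos x) * h_ n x) @[n --> \oo] --> \int[m]_x ((1 - cos x) * h x).
Proof.
move=> hm mh hh h01.
have h1 := integrable_1Bcos hm.
have hc x : setT x -> (1 - cos x) * h_ n x @[n --> \oo] --> (1 - cos x) * h x.
  by move=> _; apply: cvgM; [exact: cvg_cst|exact: hh].
have hb n x : setT x -> `|(1 - cos x) * h_ n x| <= 1 - cos x.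
  by move=> _; have /andP[h0 hle1] := h01 n x; rewrite ger0_norm ?mulr_ge0 ?onemcos_ge0// ler_piMr ?onemcos_ge0.
by have [] := dominated_Rintegral measurableT (mu := m)
  (fun n => measurable_funM measurable_1Bcos (mh n)) hc h1 hb.
Qed.

Variables (M c : R).
Hypothesis M0 : 0 <= M.

(* Squared chords [k^2 (2 - 2 cos (x / k))] are cosine polynomials tending to
   [x ^ 2], and [(1 - g / n) ^ n] tends to [exp (- g)]. *)
Let g (k : nat) (x : R) := M * (k.+1%:R ^+ 2 * (2 - 2 * cos (k.+1%:R^-1 * x)) - c) ^+ 2.

Let g0 k x : 0 <= g k x. Proof. by rewrite mulr_ge0// sqr_ge0. Qed.

Let mg k : measurable_fun (setT : set T) (g k).
Proof.
apply: measurable_funM => //; apply: measurable_funX; apply: measurable_funB => //.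
apply: measurable_funM => //; apply: measurable_funB => //; apply: measurable_funM => //.
exact: measurable_cosM.
Qed.

Let g_cosine k : cosine_polynomial (g k).
Proof.
apply: cosine_polynomialZ; apply: cosine_polynomialX; apply: cosine_polynomialB;
  last exact: cosine_polynomial_cst.
apply: cosine_polynomialZ; apply: cosine_polynomialB; first exact: cosine_polynomial_cst.
by apply: cosine_polynomialZ; exact: cosine_polynomial_cos.
Qed.

(** Boundedness uniform in x makes 1 - g/n lie in [0, 1] for all x from one n on, so that its powers
    are nonnegative and dominated. The function x^2 itself would allow neither this nor a cosine
    polynomial; hence the two successive limits. *)
Let g_bound k : exists B : R, forall x, g k x <= B.
Proof.
set K : R := k.+1%:R; exists (M * (4 * K ^+ 2 + `|c|) ^+ 2) => x.
rewrite /g ler_wpM2l// -[leLHS]real_normK ?num_real// ler_sqr ?nnegrE//; last first.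
  by rewrite addr_ge0// mulr_ge0// sqr_ge0.
rewrite -/K; have := cos_max (K^-1 * x); move: (cos _) => C; rewrite ler_norml => /andP[c1 c2].
have C0 : 0 <= 2 - 2 * C by lra.
have C4 : 2 - 2 * C <= 4 by lra.
apply: (le_trans (ler_normB _ _)); rewrite lerD2r ger0_norm ?mulr_ge0 ?sqr_ge0//.
by rewrite mulrC ler_wpM2r ?sqr_ge0.
Qed.

Let cosine_gaussian_integral_le k : \int[N]_x ((1 - cos x) * expR (- g k x)) <=
  \int[P]_x ((1 - cos x) * expR (- g k x)).
Proof.
have [B gB] := g_bound k.
have [n0 _ hn0] := nbhs_infty_ger B.
pose h_ n x := (1 - g k x / (n + n0).+1%:R) ^+ (n + n0).+1.
have h01 n x : 0 <= h_ n x <= 1.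
  have gn : g k x <= (n + n0).+1%:R.
    by apply: (le_trans (gB x)); apply: hn0; rewrite /= leqW// leq_addl.
  have n1 : (0 : R) < (n + n0).+1%:R by rewrite ltr0n.
  have u0 : 0 <= 1 - g k x / (n + n0).+1%:R by rewrite subr_ge0 ler_pdivrMr// mul1r.
  by rewrite /h_ exprn_ge0//= exprn_ile1// gerBl divr_ge0// ltW.
have mh n : measurable_fun (setT : set T) (h_ n).
  apply: measurable_funX; apply: measurable_funB => //.
  by apply: measurable_funM.
have hh x : h_ n x @[n --> \oo] --> expR (- g k x).
  by have := cvg_euler (g0 k x); rewrite -(cvg_shiftn n0).
apply: (ler_cvg_to (dominated_1Bcos sqrN mh hh h01) (dominated_1Bcos sqrP mh hh h01)).
apply: nearW => n; apply: cosine_polynomial_integral_ge0.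
- apply: cosine_polynomialM.
    apply: cosine_polynomialB; first exact: cosine_polynomial_cst.
    by apply: eq_cosine_polynomial (cosine_polynomial_cos 1) => x; rewrite mul1r.
  apply: cosine_polynomialX; apply: cosine_polynomialB; first exact: cosine_polynomial_cst.
  apply: eq_cosine_polynomial (cosine_polynomialZ (n + n0).+1%:R^-1 (g_cosine k)) => x.
  by rewrite mulrC.
- by move=> x; have /andP[h0 _] := h01 n x; rewrite mulr_ge0 ?onemcos_ge0.
- by rewrite cos0 subrr mul0r.
Qed.

Lemma gaussian_integral_le :
  \int[N]_x ((1 - cos x) * expR (- (M * (x ^+ 2 - c) ^+ 2))) <=
  \int[P]_x ((1 - cos x) * expR (- (M * (x ^+ 2 - c) ^+ 2))).
Proof.
have mh n : measurable_fun (setT : set T) (fun x => expR (- g n x)).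
  by apply: measurableT_comp => //; exact: measurable_funN.
have h01 n x : 0 <= expR (- g n x) <= 1 by rewrite expR_ge0 -expR0 ler_expR oppr_le0 g0.
have hh x : expR (- g n x) @[n --> \oo] --> expR (- (M * (x ^+ 2 - c) ^+ 2)).
  apply: (cvg_comp (fun n => - g n x) expR); last exact: continuous_expR.
  apply: cvgN; apply: cvgM; first exact: cvg_cst.
  rewrite expr2; under eq_fun do rewrite expr2.
  have h : k.+1%:R ^+ 2 * (2 - 2 * cos (k.+1%:R^-1 * x)) - c @[k --> \oo] --> x ^+ 2 - c.
    by apply: cvgB; [exact: cvg_chord_sqr|exact: cvg_cst].
  exact: cvgM.
apply: (ler_cvg_to (dominated_1Bcos sqrN mh hh h01) (dominated_1Bcos sqrP mh hh h01)).
exact/nearW/cosine_gaussian_integral_le.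
Qed.

End positivity.

(** * Failure of infinite divisibility *)

Section not_infinitely_divisible.
Context {R : realType}.
Local Notation T := (measurableTypeR R).
Local Notation leb := (@lebesgue_measure R).
Local Notation half_line := (`]0, +oo[%classic : set T).
Variable sigma : R.
Hypothesis sigma1 : 1 < sigma.

Let sigma0 : 0 < sigma. Proof. exact: lt_trans sigma1. Qed.

(** After division by e^{-sigma x}/x, the pole density contributes 1 + e^x, at least 3, and the
    Gamma density 1/(1 - e^{-2x}), at most 2. *)
Lemma net_density_le (x : R) : 0 < x -> 2 <= expR x ->
  expR (- sigma * x) / x <= - net_density sigma x.
Proof.
move=> x0 e2; rewrite /net_density opprB gamma_densityE// pole_densityE//.
have e0 : 0 < expR x by exact: expR_gt0.
have -> : expR (- (sigma - 1) * x) = expR (- sigma * x) * expR x.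
  by rewrite -expRD; congr expR; ring.
set A := expR (- sigma * x); have A0 : 0 < A / x by rewrite divr_gt0// expR_gt0.
have e4 : expR (- (2 * x)) <= 4^-1.
  rewrite expRN lef_pV2 ?posrE ?expR_gt0//.
  have -> : 2 * x = x + x by ring.
  by rewrite expRD; nra.
have d0 : 0 < 1 - expR (- (2 * x)) by lra.
have -> : A / x + A * expR x / x - A / (x * (1 - expR (- (2 * x)))) =
    A / x * (1 + expR x - (1 - expR (- (2 * x)))^-1).
  by field; rewrite !gt_eqF.
rewrite ler_peMr ?(ltW A0)//.
have : (1 - expR (- (2 * x)))^-1 <= 2 by rewrite invf_ple ?posrE//; lra.
by lra.
Qed.

(* [exp] maps the zone below onto [(25/11, 11/4)], which contains no integer, so no
   atom lies in it, and the net density is negative there. *)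
Let x0 : R := ln (5 / 2).
Let delta : R := ln (11 / 10).
Let zone : set T := (`]x0 - delta, x0 + delta[)%classic.

Let delta0 : 0 < delta. Proof. by apply: ln_gt0; lra. Qed.

Let x0E : expR x0 = 5 / 2. Proof. by rewrite lnK// posrE; lra. Qed.

Let deltaE : expR delta = 11 / 10. Proof. by rewrite lnK// posrE; lra. Qed.

Let lt_delta_x0 : delta < x0. Proof. by rewrite -ltr_expR x0E deltaE; lra. Qed.

(** e^2 >= 3 > 11/4. As 2 <= pi, this keeps the zone where the cosine is decreasing. *)
Let x0D : x0 + delta <= 2.
Proof.
rewrite -ler_expR expRD x0E deltaE; apply: le_trans (expR_ge1Dx 2); lra.
Qed.

Let expR_zone x : zone x -> 25 / 11 < expR x < 11 / 4.
Proof.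
rewrite /zone /= in_itv /= => /andP[h1 h2].
have e1 : expR (x0 - delta) < expR x by rewrite ltr_expR.
have e2 : expR x < expR (x0 + delta) by rewrite ltr_expR.
move: e1 e2; rewrite !expRD expRN x0E deltaE => e1 e2; apply/andP; split; lra.
Qed.

Let zone_gt0 x : zone x -> 0 < x.
Proof. by rewrite /zone /= in_itv /= => /andP[h _]; apply: lt_trans h; rewrite subr_gt0. Qed.

Let mzone : measurable zone. Proof. exact: measurable_itv. Qed.

Lemma jordan_pos_zone : jordan_pos sigma zone = 0%E.
Proof.
rewrite jordan_posE density_null ?add0e.
  rewrite -(setCK zone); apply: primes_support => n n1 /expR_zone.
  rewrite lnK ?posrE ?ltr0n ?(ltn_trans _ n1)// => /andP[h1 h2].
  have : (2 < n)%N by rewrite -(ltr_nat R); lra.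
  by rewrite -(ler_nat R); lra.
move=> x xz; have /andP[e1 _] := expR_zone xz; have xp := zone_gt0 xz.
apply: max_r; rewrite -oppr_ge0; apply: le_trans (net_density_le xp _); last lra.
by rewrite divr_ge0 ?expR_ge0// ltW.
Qed.

Let weight_far x : 0 < x -> ~ zone x -> delta ^+ 2 * x0 ^+ 2 <= (x ^+ 2 - x0 ^+ 2) ^+ 2.
Proof.
move=> xp xz; have h : delta <= `|x - x0|.
  rewrite leNgt; apply/negP; rewrite ltr_norml => /andP[h1 h2]; apply: xz.
  by rewrite /zone /= in_itv /=; apply/andP; split; lra.
have x00 : 0 < x0 by exact: lt_trans lt_delta_x0.
rewrite subr_sqr exprMn -[(x - x0) ^+ 2]real_normK ?num_real//.
by rewrite ler_pM ?exprn_ge0 ?(ltW x00) ?(ltW delta0)// lerXn2r ?nnegrE ?(ltW delta0)//; lra.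
Qed.

(** The radius delta/6 makes the weight on the core at most a quarter of its lower bound off the
    zone: with |x + x0| <= 3 x0 one gets (delta/6)^2 (3 x0)^2 = delta^2 x0^2 / 4. *)
Let core : set T := (`[x0 - delta / 6, x0 + delta / 6])%classic.

Let mcore : measurable core. Proof. exact: measurable_itv. Qed.

Let weight_core x : core x -> (x ^+ 2 - x0 ^+ 2) ^+ 2 <= delta ^+ 2 * x0 ^+ 2 / 4.
Proof.
rewrite /core /= in_itv /= => /andP[h1 h2].
have x00 : 0 < x0 by exact: lt_trans lt_delta_x0.
have d0 := delta0; have dx := lt_delta_x0.
rewrite subr_sqr exprMn.
have k1 : (x - x0) ^+ 2 <= (delta / 6) ^+ 2.
  rewrite -[leLHS]real_normK ?num_real// lerXn2r ?nnegrE ?normr_ge0//; first lra.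
  by rewrite ler_norml; apply/andP; split; lra.
have k2 : (x + x0) ^+ 2 <= (3 * x0) ^+ 2 by rewrite lerXn2r ?nnegrE//; lra.
apply: (@le_trans _ _ ((delta / 6) ^+ 2 * (3 * x0) ^+ 2)).
  by rewrite ler_pM ?sqr_ge0.
by rewrite le_eqVlt; apply/orP; left; apply/eqP; field.
Qed.

Let core_zone x : core x -> zone x.
Proof.
rewrite /core /zone /= !in_itv /= => /andP[h1 h2]; have d0 := delta0.
by apply/andP; split; lra.
Qed.

(** The minimum of 1 - cos on the core, attained at its left end because the cosine decreases on
    [0, pi]. *)
Let kappa : R := 1 - cos (x0 - delta / 6).

Let kappa0 : 0 < kappa.
Proof.
have d0 := delta0; have dx := lt_delta_x0; have x2 := x0D; have p2 := pi_ge2 R.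
by rewrite subr_gt0 -[ltRHS]cos0 ltr_cos ?in_itv /= ?lexx ?pi_ge0//; [lra|apply/andP; split; lra].
Qed.

Let kappa_core x : core x -> kappa <= 1 - cos x.
Proof.
have d0 := delta0; have dx := lt_delta_x0; have x2 := x0D; have p2 := pi_ge2 R.
rewrite /core /= in_itv /= => /andP[h1 h2].
rewrite lerD2l lerN2; move: h1; rewrite le_eqVlt => /predU1P[->//|h1].
by rewrite ltW// ltr_cos ?in_itv//=; apply/andP; split; lra.
Qed.

Let neg_density_core x : core x -> expR (- sigma * 2) / 2 <= neg_density sigma x.
Proof.
move=> /core_zone xz; have xp := zone_gt0 xz; have /andP[e1 _] := expR_zone xz.
have x2 : x <= 2.
  by move: xz; rewrite /zone /= in_itv /= => /andP[_ h]; apply: (le_trans (ltW h)); exact: x0D.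
apply: (@le_trans _ _ (- net_density sigma x)); last by rewrite /neg_density le_max lexx.
apply: le_trans (net_density_le xp _); last lra.
rewrite ler_pM ?expR_ge0// ?invr_ge0// ?lef_pV2 ?posrE//.
by rewrite ler_expR !mulNr lerN2 ler_wpM2l// ltW.
Qed.

Variable mu : probability T R.
Hypothesis mu_Xi : forall t, charfun mu t = Xi sigma t.
Hypothesis mu_id : infinitely_divisible mu.

Let test (M x : R) := (1 - cos x) * expR (- (M * (x ^+ 2 - x0 ^+ 2) ^+ 2)).

Let test_le M : 0 <= M ->
  \int[jordan_neg sigma]_x test M x <= \int[jordan_pos sigma]_x test M x.
Proof.
move=> M0.
apply: (gaussian_integral_le mu_id (psi := fun t => (t * lambda sigma)*i +
  signed_integral (nu_pos sigma) (nu_neg sigma) half_line (LK_integrand (1 / 2) t))) => //.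
- by move=> t; rewrite mu_Xi Xi_levy_khintchine.
- exact: sqr_min1_jordan_pos.
- exact: sqr_min1_jordan_negT.
- have h0 : (0 : R) < 1 / 2 by exact: half_gt0.
  move=> t; rewrite ReD -(signed_integral_jordan sigma1 _ h0).
  rewrite -[complex.Re (_ *i)]/0 add0r /signed_integral ReB !Re_Cintegral.
  by congr (_ - _); apply: eq_Rintegral => x _; rewrite Re_LK.
Qed.

Let measurable_test M : measurable_fun (setT : set T) (test M).
Proof.
apply: measurable_funM; first exact: measurable_1Bcos.
apply: measurableT_comp => //; apply: measurable_funN; apply: measurable_funM => //.
by apply: measurable_funX; apply: measurable_funB => //; exact: measurable_funX.
Qed.

Let test_ge0 M x : 0 <= test M x.
Proof. by rewrite mulr_ge0 ?expR_ge0 ?onemcos_ge0. Qed.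

Let integrable_test (m : {measure set T -> \bar R}) M : 0 <= M ->
  m.-integrable setT (EFin \o sqr_min1) -> m.-integrable setT (EFin \o test M).
Proof.
move=> M0 hm.
apply: (le_real_integrable measurableT (measurable_test M) (integrable_1Bcos hm)) => x _.
by rewrite ger0_norm// ler_piMr ?onemcos_ge0// -expR0 ler_expR oppr_le0 mulr_ge0// sqr_ge0.
Qed.

(** The positive part does not charge the zone, and off the zone [weight_far] bounds the exponential
    uniformly. C is the integral of 1 - cos x there. *)
Let jordan_pos_test : exists2 C : R, 0 <= C & forall M, 0 <= M ->
  \int[jordan_pos sigma]_x test M x <= C * expR (- (M * (delta ^+ 2 * x0 ^+ 2))).
Proof.
pose E : set T := half_line `&` ~` zone.
have mE : measurable E by apply: measurableI; [exact: measurable_0y|exact: measurableC].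
have E0 : jordan_pos sigma (~` E) = 0%E.
  rewrite /E setCI setCK; apply: null_set_setU => //.
  - by apply: measurableC; exact: measurable_0y.
  - exact: jordan_pos_half_line.
  - exact: jordan_pos_zone.
have sq := sqr_min1_jordan_pos sigma1.
have i1 : (jordan_pos sigma).-integrable E (EFin \o (fun x : T => 1 - cos x)).
  by apply: integrableS (integrable_1Bcos sq).
exists (\int[jordan_pos sigma]_(x in E) (1 - cos x)) => [|M M0].
  by apply: Rintegral_ge0 => x _; exact: onemcos_ge0.
rewrite (Rintegral_support mE E0 (integrable_test M0 sq)) mulrC -RintegralZl//.
apply: le_Rintegral => //.
- by apply: integrableS (integrable_test M0 sq).
- exact: real_integrableZl.
- move=> x [x_gt0 xz]; rewrite /test mulrC ler_wpM2r ?onemcos_ge0// ler_expR lerN2 ler_wpM2l//.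
  by apply: weight_far => //; move: x_gt0; rewrite /= in_itv /= andbT.
Qed.

(** Only the core is kept. Its length delta/3 is multiplied by lower bounds for 1 - cos x, for the
    negative density and, through [weight_core], for the exponential. *)
Let jordan_neg_test : exists2 c : R, 0 < c & forall M, 0 <= M ->
  c * expR (- (M * (delta ^+ 2 * x0 ^+ 2 / 4))) <= \int[jordan_neg sigma]_x test M x.
Proof.
exists (kappa * (expR (- sigma * 2) / 2) * (delta / 3)).
  by rewrite !mulr_gt0// expR_gt0.
move=> M M0; have sq := sqr_min1_jordan_negT sigma1.
have it := integrable_test M0 sq.
have id : leb.-integrable setT (EFin \o (fun x => test M x * neg_density sigma x)).
  exact: density_integrable it.
rewrite Rintegral_density//.
have core_len : leb core = (delta / 3)%:E.
  rewrite /core; have := @lebesgue_measure_itv R `[x0 - delta / 6, x0 + delta / 6]%R.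
  rewrite /= lte_fin ifT; last by have d0 := delta0; lra.
  by move=> ->; rewrite -EFinB; congr EFin; field.
pose k := kappa * expR (- (M * (delta ^+ 2 * x0 ^+ 2 / 4))) * (expR (- sigma * 2) / 2).
apply: (@le_trans _ _ (\int[leb]_(x in core) (test M x * neg_density sigma x))); last first.
  rewrite /Rintegral fine_le ?integrable_fin_num//.
    by apply: integrableS id.
  apply: ge0_subset_integral => //.
    by case/integrableP : id.
  by move=> x _; rewrite lee_fin mulr_ge0// neg_density_ge0.
apply: (@le_trans _ _ (\int[leb]_(x in core) k)).
  have -> : \int[leb]_(x in core) k = k * fine (leb core) by exact: Rintegral_cst.
  rewrite core_len /= /k le_eqVlt; apply/orP; left; apply/eqP; ring.
apply: le_Rintegral => //.
- have core_fin : (leb core < +oo)%E by rewrite core_len ltry.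
  exact: real_integrable_cst.
- by apply: integrableS id.
- move=> x xc; rewrite /k ler_pM ?mulr_ge0 ?expR_ge0 ?(ltW kappa0) ?invr_ge0//; last exact: neg_density_core.
  rewrite ler_pM ?expR_ge0 ?(ltW kappa0) ?kappa_core// ler_expR lerN2 ler_wpM2l//.
  exact: weight_core.
Qed.

Lemma infinitely_divisible_absurd : False.
Proof.
have [C C0 hC] := jordan_pos_test; have [c c0 hc] := jordan_neg_test.
pose w := delta ^+ 2 * x0 ^+ 2.
have w0 : 0 < w by rewrite mulr_gt0// exprn_gt0// (lt_trans _ lt_delta_x0).
(* The two decay rates differ by (3/4) w M, which this choice makes equal to C/c. The inequality
   becomes c e^{C/c} <= C, against e^y >= 1 + y; an explicit M thus replaces the limit. *)
pose M := C / c / (3 / 4 * w).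
have w34 : 0 < 3 / 4 * w by rewrite mulr_gt0// divr_gt0.
have M0 : 0 <= M by apply: divr_ge0; [apply: divr_ge0 => //|]; exact: ltW.
have h := le_trans (hc M M0) (le_trans (test_le M0) (hC M M0)).
rewrite -/w in h.
have e1 : expR (- (M * (w / 4))) = expR (- (M * w)) * expR (C / c).
  rewrite -expRD; congr expR; rewrite /M; field.
  by rewrite !gt_eqF.
move: h; rewrite e1 mulrCA [leRHS]mulrC ler_pM2l ?expR_gt0// => h.
have := expR_ge1Dx (C / c); rewrite -(ler_pM2l c0) => h2.
have := le_trans h2 h; rewrite mulrDr mulr1 mulrCA divff ?gt_eqF// mulr1.
by rewrite gerDr leNgt c0.
Qed.

End not_infinitely_divisible.

Unset Implicit Arguments.

Theorem theorem1p4 (R : realType) (sigma : R) (hsigma : 1 < sigma) :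
  (forall t : R,
     Xi sigma t =
     cexp ((t * lambda sigma)*i
           + signed_integral (nu_pos sigma) (nu_neg sigma) `]0, +oo[
               (LK_integrand (1 / 2) t)))
  /\ (forall mu : probability (measurableTypeR R) R,
        (forall t : R, charfun mu t = Xi sigma t) ->
        ~ infinitely_divisible mu
        /\ (forall b : R, 0 < b -> quasi_infinitely_divisible b mu)).
Proof.
split=> [t|mu hmu]; first exact: Xi_levy_khintchine.
split=> [|b b0]; last exact: (quasi_infinitely_divisible_Xi hsigma hmu b0).
exact: (infinitely_divisible_absurd hsigma hmu).
Qed.
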